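(* Let $M\in GL_n$ be a semisimple matrix each of whose (possible) negative eigenvalues has even multiplicity. Then: (a) every connected component of $\mathcal{SR}(M)$ is a closed totally geodesic homogeneous semi-Riemannian submanifold of $(GL_n,g)$, where $g$ is the trace metric; (b) for all admissible indices ($0\le u_i\le h_i$, $0\le\mu_{lt}\le m_{lt}$) the manifold $\mathcal{SR}(M)_{(u_1,\dots,u_p)}^{(\mu_{11},\dots,\mu_{1s_1};\dots;\mu_{r1},\dots,\mu_{rs_r})}$ is diffeomorphic to the following product of homogeneous spaces: $$\Big(\prod_{i=1}^p\frac{GL_{h_i}}{GL_{u_i}\oplus GL_{v_i}}\Big)\times\Big(\prod_{l=1}^r\prod_{t=1}^{s_l}\frac{GL_{m_{lt}}(\mathbb{C})}{GL_{\mu_{lt}}(\mathbb{C})\oplus GL_{\nu_{lt}}(\mathbb{C})}\Big)\times\Big(\prod_{i=1}^q\frac{GL_{2k_i}}{GL_{k_i}(\mathbb{C})}\Big),$$ where $v_i=h_i-u_i$ and $\nu_{lt}=m_{lt}-\mu_{lt}$.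
   Context: $GL_n$ is the group of real non-singular $n\times n$ matrices, $GL_n(\mathbb{C})$ the complex one. A real matrix is semisimple if it is diagonalizable over $\mathbb{C}$. The trace metric $g$ on $GL_n$ is the semi-Riemannian metric $g_A(V,W)=\mathrm{tr}(A^{-1}VA^{-1}W)$ for $A\in GL_n$ and $V,W\in T_A(GL_n)=M_n$ (real $n\times n$ matrices). Eigenvalues of $M$. Let $M\in GL_n$ be semisimple with every negative eigenvalue of even multiplicity. Its eigenvalues are denoted as follows: (i) distinct positive eigenvalues $\lambda_1<\dots<\lambda_p$ ($p\ge0$) with multiplicities $h_1,\dots,h_p$; (ii) distinct non-real eigenvalues $\rho_{lt}\exp(\pm\mathbf{i}\theta_l)$, $1\le l\le r$, $1\le t\le s_l$ ($r\ge0$), both $\rho_{lt}\exp(\pm\mathbf{i}\theta_l)$ having multiplicity $m_{lt}$, where $0<\theta_1<\dots<\theta_r<\pi$ and $0<\rho_{l1}<\dots<\rho_{ls_l}$ for each $l$; (iii) distinct negative eigenvalues $-\zeta_1>\dots>-\zeta_q$ ($q\ge0$) with multiplicities $2k_1,\dots,2k_q$. $\mathcal{SR}(M)$ is the set of all real $n\times n$ matrices $Y$ with $Y^2=M$. For integers $0\le u_i\le h_i$, $0\le\mu_{lt}\le m_{lt}$, with $v_i=h_i-u_i$, $\nu_{lt}=m_{lt}-\mu_{lt}$, the set $\mathcal{SR}(M)_{(u_1,\dots,u_p)}^{(\mu_{11},\dots,\mu_{1s_1};\dots;\mu_{r1},\dots,\mu_{rs_r})}$ consists of the $Y\in\mathcal{SR}(M)$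 whose eigenvalues are: $\sqrt{\lambda_i}$ with multiplicity $u_i$ and $-\sqrt{\lambda_i}$ with multiplicity $v_i$; $\sqrt{\rho_{lt}}\exp(\pm\mathbf{i}\theta_l/2)$ both with multiplicity $\mu_{lt}$ and $\sqrt{\rho_{lt}}\exp(\pm\mathbf{i}(\theta_l/2-\pi))$ both with multiplicity $\nu_{lt}$; $\pm\sqrt{\zeta_i}\,\mathbf{i}$ both with multiplicity $k_i$. It is regarded as an embedded submanifold of $GL_n$. One or both families of indices may be empty (when $p=0$ and/or $r=0$), in which case they are omitted from the notation, and empty products are omitted. Conventions: $GL_u\oplus GL_v$ denotes the group of block-diagonal matrices $A\oplus B$ with $A\in GL_u$, $B\in GL_v$ (a subgroup of $GL_{u+v}$; similarly over $\mathbb{C}$); blocks of size $0$ are omitted. $GL_k(\mathbb{C})$ is regarded as a Lie subgroup of $GL_{2k}$ through the monomorphism $\rho_k$ that replaces each entry $z$ of a complex matrix by the $2\times2$ real block $\begin{pmatrix}\mathrm{Re}\,z&-\mathrm{Im}\,z\\ \mathrm{Im}\,z&\mathrm{Re}\,z\end{pmatrix}$. *)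

(* Defs.v *)
From HB Require Import structures.
From mathcomp Require Import all_boot all_order all_algebra.
From mathcomp Require Import all_classical all_reals all_analysis.
From mathcomp Require Import complex.

Set Implicit Arguments.
Unset Strict Implicit.
Unset Printing Implicit Defensive.

Import Order.TTheory GRing.Theory Num.Theory numFieldNormedType.Exports.
Local Open Scope classical_set_scope.
Local Open Scope ring_scope.
Local Open Scope complex_scope.

(* 'D_(v1) ('D_(v2) (... f)) for vs = [:: v1; v2; ...] *)
Definition iter_derive (R : realType) (V W : normedModType R)
    (vs : seq V) (f : V -> W) : V -> W :=
  foldr (fun v (g : V -> W) => fun x : V => 'D_v g x) f vs.

(* C^oo on the open set U.  Only used for finite-dimensional V and W, where   *)
(* differentiability of all iterated directional derivatives is the same as   *)
(* existence and continuity of the partial derivatives of every order.        *)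
Definition smooth_on (R : realType) (V W : normedModType R)
    (U : set V) (f : V -> W) : Prop :=
  forall (vs : seq V) (x : V), U x -> differentiable (iter_derive vs f) x.

(* smoothness on an arbitrary subset: local smooth extendability *)
Definition smooth_on_subset (R : realType) (V W : normedModType R)
    (S : set V) (f : V -> W) : Prop :=
  forall x, S x -> exists (U : set V) (F : V -> W),
    [/\ open U, U x, smooth_on U F & forall y, U y -> S y -> F y = f y].

Record chart (R : realType) (T : Type) := Chart {
  cdim : nat;
  cdom : set T;
  cmap : T -> 'rV[R]_cdim;
  cinv : 'rV[R]_cdim -> T }.
Arguments cdim {R T} c.
Arguments cdom {R T} c _.
Arguments cmap {R T} c _.
Arguments cinv {R T} c _.

Definition cimage (R : realType) (T : Type) (c : chart R T) :
  set 'rV[R]_(cdim c) := cmap c @` cdom c.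
Arguments cimage {R T} c _.

Definition is_chart (R : realType) (T : Type) (c : chart R T) : Prop :=
  open (cimage c) /\ forall x, cdom c x -> cinv c (cmap c x) = x.

(* The only values considered are [submfd S], [homspace G H] and their finite *)
(* products, whose charts are pairwise smoothly compatible by construction.   *)
Record mfd (R : realType) := Mfd {
  mtype : Type;
  carrier : set mtype;
  charts : set (chart R mtype) }.
Arguments mtype {R} X : rename.
Arguments carrier {R} X _ : rename.
Arguments charts {R} X _ : rename.

Definition smooth_map (R : realType) (X Y : mfd R) (f : mtype X -> mtype Y) :
    Prop :=
  forall x, carrier X x -> exists (c : chart R (mtype X)) (d : chart R (mtype Y)),
    [/\ charts X c /\ charts Y d, cdom c x, f @` cdom c `<=` cdom d &
        smooth_on (cimage c) (fun z => cmap d (f (cinv c z)))].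

Definition is_diffeo (R : realType) (X Y : mfd R) (f : mtype X -> mtype Y) :
    Prop :=
  exists f' : mtype Y -> mtype X,
    [/\ forall x, carrier X x -> carrier Y (f x) /\ f' (f x) = x,
        forall y, carrier Y y -> carrier X (f' y) /\ f (f' y) = y,
        smooth_map (X := X) (Y := Y) f & smooth_map (X := Y) (Y := X) f'].

Definition diffeomorphic (R : realType) (X Y : mfd R) : Prop :=
  exists f : mtype X -> mtype Y, is_diffeo f.

(* Product manifolds; the model space of a product chart is the concatenation *)
(* of the model spaces of its factors.                                        *)

Definition prod_chart (R : realType) (N : nat) (T : 'I_N -> Type)
    (c : forall i, chart R (T i)) : chart R (forall i, T i) :=
  @Chart R (forall i, T i) (\sum_(i < N) cdim (c i))%N
    [set x | forall i, cdom (c i) (x i)]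
    (fun x => \mxrow_(i < N) cmap (c i) (x i))
    (fun v => fun i => cinv (c i) (submxrow v i)).

Definition prod_mfd (R : realType) (N : nat) (X : 'I_N -> mfd R) : mfd R :=
  @Mfd R (forall i, mtype (X i))
    [set x | forall i, carrier (X i) (x i)]
    [set prod_chart c | c in [set c | forall i, charts (X i) (c i)]].

Definition pair_chart (R : realType) (S T : Type)
    (c : chart R S) (d : chart R T) : chart R (S * T) :=
  @Chart R (S * T)%type (cdim c + cdim d)%N
    [set x | cdom c x.1 /\ cdom d x.2]
    (fun x => row_mx (cmap c x.1) (cmap d x.2))
    (fun v => (cinv c (lsubmx v), cinv d (rsubmx v))).

Definition pair_mfd (R : realType) (X Y : mfd R) : mfd R :=
  @Mfd R (mtype X * mtype Y)%type
    [set x | carrier X x.1 /\ carrier Y x.2]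
    [set pair_chart cd.1 cd.2
      | cd in [set cd | charts X cd.1 /\ charts Y cd.2]].

(* local coordinates of S: diffeomorphisms from relatively open subsets of S  *)
(* onto open subsets of R^d                                                   *)
Definition submfd (R : realType) (k : nat) (S : set 'M[R]_k) : mfd R :=
  @Mfd R 'M[R]_k S
    [set c | [/\ is_chart c,
                 exists2 O : set 'M[R]_k, open O & cdom c = S `&` O,
                 smooth_on_subset (cdom c) (cmap c) &
                 smooth_on (cimage c) (cinv c)]].

Definition embedded_submanifold (R : realType) (k : nat) (S : set 'M[R]_k) :
    Prop :=
  exists d : nat, forall x, S x ->
    exists c, [/\ charts (submfd S) c, cdim c = d & cdom c x].

Definition curve_from (R : realType) (k : nat) (S : set 'M[R]_k)
    (x : 'M[R]_k) (gamma : R -> 'M[R]_k) : Prop :=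
  gamma 0 = x /\ exists2 e : R, 0 < e &
    smooth_on (ball (0 : R) e) gamma /\
    forall t, ball (0 : R) e t -> S (gamma t).

Definition tangent (R : realType) (k : nat) (S : set 'M[R]_k)
    (x : 'M[R]_k) : set 'M[R]_k :=
  [set V | exists2 gamma, curve_from S x gamma & derive1 gamma 0 = V].

(* V' is the image of the tangent vector V under the differential of f at x *)
Definition differential_at (R : realType) (k : nat) (S : set 'M[R]_k)
    (f : 'M[R]_k -> 'M[R]_k) (x V V' : 'M[R]_k) : Prop :=
  exists gamma, [/\ curve_from S x gamma, derive1 gamma 0 = V &
                    derive1 (f \o gamma) 0 = V'].

Definition lcoset_mx (R : realType) (k : nat) (H : set 'M[R]_k)
    (g : 'M[R]_k) : set 'M[R]_k := [set g *m h | h in H].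

(* G / H for G an embedded Lie subgroup of GL_k and H a closed subgroup of G. *)
(* Its manifold structure is the unique one for which the projection is       *)
(* smooth and has smooth local sections around each point of G / H.           *)
Definition homspace (R : realType) (k : nat) (G H : set 'M[R]_k) : mfd R :=
  @Mfd R (set 'M[R]_k) (lcoset_mx H @` G)
    [set c | [/\ is_chart c,
                 cdom c `<=` lcoset_mx H @` G,
                 exists2 O : set 'M[R]_k, open O &
                   [set g | G g /\ cdom c (lcoset_mx H g)] = G `&` O,
                 smooth_on_subset [set g | G g /\ cdom c (lcoset_mx H g)]
                   (fun g => cmap c (lcoset_mx H g)) &
                 forall z, cimage c z -> exists (O : set 'rV[R]_(cdim c))
                     (sigma : 'rV[R]_(cdim c) -> 'M[R]_k),
                   [/\ open O, O z, O `<=` cimage c, smooth_on O sigma &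
                       forall w, O w ->
                         G (sigma w) /\ lcoset_mx H (sigma w) = cinv c w]]].

Definition GL (F : comUnitRingType) (k : nat) : set 'M[F]_k :=
  [set A | A \in unitmx].

(* GL_u (+) GL_v as a subgroup of GL_h, where h = u + v *)
Definition GLsum (F : comUnitRingType) (u v h : nat) : set 'M[F]_h :=
  [set C | exists (e : (u + v)%N = h) (A : 'M[F]_u) (B : 'M[F]_v),
     [/\ GL A, GL B & C = castmx (e, e) (block_mx A 0 0 B)]].

Definition half_ord (k : nat) (a : 'I_(k.*2)) : 'I_k :=
  Ordinal (etrans (ltn_half_double a k) (ltn_ord a)).

(* every entry z becomes the block (Re z, - Im z; Im z, Re z) *)
Definition realify (R : realType) (k : nat) (A : 'M[R[i]]_k) : 'M[R]_(k.*2) :=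
  \matrix_(a, b)
    let z := A (half_ord a) (half_ord b) in
    if odd a == odd b then complex.Re z
    else if odd a then complex.Im z else - complex.Im z.

Definition GLC (R : realType) (k : nat) : set 'M[R]_(k.*2) :=
  @realify R k @` @GL R[i] k.

Definition GLCsum (R : realType) (u v h : nat) : set 'M[R]_(h.*2) :=
  @realify R h @` @GLsum R[i] u v h.

(* In what follows the ambient space is an open subset of 'M[R]_k with the    *)
(* metric g; tangent vectors are matrices.                                    *)

Definition metric_index (R : realType) (k : nat)
    (b : 'M[R]_k -> 'M[R]_k -> R) (T : set 'M[R]_k) (nu : nat) : Prop :=
  let negdef (W : {vspace 'M[R]_k}) :=
    (forall V, V \in W -> T V) /\
    (forall V, V \in W -> V != 0 -> b V V < 0) in
  (exists2 W : {vspace 'M[R]_k}, negdef W & \dim W = nu) /\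
  (forall W : {vspace 'M[R]_k}, negdef W -> (\dim W <= nu)%N).

(* the pull-back of g is nondegenerate and has constant index *)
Definition semi_riemannian_submanifold (R : realType) (k : nat)
    (g : 'M[R]_k -> 'M[R]_k -> 'M[R]_k -> R) (S : set 'M[R]_k) : Prop :=
  [/\ embedded_submanifold S,
      forall x V, S x -> tangent S x V ->
        (forall W, tangent S x W -> g x V W = 0) -> V = 0 &
      exists nu, forall x, S x -> metric_index (g x) (tangent S x) nu].

(* Z is the Levi-Civita covariant derivative of the vector field Y along V at *)
(* x: the directional derivative plus the Christoffel term                    *)
(*   Gamma_(ij,k) = (d_i g_jk + d_j g_ik - d_k g_ij) / 2.                     *)
Definition levi_civita (R : realType) (k : nat)
    (g : 'M[R]_k -> 'M[R]_k -> 'M[R]_k -> R)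
    (Y : 'M[R]_k -> 'M[R]_k) (x V Z : 'M[R]_k) : Prop :=
  forall W : 'M[R]_k,
    g x Z W = g x ('D_V Y x) W
      + 2^-1 * ('D_V (fun y => g y (Y x) W : R) x
                + 'D_(Y x) (fun y => g y V W : R) x
                - 'D_W (fun y => g y V (Y x) : R) x).

(* The second fundamental form vanishes: the ambient covariant derivative of  *)
(* a (locally extended) tangent field along a tangent vector is tangent.      *)
Definition totally_geodesic (R : realType) (k : nat)
    (g : 'M[R]_k -> 'M[R]_k -> 'M[R]_k -> R) (S : set 'M[R]_k) : Prop :=
  forall (U : set 'M[R]_k) (Y : 'M[R]_k -> 'M[R]_k) (x V : 'M[R]_k),
    open U -> smooth_on U Y -> (forall y, S y -> U y -> tangent S y (Y y)) ->
    S x -> U x -> tangent S x V ->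
    exists2 Z, levi_civita g Y x V Z & tangent S x Z.

Definition isometry_of (R : realType) (k : nat)
    (g : 'M[R]_k -> 'M[R]_k -> 'M[R]_k -> R) (S : set 'M[R]_k)
    (f : 'M[R]_k -> 'M[R]_k) : Prop :=
  is_diffeo (X := submfd S) (Y := submfd S) f /\
  forall x V W V' W', S x ->
    differential_at S f x V V' -> differential_at S f x W W' ->
    g (f x) V' W' = g x V W.

Definition homogeneous (R : realType) (k : nat)
    (g : 'M[R]_k -> 'M[R]_k -> 'M[R]_k -> R) (S : set 'M[R]_k) : Prop :=
  forall x y, S x -> S y -> exists2 f, isometry_of g S f & f x = y.

Definition closed_in (T : topologicalType) (X S : set T) : Prop :=
  S `<=` X /\ closure S `&` X `<=` S.

Definition trace_metric (R : realType) (n : nat) (A V W : 'M[R]_n) : R :=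
  \tr (invmx A *m V *m invmx A *m W).

Definition complexify (R : realType) (n : nat) (A : 'M[R]_n) : 'M[R[i]]_n :=
  map_mx (real_complex R) A.

Definition semisimple (R : realType) (n : nat) (A : 'M[R]_n) : Prop :=
  diagonalizable (complexify A).

Definition even_negative_eigenvalues (R : realType) (n : nat) (A : 'M[R]_n) :
    Prop :=
  forall a : R, a < 0 -> eigenvalue A a -> ~~ odd (mup a (char_poly A)).

(* r exp(i t) *)
Definition polar (R : realType) (r t : R) : R[i] := (r * cos t) +i* (r * sin t).

(* the monic polynomials with a single root z, resp. with roots r exp(+-i t) *)
Definition lin_factor (R : realType) (z : R[i]) : {poly R[i]} := 'X - z%:P.
Definition conj_factor (R : realType) (r t : R) : {poly R[i]} :=
  lin_factor (polar r t) * lin_factor (polar r (- t)).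

(* Distinct eigenvalues and multiplicities: ed_lam i (ed_h i times);          *)
(* ed_rho l t * exp(+-i ed_theta l) (ed_m l t times each);                    *)
(* - ed_zeta i (2 * ed_k i times).                                            *)
Record eigendata (R : realType) := EigenData {
  ed_p : nat;
  ed_lam : 'I_ed_p -> R;
  ed_h : 'I_ed_p -> nat;
  ed_r : nat;
  ed_theta : 'I_ed_r -> R;
  ed_s : 'I_ed_r -> nat;
  ed_rho : forall l, 'I_(ed_s l) -> R;
  ed_m : forall l, 'I_(ed_s l) -> nat;
  ed_q : nat;
  ed_zeta : 'I_ed_q -> R;
  ed_k : 'I_ed_q -> nat }.
Arguments ed_p {R} d : rename.
Arguments ed_lam {R} d i : rename.
Arguments ed_h {R} d i : rename.
Arguments ed_r {R} d : rename.
Arguments ed_theta {R} d l : rename.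
Arguments ed_s {R} d l : rename.
Arguments ed_rho {R} d l t : rename.
Arguments ed_m {R} d l t : rename.
Arguments ed_q {R} d : rename.
Arguments ed_zeta {R} d i : rename.
Arguments ed_k {R} d i : rename.

Definition pos_increasing (R : realType) (N : nat) (a : 'I_N -> R) : Prop :=
  (forall i, 0 < a i) /\ (forall i j : 'I_N, (i < j)%N -> a i < a j).

Definition eigendata_of (R : realType) (n : nat) (M : 'M[R]_n)
    (d : eigendata R) : Prop :=
  [/\ [/\ pos_increasing (ed_lam d),
          pos_increasing (ed_theta d) /\ (forall l, ed_theta d l < pi),
          forall l, pos_increasing (ed_rho d l) &
          pos_increasing (ed_zeta d)],
      [/\ forall i, (0 < ed_h d i)%N,
          forall l, (0 < ed_s d l)%N,
          forall l t, (0 < ed_m d l t)%N &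
          forall i, (0 < ed_k d i)%N] &
      char_poly (complexify M) =
        (\prod_(i < ed_p d) lin_factor (ed_lam d i)%:C ^+ (ed_h d i)) *
        (\prod_(l < ed_r d) \prod_(t < ed_s d l)
           conj_factor (ed_rho d l t) (ed_theta d l) ^+ (ed_m d l t)) *
        (\prod_(i < ed_q d)
           lin_factor (- (ed_zeta d i)%:C) ^+ (ed_k d i).*2)].

Definition SR (R : realType) (n : nat) (M : 'M[R]_n) : set 'M[R]_n :=
  [set Y | Y *m Y = M].

(* SR(M)_(u)^(mu); all the listed eigenvalues of Y are pairwise distinct, so   *)
(* the exponents are their multiplicities.                                    *)
Definition SR_index (R : realType) (n : nat) (M : 'M[R]_n) (d : eigendata R)
    (u : 'I_(ed_p d) -> nat) (mu : forall l, 'I_(ed_s d l) -> nat) :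
    set 'M[R]_n :=
  [set Y | SR M Y /\
    char_poly (complexify Y) =
      (\prod_(i < ed_p d)
         (lin_factor (Num.sqrt (ed_lam d i))%:C ^+ u i *
          lin_factor (- (Num.sqrt (ed_lam d i))%:C)
            ^+ (ed_h d i - u i))) *
      (\prod_(l < ed_r d) \prod_(t < ed_s d l)
         (conj_factor (Num.sqrt (ed_rho d l t)) (ed_theta d l / 2)
            ^+ mu l t *
          conj_factor (Num.sqrt (ed_rho d l t)) (ed_theta d l / 2 - pi)
            ^+ (ed_m d l t - mu l t))) *
      (\prod_(i < ed_q d)
         (lin_factor (0 +i* Num.sqrt (ed_zeta d i)) ^+ (ed_k d i) *
          lin_factor (- (0 +i* Num.sqrt (ed_zeta d i))) ^+ (ed_k d i)))].

Definition homspace_product (R : realType) (d : eigendata R)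
    (u : 'I_(ed_p d) -> nat) (mu : forall l, 'I_(ed_s d l) -> nat) : mfd R :=
  pair_mfd
    (pair_mfd
      (prod_mfd (fun i : 'I_(ed_p d) =>
         homspace (@GL R (ed_h d i))
                  (@GLsum R (u i) (ed_h d i - u i) (ed_h d i))))
      (prod_mfd (fun l : 'I_(ed_r d) => prod_mfd (fun t : 'I_(ed_s d l) =>
         homspace (@GLC R (ed_m d l t))
                  (@GLCsum R (mu l t) (ed_m d l t - mu l t)
                     (ed_m d l t))))))
    (prod_mfd (fun i : 'I_(ed_q d) =>
       homspace (@GL R (ed_k d i).*2) (@GLC R (ed_k d i)))).

(* Main.v *)
Require Import Defs.
From HB Require Import structures.
From mathcomp Require Import all_boot all_order all_algebra.
From mathcomp Require Import all_classical all_reals all_analysis.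
From mathcomp Require Import complex perm ring lra zify.

(** The reason for both parts is that the set of square roots of [M] is locally
    linear. If [x] and [Y] are square roots of [M], then [Y + x] commutes with [M]
    and [Y (Y + x) = (Y + x) x]; so as soon as [Y + x] is invertible, [Y] is
    conjugate to [x] under the centralizer of [M]. Moreover
    [K = (Y - x) (Y + x)^-1] anticommutes with [x] and
    [Y = (1 + K) x (1 + K)^-1]. Conversely every [K] anticommuting with [x], with
    [1 + K] invertible, gives a square root. This Cayley transform is a chart around
    [x] whose model is the linear space of matrices anticommuting with [x], which is
    therefore the tangent space ([cayleyK], [icayleyK], [cayley_chart_submfd],
    [tangentP]).

    Components. Close square roots are conjugate under the centralizer of [M], so
    a connected component lies in one orbit ([connected_conj]); it is open among
    the square roots ([component_relatively_open]). Conjugations are isometries of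
    the trace metric, they are linear in Cayley charts, and those in the centralizer
    that move a point of the component to another one preserve the component: it is
    homogeneous, and the index of the metric is constant along it. The metric is
    nondegenerate on the tangent space at [x], because for [V] tangent and [W]
    commuting with [M] the matrix [W - x^-1 W x] is tangent and has product
    [- 2 tr (V M^-1 W)] with [V], and because the trace form is nondegenerate on the
    centralizer of a semisimple matrix ([anticomm_nondegenerate]). The Levi-Civita
    derivative of [Y] along [V] is the directional derivative minus
    [(V x^-1 Y + Y x^-1 V) / 2]; differentiating [Y x + x Y = 0] along a curve shows
    that it anticommutes with [x] again ([SR_totally_geodesic]).

    Diffeomorphism type. The spectral projections of [M], grouped by conjugate pairs,
    are real and commute with every square root [Y], so [Y] is a family of blocks,
    one per positive eigenvalue, per pair of non-real eigenvalues and per negative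
    eigenvalue. After division by a square root of the eigenvalue (of its absolute
    value, if it is negative) a block is respectively a real involution, a complex
    involution or a complex structure ([real_block], [complex_block],
    [negative_block]). Involutions are classified up to conjugation by their trace,
    which the multiplicities of the eigenvalues of [Y] determine ([mup_sqrt_trace],
    [signature_conjP]), and complex structures are all conjugate
    ([complex_structure_conj]). Hence the square roots with the prescribed
    multiplicities are exactly the families of blocks that lie in given orbits of
    the groups [G], with stabilizers the groups [H] of the theorem, and [Y]
    corresponds to a family of cosets of [H], the fibers of the orbit maps. The
    Cayley transform also gives charts of [G / H], with the section [(1 + K) g0]
    ([hom_chart_charts]). As it commutes with taking blocks, the bijection and its
    inverse are linear in these coordinates, hence smooth ([blocks_diffeo]). *)

Set Implicit Arguments.
Unset Strict Implicit.
Unset Printing Implicit Defensive.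

Import Order.TTheory GRing.Theory Num.Theory.
Import numFieldNormedType.Exports.
Local Open Scope classical_set_scope.
Local Open Scope ring_scope.

(** * Smooth maps between matrix spaces *)

Section Smooth.
Variables (R : realType) (V : normedModType R).

Lemma iter_derive_rcons (W : normedModType R) (vs : seq V) v (f : V -> W) :
  iter_derive (rcons vs v) f = iter_derive vs (fun x => 'D_v f x).
Proof. by rewrite /iter_derive foldr_rcons. Qed.

(** [derivable] is local by [near_eq_derive]; for [differentiable] the null
    germ [g - f] is shown to have the zero map as its differential. *)
Lemma near_eq_differentiable (W : normedModType R) (f g : V -> W) x :
  (\near x, f x = g x) -> differentiable f x -> differentiable g x.
Proof.
move=> fg df.
have -> : g = f + (g - f) by apply/funext => y; rewrite !fctE addrC subrK.
apply: differentiableD => //.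
pose zl : {linear V -> W} := \0.
have cont0 : continuous (zl : V -> W).
  by move=> y; apply: cvg_cst.
set h := g - f.
have h0 : \near x, h x = 0.
  by near=> y; rewrite /h !fctE (near fg y) ?subrr //.
have E : h \o shift x = cst (h x) + (zl : V -> W) +o_ (0 : V) id.
  apply/eqaddoP => e e0; have {h0} := h0.
  rewrite (near_shift 0 x) subr0 => h0.
  near=> y; rewrite !fctE /=.
  have -> : h x = 0.
    by move: (nbhs_singleton h0) => /=; rewrite add0r.
  have -> : h (y + x) = 0 by apply: (near h0 y).
  by rewrite addr0 subr0 normr0 mulr_ge0 // ltW.
have dE := diff_unique cont0 E.
by apply/diff_locallyP; rewrite dE.
Unshelve. all: by end_near. Qed.

Lemma open_eq_near (W : Type) (U : set V) (f g : V -> W) x : open U -> U x ->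
  (forall y, U y -> f y = g y) -> \near x, f x = g x.
Proof.
move=> oU Ux fg; near=> y; apply: fg.
by near: y; exact: open_nbhs_nbhs.
Unshelve. all: by end_near. Qed.

Lemma eq_iter_derive (W : normedModType R) (U : set V) (f g : V -> W) vs :
  open U -> (forall y, U y -> f y = g y) ->
  forall x, U x -> iter_derive vs f x = iter_derive vs g x.
Proof.
move=> oU fg; elim: vs => [|v vs IH] x Ux /=; first exact: fg.
by apply: near_eq_derive; apply: open_eq_near IH.
Qed.

Lemma eq_smooth_on (W : normedModType R) (U : set V) (f g : V -> W) :
  open U -> (forall y, U y -> f y = g y) -> smooth_on U f -> smooth_on U g.
Proof.
move=> oU fg sf vs x Ux.
apply: near_eq_differentiable (sf vs x Ux).
exact: (open_eq_near oU Ux (@eq_iter_derive _ _ _ _ vs oU fg)).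
Qed.

Lemma smooth_onS (W : normedModType R) (U U' : set V) (f : V -> W) :
  U' `<=` U -> smooth_on U f -> smooth_on U' f.
Proof. by move=> UU sf vs x /UU; exact: sf. Qed.

Lemma smooth_on_differentiable (W : normedModType R) (U : set V) (f : V -> W) x :
  smooth_on U f -> U x -> differentiable f x.
Proof. by move=> sf; apply: (sf [::]). Qed.

Lemma smooth_on_derive (W : normedModType R) (U : set V) (f : V -> W) v :
  smooth_on U f -> smooth_on U (fun x => 'D_v f x).
Proof. by move=> sf vs x Ux; rewrite -iter_derive_rcons; apply: sf. Qed.

(** Coinduction: the induction on the order of the derivatives is done once and for
    all, and for each class of functions only first derivatives are computed. *)
Lemma smooth_coind (W : normedModType R) (U : set V) (P : (V -> W) -> Prop) :
  open U ->
  (forall f x, P f -> U x -> differentiable f x) ->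
  (forall f v, P f -> exists2 g, P g & forall x, U x -> 'D_v f x = g x) ->
  forall f, P f -> smooth_on U f.
Proof.
move=> oU Pd PD f Pf vs; elim/last_ind: vs f Pf => [|vs v IH] f Pf x Ux.
  exact: Pd.
rewrite iter_derive_rcons; have [g Pg fg] := PD f v Pf.
apply: near_eq_differentiable (IH g Pg x Ux).
apply: (open_eq_near oU Ux (@eq_iter_derive _ _ _ _ vs oU _)) => z Uz.
by rewrite fg.
Qed.

(** A matrix is the combination of the constant matrices [delta_mx i j] by its
    entries, which reduces differentiability to scalar functions. *)
Lemma differentiable_mx m n (f : V -> 'M[R]_(m, n)) x :
  (forall i j, differentiable (fun y => f y i j : R) x) -> differentiable f x.
Proof.
move=> df.
have -> : f = \sum_(i < m) \sum_(j < n) (fun y => f y i j *: delta_mx i j).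
  apply/funext => y; rewrite [LHS]matrix_sum_delta fct_sumE.
  by apply: eq_bigr => i _; rewrite fct_sumE.
apply: differentiable_sum => i; apply: differentiable_sum => j.
exact: differentiableZl.
Qed.

Lemma differentiable_entry m n (f : V -> 'M[R]_(m, n)) x i j :
  differentiable f x -> differentiable (fun y => f y i j : R) x.
Proof.
move=> df; have := @differentiable_comp _ _ _ _ f (fun N => N i j : R) x df.
by apply; apply: differentiable_coord.
Qed.

Lemma differentiable_mulmx m n p (f : V -> 'M[R]_(m, n)) (g : V -> 'M[R]_(n, p)) x :
  differentiable f x -> differentiable g x ->
  differentiable (fun y => f y *m g y) x.
Proof.
move=> df dg; apply: differentiable_mx => i j.
have -> : (fun y => (f y *m g y) i j : R)
    = \sum_l ((fun y => f y i l : R) * (fun y => g y l j : R)).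
  by apply/funext => y; rewrite mxE fct_sumE.
by apply: differentiable_sum => l; apply: differentiableM;
  apply: differentiable_entry.
Qed.

Lemma derive_mulmx m n p (f : V -> 'M[R]_(m, n)) (g : V -> 'M[R]_(n, p)) x v :
  differentiable f x -> differentiable g x ->
  'D_v (fun y => f y *m g y) x = 'D_v f x *m g x + f x *m 'D_v g x.
Proof.
move=> df dg; rewrite !derive_mx; try exact: diff_derivable;
  last by apply/diff_derivable/differentiable_mulmx.
apply/matrixP => i j; rewrite !mxE.
have -> : (fun y => (f y *m g y) i j : R)
    = \sum_l ((fun y => f y i l : R) * (fun y => g y l j : R)).
  by apply/funext => y; rewrite mxE fct_sumE.
have dfe i' j' : derivable (fun y => f y i' j' : R) x v.
  by apply/diff_derivable/differentiable_entry.
have dge i' j' : derivable (fun y => g y i' j' : R) x v.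
  by apply/diff_derivable/differentiable_entry.
rewrite derive_sum => [|l]; last exact: derivableM.
rewrite -big_split; apply: eq_bigr => l _ /=.
rewrite deriveM // !mxE /GRing.scale /= addrC; congr (_ + _).
by rewrite mulrC.
Qed.

Lemma differentiable_det n (f : V -> 'M[R]_n) x :
  differentiable f x -> differentiable (fun y => \det (f y) : R) x.
Proof.
move=> df.
have -> : (fun y => \det (f y) : R) =
   \sum_(s : 'S_n) ((-1) ^+ s *: \prod_i (fun y => f y i (s i) : R)).
  apply/funext => y; rewrite /determinant fct_sumE; apply: eq_bigr => s _.
  by rewrite !fctE fct_prodE.
elim/big_ind: _ => [|g h|s _]; first exact: differentiable_cst.
  exact: differentiableD.
apply: differentiableZ; elim/big_ind: _ => [|g h|i _].
- exact: differentiable_cst.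
- exact: differentiableM.
- exact: differentiable_entry.
Qed.

End Smooth.

Section SmoothMx.
Variable R : realType.

Lemma differentiable_linear_mx m n (W : normedModType R)
  (L : {linear 'M[R]_(m, n) -> W}) x : differentiable L x.
Proof.
have -> : (L : 'M[R]_(m, n) -> W) =
    \sum_(i < m) \sum_(j < n) (fun y : 'M[R]_(m, n) => y i j *: L (delta_mx i j)).
  apply/funext => y; rewrite [in LHS](matrix_sum_delta y) fct_sumE linear_sum.
  apply: eq_bigr => i _; rewrite fct_sumE linear_sum.
  by apply: eq_bigr => j _; rewrite linearZ.
apply: differentiable_sum => i; apply: differentiable_sum => j.
apply: differentiableZl; exact: differentiable_coord.
Qed.

Lemma continuous_linear_mx m n (W : normedModType R)
  (L : {linear 'M[R]_(m, n) -> W}) : continuous L.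
Proof. by move=> x; apply/differentiable_continuous/differentiable_linear_mx. Qed.

Variable V : normedModType R.

Lemma differentiable_linear_comp m n (W : normedModType R)
  (L : {linear 'M[R]_(m, n) -> W}) (f : V -> 'M[R]_(m, n)) x :
  differentiable f x -> differentiable (fun y => L (f y)) x.
Proof.
move=> df; apply: (@differentiable_comp _ _ _ _ f L) => //.
exact: differentiable_linear_mx.
Qed.

Lemma derive_linear_comp m n (W : normedModType R)
  (L : {linear 'M[R]_(m, n) -> W}) (f : V -> 'M[R]_(m, n)) x v :
  differentiable f x -> 'D_v (fun y => L (f y)) x = L ('D_v f x).
Proof.
move=> df; rewrite [in RHS]deriveE // [LHS]deriveE; last first.
  exact: differentiable_linear_comp.
have -> : 'd (fun y => L (f y)) x = 'd L (f x) \o 'd f x :> (_ -> _).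
  by apply: (@diff_comp _ _ _ _ f L) => //; exact: differentiable_linear_mx.
by rewrite /= diff_lin //; exact: continuous_linear_mx.
Qed.

Lemma differentiable_adj n (f : V -> 'M[R]_n) x :
  differentiable f x -> differentiable (fun y => \adj (f y)) x.
Proof.
move=> df; apply: differentiable_mx => i j.
have -> : (fun y => (\adj (f y)) i j : R)
    = (-1) ^+ (j + i) *: (fun y => \det (row' j (col' i (f y))) : R).
  by apply/funext => y; rewrite mxE.
apply: differentiableZ; apply: differentiable_det; apply: differentiable_mx => k l.
have -> : (fun y => row' j (col' i (f y)) k l : R) =
   (fun y => f y (lift j k) (lift i l)) by apply/funext => y; rewrite !mxE.
exact: differentiable_entry.
Qed.

Lemma open_preim_unit (T : topologicalType) n (f : T -> 'M[R]_n) (U : set T) :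
  open U -> {in U, continuous f} -> open [set x | U x /\ f x \in unitmx].
Proof.
move=> oU cf; rewrite openE => x [Ux]; rewrite unitmxE unitfE => d0.
have cdet : {for x, continuous (fun y => \det (f y) : R)}.
  apply: (@continuous_comp _ _ _ f (fun A : 'M[R]_n => \det A : R)).
    by apply: cf; rewrite inE.
  apply: differentiable_continuous.
  by apply: (@differentiable_det R _ n id); exact: ex_diff.
have /cdet : nbhs (\det (f x)) (fun r : R => r != 0).
  by apply: open_nbhs_nbhs; split => //; exact: open_neq.
rewrite nbhs_simpl => d1; near=> y; split.
  by near: y; exact: open_nbhs_nbhs.
rewrite unitmxE unitfE; near: y; exact: d1.
Unshelve. all: by end_near. Qed.

Lemma near_unit n (f : V -> 'M[R]_n) x :
  differentiable f x -> f x \in unitmx -> \near x, f x \in unitmx.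
Proof.
move=> df ux.
have cdet := differentiable_continuous (differentiable_det df).
have /cdet : nbhs (\det (f x)) (fun r : R => r != 0).
  by apply: open_nbhs_nbhs; split; [exact: open_neq|rewrite /= -unitfE -unitmxE].
rewrite nbhs_simpl => d0; near=> y.
by rewrite unitmxE unitfE; near: y; exact: d0.
Unshelve. all: by end_near. Qed.

(** On invertible matrices the inverse is the adjugate divided by the
    determinant, both polynomial in the entries. *)
Lemma differentiable_invmx n (f : V -> 'M[R]_n) x :
  differentiable f x -> f x \in unitmx -> differentiable (fun y => invmx (f y)) x.
Proof.
move=> df ux.
apply: (@near_eq_differentiable _ _ _ (fun y => (\det (f y))^-1 *: \adj (f y))).
  by near=> y; rewrite /invmx (near (near_unit df ux) y).
apply: differentiable_mx => i j.
have -> : (fun y => ((\det (f y))^-1 *: \adj (f y)) i j : R) =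
   (fun y => (\det (f y))^-1) * (fun y => (\adj (f y)) i j).
  by apply/funext => y; rewrite mxE.
apply: differentiableM; last first.
  by apply: differentiable_entry; exact: differentiable_adj.
apply: differentiableV; first exact: differentiable_det.
by rewrite -unitfE -unitmxE.
Unshelve. all: by end_near. Qed.

Lemma derive_invmx n (f : V -> 'M[R]_n) x v :
  differentiable f x -> f x \in unitmx ->
  'D_v (fun y => invmx (f y)) x = - (invmx (f x) *m 'D_v f x *m invmx (f x)).
Proof.
move=> df ux; have di := differentiable_invmx df ux.
have : 'D_v (fun y => invmx (f y) *m f y) x = 'D_v (cst 1%:M) x.
  apply: near_eq_derive; near=> y; rewrite mulVmx //.
  by rewrite (near (near_unit df ux) y).
rewrite derive_cst derive_mulmx // => /eqP; rewrite addr_eq0 => /eqP E.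
by rewrite -[LHS](mulmxK ux) E mulNmx.
Unshelve. all: by end_near. Qed.

(** The closure of the smooth functions on [U] under sums, products and
    inverses; it is stable under derivatives, so it consists of smooth
    functions. *)
Inductive rational_closure (U : set V) n : (V -> 'M[R]_n) -> Prop :=
| RcBase f : smooth_on U f -> rational_closure U f
| RcAdd f g : rational_closure U f -> rational_closure U g ->
    rational_closure U (fun x => f x + g x)
| RcMul f g : rational_closure U f -> rational_closure U g ->
    rational_closure U (fun x => f x *m g x)
| RcInv f : rational_closure U f -> (forall x, U x -> f x \in unitmx) ->
    rational_closure U (fun x => invmx (f x)).

Lemma smooth_cst (W : normedModType R) (U : set V) (c : W) :
  open U -> smooth_on U (fun _ : V => c).
Proof.
move=> oU; apply: (@smooth_coind _ _ _ _
  (fun f => exists c, f = fun _ => c) oU); last by exists c.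
- by move=> _ x [{}c ->] _; exact: differentiable_cst.
- move=> _ v [{}c ->]; exists (fun _ => 0); first by exists 0.
  by move=> x _; exact: derive_cst.
Qed.

Lemma rational_closure_smooth (U : set V) n (f : V -> 'M[R]_n) :
  open U -> rational_closure U f -> smooth_on U f.
Proof.
move=> oU; apply: smooth_coind => //.
  move=> {}f x rf Ux; elim: {f} rf => [f sf|f g _ df _ dg|f g _ df _ dg|f _ df uf].
  - exact: smooth_on_differentiable Ux.
  - exact: differentiableD.
  - exact: differentiable_mulmx.
  - by apply: differentiable_invmx => //; exact: uf.
move=> {}f v rf.
have dif g x : rational_closure U g -> U x -> differentiable g x.
  move=> rg Ux; elim: {g} rg => [g sg|g h _ dg _ dh|g h _ dg _ dh|g _ dg ug].
  - exact: smooth_on_differentiable Ux.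
  - exact: differentiableD.
  - exact: differentiable_mulmx.
  - by apply: differentiable_invmx => //; exact: ug.
have rN g : rational_closure U g -> rational_closure U (fun x => - g x).
  move=> rg; have -> : (fun x => - g x) = (fun x => (- 1%:M) *m g x).
    by apply/funext => x; rewrite mulNmx mul1mx.
  by apply: RcMul rg; apply: RcBase; exact: smooth_cst.
elim: {f} rf => [f sf|f g rf [f' rf' Ef] rg [g' rg' Eg]
                |f g rf [f' rf' Ef] rg [g' rg' Eg]|f rf [f' rf' Ef] uf].
- by exists (fun x => 'D_v f x) => //; apply: RcBase; exact: smooth_on_derive.
- exists (fun x => f' x + g' x); first exact: RcAdd.
  by move=> x Ux; rewrite -Ef // -Eg // -deriveD //; apply/diff_derivable/dif.
- exists (fun x => f' x *m g x + f x *m g' x).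
    by apply: RcAdd; apply: RcMul.
  by move=> x Ux; rewrite -Ef // -Eg // -derive_mulmx //; apply: dif.
- exists (fun x => - (invmx (f x) *m f' x *m invmx (f x))).
    by apply: rN; apply: RcMul; [apply: RcMul => //|]; apply: RcInv.
  by move=> x Ux; rewrite -Ef // -derive_invmx //; [exact: dif|exact: uf].
Qed.

Lemma smooth_add (U : set V) n (f g : V -> 'M[R]_n) : open U ->
  smooth_on U f -> smooth_on U g -> smooth_on U (fun x => f x + g x).
Proof. by move=> oU ? ?; apply: rational_closure_smooth => //; apply: RcAdd; apply: RcBase. Qed.

Lemma smooth_mulmx (U : set V) n (f g : V -> 'M[R]_n) : open U ->
  smooth_on U f -> smooth_on U g -> smooth_on U (fun x => f x *m g x).
Proof. by move=> oU ? ?; apply: rational_closure_smooth => //; apply: RcMul; apply: RcBase. Qed.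

Lemma smooth_invmx (U : set V) n (f : V -> 'M[R]_n) : open U ->
  smooth_on U f -> (forall x, U x -> f x \in unitmx) ->
  smooth_on U (fun x => invmx (f x)).
Proof.
by move=> oU ? ?; apply: rational_closure_smooth => //; apply: RcInv => //; apply: RcBase.
Qed.

Lemma smooth_linear_comp m n (W : normedModType R) (U : set V)
  (L : {linear 'M[R]_(m, n) -> W}) (f : V -> 'M[R]_(m, n)) : open U ->
  smooth_on U f -> smooth_on U (fun y => L (f y)).
Proof.
move=> oU sf; apply: (@smooth_coind _ _ _ _
  (fun g => exists2 f, smooth_on U f & g = fun y => L (f y)) oU); last by exists f.
- move=> _ x [{sf}f sf ->] Ux.
  by apply: differentiable_linear_comp; exact: smooth_on_differentiable Ux.
- move=> _ v [{sf}f sf ->]; exists (fun x => L ('D_v f x)).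
    by exists (fun x => 'D_v f x) => //; exact: smooth_on_derive.
  by move=> x Ux; apply: derive_linear_comp; exact: smooth_on_differentiable Ux.
Qed.

End SmoothMx.

Lemma smooth_linear (R : realType) (V W : normedModType R) (U : set V)
  (L : {linear V -> W}) : continuous L -> open U -> smooth_on U L.
Proof.
move=> cL oU; apply: (@smooth_coind _ _ _ _
  (fun g => g = L :> (_ -> _) \/ exists c, g = fun _ => c) oU); last by left.
- move=> _ x [->|[c ->]] _; last exact: differentiable_cst.
  exact: linear_differentiable.
- move=> _ v [->|[c ->]].
    exists (fun _ => L v); first by right; exists (L v).
    by move=> x _; rewrite deriveE ?diff_lin //; exact: linear_differentiable.
  exists (fun _ => 0); first by right; exists 0.
  by move=> x _; exact: derive_cst.
Qed.

Lemma smooth_linear_mx (R : realType) m n (W : normedModType R)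
  (U : set 'M[R]_(m, n)) (L : {linear 'M[R]_(m, n) -> W}) :
  open U -> smooth_on U L.
Proof. by apply: smooth_linear; exact: continuous_linear_mx. Qed.

(** * Cayley coordinates on the square roots of a matrix *)

Section Cayley.
Variables (R : fieldType) (n : nat).
Hypothesis two_unit : (2 : R) \is a GRing.unit.
Implicit Types x Y K J : 'M[R]_n.

(** The square roots [Y] of [x *m x] with [Y + x] invertible are the matrices
    [(1 + K) x (1 + K)^-1] with [K] anticommuting with [x], and
    [K = (Y - x) (Y + x)^-1] is recovered from [Y]. So the set of square roots
    of a matrix is parametrized near [x] by an open subset of a linear space. *)
Definition cayley x Y := (Y - x) *m invmx (Y + x).
Definition icayley x K := (1%:M + K) *m x *m invmx (1%:M + K).
Definition anticomm x K := K *m x + x *m K = 0.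

Lemma anticommE x K : anticomm x K -> K *m x = - (x *m K).
Proof. by move/eqP; rewrite addr_eq0 => /eqP. Qed.

Lemma mx_add2 (A : 'M[R]_n) : A + A = 2 *: A.
Proof. by rewrite -[in LHS](scale1r A) -scalerDl. Qed.

(** [Y + x] intertwines the two square roots [x] and [Y] of the same matrix, so
    they are conjugate as soon as [Y + x] is invertible; it also commutes with
    that matrix. *)
Lemma sqrt_intertwine x Y : Y *m Y = x *m x -> x *m (Y + x) = (Y + x) *m Y.
Proof. by move=> E; rewrite mulmxDr mulmxDl E addrC. Qed.

Lemma sqrt_intertwineV x Y : Y *m Y = x *m x -> Y *m (Y + x) = (Y + x) *m x.
Proof. by move=> E; rewrite mulmxDr mulmxDl E addrC. Qed.

Lemma intertwine_inv (P A B : 'M[R]_n) : P \in unitmx -> A *m P = P *m B ->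
  invmx P *m A = B *m invmx P.
Proof.
move=> uP E; apply: (can_inj (mulmxK uP)).
by rewrite mulmxKV // -mulmxA E mulmxA mulVmx // mul1mx.
Qed.

Lemma cayley_anticomm x Y : Y *m Y = x *m x -> Y + x \in unitmx ->
  anticomm x (cayley x Y).
Proof.
move=> E u; rewrite /anticomm /cayley -mulmxA (intertwine_inv u (sqrt_intertwine E)).
rewrite !mulmxA -mulmxDl mulmxBl mulmxBr E.
by rewrite addrC addrA subrK subrr mul0mx.
Qed.

Lemma cayley_add1 x Y : Y + x \in unitmx ->
  1%:M + cayley x Y = 2 *: (Y *m invmx (Y + x)).
Proof.
move=> u; rewrite /cayley -{1}(mulmxV u) -mulmxDl -mx_add2 -mulmxDl.
by rewrite addrACA subrr addr0.
Qed.

Lemma cayley_unit x Y : Y \in unitmx -> Y + x \in unitmx ->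
  1%:M + cayley x Y \in unitmx.
Proof.
by move=> uY u; rewrite cayley_add1 // unitmxZ // unitmx_mul uY unitmx_inv.
Qed.

Lemma cayleyK x Y : Y \in unitmx -> Y *m Y = x *m x -> Y + x \in unitmx ->
  icayley x (cayley x Y) = Y.
Proof.
move=> uY E u; have uC := cayley_unit uY u; apply: (can_inj (mulmxK uC)).
rewrite /icayley mulmxKV // cayley_add1 // -scalemxAl -scalemxAr -mulmxA.
by rewrite (intertwine_inv u (sqrt_intertwine E)).
Qed.

Lemma icayley_sqr x K : anticomm x K -> 1%:M + K \in unitmx ->
  icayley x K *m icayley x K = x *m x.
Proof.
move=> /anticommE aK u; rewrite /icayley !mulmxA mulmxKV // -mulmxA.
have: (1%:M + K) *m (x *m x) = x *m x *m (1%:M + K).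
  rewrite mulmxDl mulmxDr mul1mx mulmx1; congr (_ + _).
  by rewrite mulmxA aK mulNmx -!mulmxA aK mulmxN opprK.
by rewrite !mulmxA => ->; rewrite -mulmxA mulmxV ?mulmx1.
Qed.

Lemma icayley_add x K : anticomm x K -> 1%:M + K \in unitmx ->
  icayley x K + x = 2 *: (x *m invmx (1%:M + K)).
Proof.
move=> /anticommE aK u; apply: (can_inj (mulmxK u)).
rewrite /= mulmxDl /icayley mulmxKV // -scalemxAl mulmxKV //.
rewrite mulmxDl mulmxDr mul1mx mulmx1 aK -mx_add2.
by rewrite addrACA addNr addr0.
Qed.

Lemma icayley_sub x K : anticomm x K -> 1%:M + K \in unitmx ->
  icayley x K - x = 2 *: (K *m x *m invmx (1%:M + K)).
Proof.
move=> /anticommE aK u; apply: (can_inj (mulmxK u)).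
rewrite /= mulmxBl /icayley mulmxKV // -scalemxAl mulmxKV //.
rewrite mulmxDl mulmxDr mul1mx mulmx1 -[x *m K]opprK -aK -mx_add2.
by rewrite opprD opprK addrACA subrr add0r.
Qed.

Lemma icayley_add_unit x K : x \in unitmx -> anticomm x K ->
  1%:M + K \in unitmx -> icayley x K + x \in unitmx.
Proof.
by move=> ux aK u; rewrite icayley_add // unitmxZ // unitmx_mul ux unitmx_inv.
Qed.

Lemma icayleyK x K : x \in unitmx -> anticomm x K -> 1%:M + K \in unitmx ->
  cayley x (icayley x K) = K.
Proof.
move=> ux aK u; have ua := icayley_add_unit ux aK u.
apply: (can_inj (mulmxK ua)); rewrite /cayley mulmxKV // icayley_add //.
by rewrite icayley_sub // -scalemxAr mulmxA.
Qed.

Lemma invmx_conj (A g : 'M[R]_n) : g \in unitmx -> A \in unitmx ->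
  invmx (g *m A *m invmx g) = g *m invmx A *m invmx g.
Proof.
move=> ug u; have uc : g *m A *m invmx g \in unitmx.
  by rewrite !unitmx_mul ug u unitmx_inv.
apply: (can_inj (mulKmx uc)).
rewrite mulmxV // !mulmxA mulmxKV // -[X in _ = X *m _]mulmxA.
by rewrite mulmxV // mulmx1 mulmxV.
Qed.

Lemma cayley_conj x Y g : g \in unitmx -> Y + x \in unitmx ->
  cayley (g *m x *m invmx g) (g *m Y *m invmx g) = g *m cayley x Y *m invmx g.
Proof.
move=> ug u; rewrite /cayley -mulmxBl -mulmxDl -mulmxBr -mulmxDr.
by rewrite invmx_conj // !mulmxA mulmxKV.
Qed.

End Cayley.

Lemma open_preimage_in (T U : topologicalType) (f : T -> U) (A : set T) (O : set U) :
  open A -> (forall x, A x -> {for x, continuous f}) -> open O ->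
  open (A `&` f @^-1` O).
Proof.
move=> oA cf oO; rewrite openE => x [Ax Ofx].
have /(cf x Ax) fO : nbhs (f x) O by exact: open_nbhs_nbhs.
by apply: filterI => //; exact: open_nbhs_nbhs.
Qed.

Section AntiSpace.
Variables (R : realType) (n : nat).
Implicit Types x Y K J : 'M[R]_n.

(** The space of matrices anticommuting with [x] and commuting with [J]. For
    [J = 1] it is the tangent space at an invertible [x] of the square roots of
    [x *m x]; a complex structure [J] restricts it to complex linear matrices. *)
Definition anti_space J x : {vspace 'M[R]_n} :=
  (lker (linfun (mulmxr x \+ mulmx x)) :&:
   lker (linfun (mulmxr J \- mulmx J)))%VS.

Lemma anti_spaceP J x K :
  K \in anti_space J x <-> anticomm x K /\ K *m J = J *m K.
Proof.
rewrite memv_cap !memv_ker !lfunE /= subr_eq0.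
split; first by case/andP => /eqP ? /eqP ?.
by case=> aK cK; apply/andP; split; apply/eqP.
Qed.

Lemma anti_space1P x K : K \in anti_space 1%:M x <-> anticomm x K.
Proof.
rewrite anti_spaceP; split; first by case.
by move=> a; split=> //; rewrite mulmx1 mul1mx.
Qed.

Local Notation anti_dim J x := (\dim (anti_space J x)).

Definition anti_coord J x K : 'rV[R]_(anti_dim J x) :=
  \row_j coord (vbasis (anti_space J x)) j K.

Definition anti_vec J x (z : 'rV[R]_(anti_dim J x)) : 'M[R]_n :=
  \sum_j z 0 j *: (vbasis (anti_space J x))`_j.

Fact anti_coord_is_linear J x : linear (anti_coord J x).
Proof. by move=> a u v; apply/rowP => j; rewrite !mxE linearP. Qed.
HB.instance Definition _ J x := GRing.isLinear.Build _ _ _ _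
  (anti_coord J x) (@anti_coord_is_linear J x).

Fact anti_vec_is_linear J x : linear (@anti_vec J x).
Proof.
move=> a u v; rewrite /anti_vec scaler_sumr -big_split; apply: eq_bigr => j _ /=.
by rewrite !mxE scalerDl scalerA.
Qed.
HB.instance Definition _ J x := GRing.isLinear.Build _ _ _ _
  (@anti_vec J x) (@anti_vec_is_linear J x).

Lemma anti_vec_in J x (z : 'rV_(anti_dim J x)) : anti_vec z \in anti_space J x.
Proof.
apply: memv_suml => j _; apply: memvZ; apply: vbasis_mem.
by rewrite mem_nth // size_tuple.
Qed.

Lemma anti_coordK J x K : K \in anti_space J x -> anti_vec (anti_coord J x K) = K.
Proof.
move=> KT; rewrite /anti_vec [RHS](coord_vbasis KT).
by under eq_bigr do rewrite mxE.
Qed.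

Lemma anti_vecK J x : cancel (@anti_vec J x) (anti_coord J x).
Proof.
move=> z; apply/rowP => j; rewrite mxE coord_sum_free //.
exact: basis_free (vbasisP _).
Qed.

Lemma anti_vec_anticomm J x (z : 'rV_(anti_dim J x)) : anticomm x (anti_vec z).
Proof. by have /anti_spaceP[] := anti_vec_in z. Qed.

Lemma anti_vec_comm J x (z : 'rV_(anti_dim J x)) :
  anti_vec z *m J = J *m anti_vec z.
Proof. by have /anti_spaceP[] := anti_vec_in z. Qed.

Lemma two_unitr : (2 : R) \is a GRing.unit.
Proof. by rewrite unitfE pnatr_eq0. Qed.

Lemma open_units_affine (J x : 'M[R]_n) :
  open [set z : 'rV[R]_(anti_dim J x) | 1%:M + anti_vec z \in unitmx].
Proof.
rewrite (_ : [set z | _] = [set z | setT z /\ 1%:M + anti_vec z \in unitmx]).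
  apply: open_preim_unit; first exact: openT.
  move=> z _; apply: (differentiable_continuous
    (differentiableD (differentiable_cst 1%:M z) _)).
  exact: (differentiable_linear_mx (@anti_vec J x)).
by apply/seteqP; split => z //= [].
Qed.

End AntiSpace.
Notation anti_dim J x := (\dim (anti_space J x)).

Lemma open_addunit (R : realType) n (x : 'M[R]_n) :
  open [set Y : 'M[R]_n | Y + x \in unitmx].
Proof.
rewrite (_ : [set z | _] = [set z | setT z /\ z + x \in unitmx]).
  apply: open_preim_unit; first exact: openT.
  move=> z _; apply: (differentiable_continuous
    (differentiableD _ (differentiable_cst x z))).
  exact: ex_diff.
by apply/seteqP; split => z //= [].
Qed.

Lemma smooth_id (R : realType) (V : normedModType R) (U : set V) :
  open U -> smooth_on U (fun x : V => x).
Proof.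
move=> oU; apply: (@smooth_linear _ _ _ _ (idfun : {linear V -> V})) => //.
by move=> x; exact: cvg_id.
Qed.

Lemma smooth_cayley (R : realType) n (x : 'M[R]_n) :
  smooth_on [set Y : 'M[R]_n | Y + x \in unitmx] (cayley x).
Proof.
have oU := @open_addunit R n x; apply: smooth_mulmx => //.
  by apply: smooth_add => //; [exact: smooth_id|exact: smooth_cst].
apply: smooth_invmx => //.
by apply: smooth_add => //; [exact: smooth_id|exact: smooth_cst].
Qed.

Lemma smooth_icayley (R : realType) (V : normedModType R) (U : set V) n
  (x : 'M[R]_n) (f : V -> 'M[R]_n) : open U ->
  smooth_on U f -> (forall z, U z -> 1%:M + f z \in unitmx) ->
  smooth_on U (fun z => icayley x (f z)).
Proof.
move=> oU sf uf.
have s1 : smooth_on U (fun z => 1%:M + f z).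
  by apply: smooth_add => //; exact: smooth_cst.
apply: smooth_mulmx => //; last exact: smooth_invmx.
by apply: smooth_mulmx => //; exact: smooth_cst.
Qed.

Section CayleyChart.
Variables (R : realType) (n : nat).
Implicit Types x Y K J : 'M[R]_n.

Definition cayley_chart (S : set 'M[R]_n) J x : chart R 'M[R]_n :=
  Chart (S `&` [set Y | Y + x \in unitmx])
        (fun Y => anti_coord J x (cayley x Y))
        (fun z => icayley x (@anti_vec R n J x z)).

(** With [X] the set of all square roots, both the components and the sets with
    prescribed eigenvalues are such [S]; Cayley charts are studied on all of them
    at once. *)
Definition relatively_open (T : topologicalType) (X S : set T) :=
  exists2 O : set T, open O & S = X `&` O.

Lemma SR_unit (M Y : 'M[R]_n) : M \in unitmx -> SR M Y -> Y \in unitmx.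
Proof. by move=> uM E; move: uM; rewrite -E unitmx_mul => /andP[]. Qed.

Variables (M : 'M[R]_n) (S : set 'M[R]_n) (x : 'M[R]_n).
Hypotheses (uM : M \in unitmx) (oS : relatively_open (SR M) S) (Sx : S x).

Let SSR : S `<=` SR M. Proof. by case: oS => O _ -> y []. Qed.
Let xx : x *m x = M. Proof. exact: SSR. Qed.
Let ux : x \in unitmx. Proof. exact: SR_unit uM (SSR Sx). Qed.
Let c := cayley_chart S 1%:M x.

Lemma cayley_chart_anti Y : cdom c Y -> cayley x Y \in anti_space 1%:M x.
Proof.
move=> [SY u]; apply/anti_space1P/cayley_anticomm => //.
by rewrite xx; exact: SSR.
Qed.

Lemma cayley_chartK Y : cdom c Y -> cinv c (cmap c Y) = Y.
Proof.
move=> dY; rewrite /= anti_coordK; last exact: cayley_chart_anti.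
case: dY => SY u; apply: cayleyK => //; first exact: two_unitr.
- exact: SR_unit uM (SSR SY).
- by rewrite xx; exact: SSR.
Qed.

Lemma cayley_chart_image : cimage c =
  [set z | 1%:M + anti_vec z \in unitmx /\ S (icayley x (anti_vec z))].
Proof.
apply/seteqP; split=> z /=.
  move=> [Y dY <-]; have := cayley_chartK dY => /= ->.
  rewrite anti_coordK; last exact: cayley_chart_anti.
  case: dY => SY u; split=> //; apply: cayley_unit => //.
  - exact: two_unitr.
  - exact: SR_unit uM (SSR SY).
move=> [u Sz]; exists (icayley x (anti_vec z)).
  split=> //; apply: icayley_add_unit => //; first exact: two_unitr.
  exact: anti_vec_anticomm.
rewrite /= icayleyK ?anti_vecK //; first exact: two_unitr.
exact: anti_vec_anticomm.
Qed.

Lemma cayley_chart_imageP z : cimage c z -> 1%:M + anti_vec z \in unitmx.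
Proof. by rewrite cayley_chart_image => -[]. Qed.

Lemma cayley_chart_dom z : cimage c z -> cdom c (cinv c z).
Proof. by case=> Y dY <-; rewrite cayley_chartK. Qed.

Lemma smooth_cinv_units :
  smooth_on [set z | 1%:M + anti_vec z \in unitmx] (cinv c).
Proof.
apply: smooth_icayley => //; first exact: open_units_affine.
by apply: smooth_linear_mx; exact: open_units_affine.
Qed.

(** [icayley] sends every admissible [K] to a square root of [M], hence the only
    condition for landing in [S] is the open one that defines [S]. *)
Lemma open_cimage : open (cimage c).
Proof.
rewrite cayley_chart_image; case: (oS) => O oO SO.
have -> : [set z | 1%:M + anti_vec z \in unitmx /\ S (icayley x (anti_vec z))] =
  [set z | 1%:M + anti_vec z \in unitmx] `&` (cinv c @^-1` O).
  apply/seteqP; split=> z /= [u]; rewrite SO => // Oz.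
    by split=> //; case: Oz.
  split=> //; split=> //; rewrite /SR /= icayley_sqr //.
  exact: anti_vec_anticomm.
apply: (@open_preimage_in _ _ (cinv c)
  [set z | 1%:M + @anti_vec R n 1%:M x z \in unitmx] O _ _ oO).
- exact: open_units_affine.
- move=> z uz.
  exact/differentiable_continuous/(smooth_on_differentiable smooth_cinv_units).
Qed.

Lemma cayley_chart_submfd : charts (submfd S) c.
Proof.
split.
- by split; [exact: open_cimage|exact: cayley_chartK].
- by exists [set Y | Y + x \in unitmx] => //; exact: open_addunit.
- move=> Y [SY u]; exists [set Y | Y + x \in unitmx], (cmap c); split => //.
    exact: open_addunit.
  by apply: smooth_linear_comp; [exact: open_addunit|exact: smooth_cayley].
- by apply: smooth_onS smooth_cinv_units => z /cayley_chart_imageP.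
Qed.

Lemma cayley_chart_base : cdom c x.
Proof. by split=> //=; rewrite mx_add2 unitmxZ // two_unitr. Qed.

End CayleyChart.

(** * Components of the set of square roots *)

Section Conjugation.
Variables (F : fieldType) (n : nat).
Implicit Types (A B M g h : 'M[F]_n).

Definition conjM g (A : 'M[F]_n) := g *m A *m invmx g.

Fact conjM_is_linear g : linear (conjM g).
Proof.
by move=> a u v; rewrite /conjM mulmxDr mulmxDl -scalemxAr -scalemxAl.
Qed.
HB.instance Definition _ g := GRing.isLinear.Build _ _ _ _ (conjM g) (conjM_is_linear g).

Lemma conjMK g : g \in unitmx -> cancel (conjM g) (conjM (invmx g)).
Proof.
move=> ug A; rewrite /conjM invmxK !mulmxA mulVmx // mul1mx -mulmxA.
by rewrite mulVmx // mulmx1.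
Qed.

Lemma conjMVK g : g \in unitmx -> cancel (conjM (invmx g)) (conjM g).
Proof. by move=> ug A; have := @conjMK (invmx g); rewrite invmxK unitmx_inv => /(_ ug). Qed.

Lemma conjM_mul g A B : g \in unitmx -> conjM g (A *m B) = conjM g A *m conjM g B.
Proof. by move=> ug; rewrite /conjM !mulmxA mulmxKV. Qed.

Lemma conjM_id g M : g \in unitmx -> g *m M = M *m g -> conjM g M = M.
Proof. by move=> ug E; rewrite /conjM E mulmxK. Qed.

Lemma invmxM g h : g \in unitmx -> h \in unitmx ->
  invmx (h *m g) = invmx g *m invmx h.
Proof.
move=> ug uh; have uhg : h *m g \in unitmx by rewrite unitmx_mul uh ug.
apply: (can_inj (mulKmx uhg)); rewrite mulmxV // !mulmxA mulmxK //.
by rewrite mulmxV.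
Qed.

Lemma conjM_unit g A : g \in unitmx -> (conjM g A \in unitmx) = (A \in unitmx).
Proof. by move=> ug; rewrite /conjM !unitmx_mul ug unitmx_inv ug andbT. Qed.

Lemma invmx_comm g M : g \in unitmx -> g *m M = M *m g -> invmx g *m M = M *m invmx g.
Proof. by move=> ug E; apply: intertwine_inv. Qed.

End Conjugation.

Section Orbits.
Variables (R : realType) (n : nat).
Implicit Types x Y K J M g : 'M[R]_n.

Lemma SR_conj g M Y : g \in unitmx -> g *m M = M *m g -> SR M Y -> SR M (conjM g Y).
Proof. by move=> ug E YM; rewrite /SR /= -conjM_mul // YM conjM_id. Qed.

Lemma SR_comm M Y : SR M Y -> Y *m M = M *m Y.
Proof. by move=> <-; rewrite mulmxA. Qed.

Definition conjugate_by_centralizer M x Y :=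
  exists g, [/\ g \in unitmx, g *m M = M *m g & Y = conjM g x].

Lemma SR_near_conj M x Y : SR M x -> SR M Y -> Y + x \in unitmx ->
  conjugate_by_centralizer M x Y.
Proof.
move=> Mx MY u; exists (Y + x); split => //.
  by rewrite mulmxDl mulmxDr (SR_comm Mx) (SR_comm MY).
rewrite /conjM -sqrt_intertwineV ?mulmxK //.
by rewrite [LHS]MY [RHS]Mx.
Qed.

Lemma conjugate_trans M x Y Z : conjugate_by_centralizer M x Y ->
  conjugate_by_centralizer M Y Z -> conjugate_by_centralizer M x Z.
Proof.
move=> [g [ug gM ->]] [h [uh hM ->]]; exists (h *m g); split.
- by rewrite unitmx_mul uh ug.
- by rewrite -mulmxA gM !mulmxA hM.
- by rewrite /conjM invmxM // !mulmxA.
Qed.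

(** Square roots close to each other are conjugate under the centralizer of [M],
    so each orbit of the centralizer is relatively open, hence also relatively
    closed: a connected set meets only one of them. *)
Lemma connected_conj M (S : set 'M[R]_n) x Y : connected S -> S `<=` SR M ->
  M \in unitmx -> S x -> S Y -> conjugate_by_centralizer M x Y.
Proof.
move=> cS SM uM Sx SY.
pose B := [set Y | S Y /\ conjugate_by_centralizer M x Y].
have self_unit Z : S Z -> Z + Z \in unitmx.
  move=> SZ; rewrite mx_add2 unitmxZ ?two_unitr //.
  exact: SR_unit uM (SM _ SZ).
suff SB : B = S by move: SY; rewrite -SB => -[].
apply: cS.
- exists x; split=> //; exists 1%:M.
  by rewrite unitmx1 mul1mx mulmx1 /conjM invmx1 mulmx1 mul1mx.
- exists (\bigcup_(y in B) [set Y | Y + y \in unitmx]).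
    by apply: bigcup_open => y _; exact: open_addunit.
  apply/seteqP; split=> Z.
    by move=> BZ; split; [case: BZ|exists Z => //; apply: self_unit; case: BZ].
  move=> [SZ [y [Sy xy] u]]; split=> //.
  exact: conjugate_trans xy (SR_near_conj (SM _ Sy) (SM _ SZ) u).
- exists (~` \bigcup_(y in S `\` B) [set Y | Y + y \in unitmx]).
    by apply: open_closedC; apply: bigcup_open => y _; exact: open_addunit.
  apply/seteqP; split=> Z.
    move=> [SZ xZ]; split=> //; move=> [y [Sy nBy] /= u].
    apply: nBy; split=> //; rewrite addrC in u.
    exact: conjugate_trans xZ (SR_near_conj (SM _ SZ) (SM _ Sy) u).
  move=> [SZ nZ]; split=> //; apply: contrapT => nB; apply: nZ.
  by exists Z; [split=> // -[]|exact: self_unit].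
Qed.

Lemma scaleline_continuous (V : normedModType R) (K : V) :
  continuous (fun t : R => t *: K).
Proof. by move=> t; apply: scalel_continuous. Qed.

Lemma smooth_scaleline (V : normedModType R) (U : set R) (K : V) : open U ->
  smooth_on U (fun t : R => t *: K).
Proof.
move=> oU; have lin : linear (fun t : R => t *: K).
  by move=> a u v; rewrite scalerDl scalerA.
pose f : {linear R -> V} :=
  HB.pack (fun t : R => t *: K) (GRing.isLinear.Build _ _ _ _ _ lin).
exact: (@smooth_linear _ _ _ _ f (@scaleline_continuous V K)).
Qed.

Lemma open_line_units K : open [set t : R | 1%:M + t *: K \in unitmx].
Proof.
rewrite (_ : [set t | _] = [set t : R | setT t /\ 1%:M + t *: K \in unitmx]).
  apply: open_preim_unit; first exact: openT.
  move=> s _; apply: (differentiable_continuous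
    (differentiableD (differentiable_cst 1%:M s) _)).
  exact: (smooth_on_differentiable (smooth_scaleline K openT)).
by apply/seteqP; split => z //= [].
Qed.

Lemma near0_unit : \forall K \near (0 : 'M[R]_n), 1%:M + K \in unitmx.
Proof.
apply: (@near_unit _ _ _ (fun K => 1%:M + K)); last by rewrite addr0 unitmx1.
by apply: differentiableD.
Qed.

(** A square root close to [x] is joined to [x] by a Cayley segment, so the
    components of the set of square roots are relatively open in it. *)
Lemma component_relatively_open M Y0 : M \in unitmx ->
  relatively_open (SR M) (connected_component (SR M) Y0).
Proof.
move=> uM; have [e /= e0 He] := (nbhs_ballP _ _).1 near0_unit.
pose O x := [set Y | Y + x \in unitmx] `&` cayley x @^-1` (ball 0 e).
have oO x : open (O x).
  apply: open_preimage_in; first exact: open_addunit.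
  - move=> y uy; apply: differentiable_continuous.
    exact: smooth_on_differentiable (@smooth_cayley R n x) uy.
  - exact: ball_open.
exists (\bigcup_(x in connected_component (SR M) Y0) O x).
  by apply: bigcup_open => x _; exact: oO.
apply/seteqP; split=> Y.
  move=> CY; split; first exact: connected_component_sub CY.
  exists Y => //; split => /=.
    rewrite mx_add2 unitmxZ ?two_unitr //.
    exact: SR_unit uM (connected_component_sub CY).
  by rewrite /cayley subrr mul0mx; exact: ballxx.
move=> [MY [x Cx [/= uYx bY]]]; have Mx := connected_component_sub Cx.
have xx : x *m x = M by [].
set K := cayley x Y in bY *.
have aK : anticomm x K by apply: cayley_anticomm => //; rewrite xx.
have ut t : t \in `[0, 1] -> 1%:M + t *: K \in unitmx.
  rewrite in_itv /= => /andP[t0 t1]; apply: He.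
  move: bY; rewrite -ball_normE /= !sub0r !normrN normrZ ger0_norm //.
  by apply: le_lt_trans; rewrite ler_piMl.
pose f t := icayley x (t *: K).
have atK t : anticomm x (t *: K).
  by rewrite /anticomm -scalemxAl -scalemxAr -scalerDr aK scaler0.
have cf : connected (f @` `[0, 1]%classic).
  apply: connected_continuous_connected; first exact: segment_connected.
  apply: continuous_in_subspaceT => t; rewrite inE => /ut u.
  have oU : open [set t : R | 1%:M + t *: K \in unitmx] by exact: open_line_units.
  apply: differentiable_continuous.
  apply: (smooth_on_differentiable (U := [set t : R | 1%:M + t *: K \in unitmx])) => //.
  by apply: smooth_icayley => //; exact: smooth_scaleline.
have sub : f @` `[0, 1]%classic `<=` SR M.
  by move=> _ [t /ut u <-]; rewrite /SR /= icayley_sqr.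
have fx : (f @` `[0, 1]%classic) x.
  exists 0; first by rewrite /= in_itv /= lexx ler01.
  by rewrite /f scale0r /icayley addr0 invmx1 mulmx1 mul1mx.
have fY : (f @` `[0, 1]%classic) Y.
  exists 1; first by rewrite /= in_itv /= lexx ler01.
  rewrite /f scale1r cayleyK ?two_unitr //; last by rewrite xx.
  exact: SR_unit uM MY.
apply: connected_component_trans Cx _.
exact: (connected_component_max fx sub cf) fY.
Qed.

End Orbits.

(** * The tangent space and the trace metric *)

Section Tangent.
Variables (R : realType) (n : nat).
Variables (M : 'M[R]_n) (S : set 'M[R]_n).
Hypotheses (uM : M \in unitmx) (oS : relatively_open (SR M) S).
Implicit Types x Y V W K g : 'M[R]_n.

Let SSR : S `<=` SR M. Proof. by case: oS => O _ -> y []. Qed.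
Let Sunit x : S x -> x \in unitmx. Proof. by move=> /SSR; exact: SR_unit. Qed.

Lemma curve_differentiable x gamma : curve_from S x gamma -> differentiable gamma 0.
Proof.
move=> [_ [e e0 [sg _]]]; apply: smooth_on_differentiable sg _.
exact: ballxx.
Qed.

(** Differentiate [gamma t *m gamma t = M] at [0]. *)
Lemma tangent_anticomm x V : S x -> tangent S x V -> anticomm x V.
Proof.
move=> Sx [gamma cg gV]; have dg := curve_differentiable cg.
case: (cg) => g0 [e e0 [sg Sg]].
have: 'D_(1 : R) (fun t : R => gamma t *m gamma t) (0 : R) =
    'D_(1 : R) (fun _ : R => M) (0 : R).
  apply: near_eq_derive; near=> t; apply: (SSR (Sg t _)).
  by near: t; exact: nbhsx_ballx.
by rewrite derive_cst derive_mulmx // -derive1E gV g0.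
Unshelve. all: by end_near. Qed.

Definition cayley_curve x K (t : R) := icayley x (t *: K).

Lemma smooth_cayley_curve x K :
  smooth_on [set t : R | 1%:M + t *: K \in unitmx] (cayley_curve x K).
Proof.
apply: smooth_icayley => //; first exact: open_line_units.
by apply: smooth_scaleline; exact: open_line_units.
Qed.

Lemma derive_cayley_curve x K : derive1 (cayley_curve x K) 0 = K *m x - x *m K.
Proof.
have dK : differentiable (fun t : R => t *: K) (0 : R).
  exact: (smooth_on_differentiable (smooth_scaleline K openT)).
have dlin : 'D_(1 : R) (fun t : R => t *: K) (0 : R) = K.
  have h : is_derive (0 : R) (1 : R) (fun t : R => t *: K) K.
    apply: DeriveDef; first exact: diff_derivable.
    rewrite deriveE //.
    have -> : 'd (fun t : R => t *: K) (0 : R) = ( *:%R ^~ K) :> (R -> _).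
      exact: diff_val.
    by rewrite scale1r.
  exact: derive_val.
have d1 : differentiable (fun t : R => 1%:M + t *: K) (0 : R).
  exact: differentiableD.
have D1 : 'D_(1 : R) (fun t : R => 1%:M + t *: K) (0 : R) = K.
  rewrite (@deriveD _ _ _ (cst 1%:M) (fun t : R => t *: K)); last 2 first.
  - exact: derivable_cst.
  - exact: diff_derivable.
  by rewrite derive_cst add0r.
have u0 : 1%:M + (0 : R) *: K \in unitmx by rewrite scale0r addr0 unitmx1.
rewrite derive1E /cayley_curve /icayley.
rewrite (@derive_mulmx _ _ _ _ _ (fun t : R => (1%:M + t *: K) *m x)); last 2 first.
- exact: differentiable_mulmx.
- exact: differentiable_invmx.
rewrite derive_invmx // (@derive_mulmx _ _ _ _ _ (fun t : R => 1%:M + t *: K) (cst x)) //.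
rewrite derive_cst mulmx0 addr0 D1 scale0r addr0 invmx1.
by rewrite !mulmx1 !mul1mx mulmxN.
Qed.

(** The factor [1/2] makes [K x - x K = 2 K x] equal to [V]. *)
Lemma anticomm_half x V : x \in unitmx -> anticomm x V ->
  anticomm x ((2^-1 : R) *: (V *m invmx x)).
Proof.
move=> ux aV; rewrite /anticomm -scalemxAl -scalemxAr -scalerDr mulmxKV //.
have -> : x *m (V *m invmx x) = - V.
  by rewrite mulmxA -[x *m V]opprK -(anticommE aV) mulNmx mulmxK.
by rewrite subrr scaler0.
Qed.

Lemma anticomm_tangent x V : S x -> anticomm x V -> tangent S x V.
Proof.
move=> Sx aV; have ux := Sunit Sx.
pose K := (2^-1 : R) *: (V *m invmx x).
have aK : anticomm x K by exact: anticomm_half.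
have c0 : cayley_curve x K 0 = x.
  by rewrite /cayley_curve scale0r /icayley addr0 invmx1 mulmx1 mul1mx.
exists (cayley_curve x K); last first.
  rewrite derive_cayley_curve -[x *m K]opprK -(anticommE aK) opprK mx_add2.
  by rewrite /K -scalemxAl mulmxKV // scalerA divff ?scale1r // pnatr_eq0.
split=> //; case: (oS) => O oO SO.
(* [S] is open among the square roots, so the curve stays in [S] for small [t]. *)
have oU : open ([set t : R | 1%:M + t *: K \in unitmx] `&` cayley_curve x K @^-1` O).
  apply: (@open_preimage_in _ _ (cayley_curve x K)
    [set t : R | 1%:M + t *: K \in unitmx] O (@open_line_units R n K) _ oO).
  move=> t ut; apply: differentiable_continuous.
  exact: (smooth_on_differentiable (@smooth_cayley_curve x K) ut).
have U0 : ([set t : R | 1%:M + t *: K \in unitmx] `&` cayley_curve x K @^-1` O) 0.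
  by split => /=; rewrite ?scale0r ?addr0 ?unitmx1 // c0; move: Sx; rewrite SO => -[].
have [e /= e0 eU] := (nbhs_ballP _ _).1 (open_nbhs_nbhs (conj oU U0)).
exists e => //; split.
  by apply: smooth_onS (@smooth_cayley_curve x K) => t /eU [].
move=> t /eU [ut Ot]; rewrite SO; split=> //.
rewrite /SR /= /cayley_curve icayley_sqr //; first exact: SSR.
by rewrite /anticomm -scalemxAl -scalemxAr -scalerDr aK scaler0.
Qed.

Lemma tangentP x V : S x -> tangent S x V <-> anticomm x V.
Proof. by move=> Sx; split; [exact: tangent_anticomm|exact: anticomm_tangent]. Qed.

Lemma anticomm_conj g x V : g \in unitmx -> anticomm x V ->
  anticomm (conjM g x) (conjM g V).
Proof.
move=> ug aV; rewrite /anticomm -!conjM_mul // -linearD aV.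
exact: linear0.
Qed.

Lemma trace_metric_conj g x V W : g \in unitmx -> x \in unitmx ->
  trace_metric (conjM g x) (conjM g V) (conjM g W) = trace_metric x V W.
Proof.
move=> ug ux; rewrite /trace_metric.
have -> : invmx (conjM g x) = conjM g (invmx x) by exact: invmx_conj.
by rewrite -!conjM_mul // /conjM mxtrace_mulC mulKmx.
Qed.

Lemma dim_conjM g (W : {vspace 'M[R]_n}) : g \in unitmx ->
  \dim (linfun (conjM g) @: W) = \dim W.
Proof.
move=> ug; apply: limg_dim_eq; apply/eqP; rewrite -subv0; apply/subvP => v.
rewrite memv_cap memv_ker => /andP[_]; rewrite lfunE /= => /eqP v0.
by rewrite memv0 -(conjMK ug v) v0 linear0.
Qed.

Section Conjugate.
Hypothesis Sconj : forall x y, S x -> S y -> conjugate_by_centralizer M x y.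

Let dim_le x y : S x -> S y -> (anti_dim 1%:M x <= anti_dim 1%:M y)%N.
Proof.
move=> Sx Sy; have [g [ug gM Ey]] := Sconj Sx Sy.
pose f := linfun (conjM g).
have <- : \dim (f @: anti_space 1%:M x) = anti_dim 1%:M x.
  exact: dim_conjM.
apply: dimvS; apply/subvP => _ /memv_imgP[v vT ->]; rewrite lfunE /= Ey.
apply/anti_space1P; apply: anticomm_conj => //.
by move/anti_space1P: vT.
Qed.

(** Conjugations are linear isometries of the ambient space, so the dimension and
    the index of the tangent spaces are constant along an orbit. *)
Lemma conj_embedded : embedded_submanifold S.
Proof.
have [S0|/set0P[x0 Sx0]] := eqVneq S set0.
  by exists 0%N => x; rewrite S0.
exists (anti_dim 1%:M x0) => x Sx.
exists (cayley_chart S 1%:M x); split.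
- exact: cayley_chart_submfd uM oS Sx.
- by apply/eqP; rewrite eqn_leq /= !dim_le.
- exact: cayley_chart_base uM oS Sx.
Qed.

Lemma conj_metric_index :
  exists nu, forall x, S x -> metric_index (trace_metric x) (tangent S x) nu.
Proof.
have [S0|/set0P[x0 Sx0]] := eqVneq S set0.
  by exists 0%N => x; rewrite S0.
pose negdef x (W : {vspace 'M[R]_n}) := (forall V, V \in W -> tangent S x V) /\
    (forall V, V \in W -> V != 0 -> trace_metric x V V < 0).
have transport x y (W : {vspace 'M[R]_n}) : S x -> S y -> negdef x W ->
    exists2 W' : {vspace 'M[R]_n}, negdef y W' & \dim W' = \dim W.
  move=> Sx Sy [WT Wn]; have [g [ug gM Ey]] := Sconj Sx Sy.
  pose f := linfun (conjM g); exists (f @: W)%VS.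
    split=> _ /memv_imgP[v vW ->]; rewrite lfunE /=.
      apply/tangentP => //; rewrite Ey; apply: anticomm_conj => //.
      by apply/tangentP => //; exact: WT.
    move=> v0; rewrite Ey trace_metric_conj //; last exact: Sunit.
    by apply: Wn => //; apply: contraNneq v0 => ->; rewrite linear0.
  exact: dim_conjM.
pose P k := `[< exists2 W : {vspace 'M[R]_n}, negdef x0 W & \dim W = k >].
have exP : exists k, P k.
  exists 0%N; apply/asboolP; exists 0%VS; last exact: dimv0.
  split=> V; rewrite memv0 => /eqP ->; last by rewrite eqxx.
  by apply/tangentP => //; rewrite /anticomm mul0mx mulmx0 addr0.
have ubP k : P k -> (k <= \dim {:'M[R]_n})%N.
  by move=> /asboolP[W _ <-]; apply: dimvS; exact: subvf.
have [nu Pnu nu_max] := ex_maxnP exP ubP.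
exists nu => x Sx; split.
  have /asboolP[W Wn <-] := Pnu.
  by have [W' W'n E] := transport x0 x W Sx0 Sx Wn; exists W'.
move=> W Wn; have [W' W'n <-] := transport x x0 W Sx Sx0 Wn.
by apply: nu_max; apply/asboolP; exists W'.
Qed.

End Conjugate.
End Tangent.

Section Geodesic.
Variables (R : realType) (n : nat).
Variables (M : 'M[R]_n) (S : set 'M[R]_n).
Hypotheses (uM : M \in unitmx) (oS : relatively_open (SR M) S).
Implicit Types x Y V W K g : 'M[R]_n.

Let SSR : S `<=` SR M. Proof. by case: oS => O _ -> y []. Qed.
Let Sunit x : S x -> x \in unitmx. Proof. by move=> /SSR; exact: SR_unit. Qed.

Lemma derive_trace_metric x A B V : x \in unitmx ->
  'D_V (fun y => trace_metric y A B : R) x =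
  - (\tr (invmx x *m V *m invmx x *m A *m invmx x *m B) +
     \tr (invmx x *m A *m invmx x *m V *m invmx x *m B)).
Proof.
move=> ux; have di : differentiable (fun y : 'M[R]_n => invmx y) x.
  by apply: differentiable_invmx => //; exact: ex_diff.
have did : differentiable (fun y : 'M[R]_n => y) x by exact: ex_diff.
have D1 : 'D_V (fun y : 'M[R]_n => invmx y) x = - (invmx x *m V *m invmx x).
  rewrite (@derive_invmx _ _ _ (fun y => y)) //.
  by rewrite derive_id.
have dA : differentiable (fun y : 'M[R]_n => invmx y *m A) x.
  exact: differentiable_mulmx.
have DA : 'D_V (fun y : 'M[R]_n => invmx y *m A) x = - (invmx x *m V *m invmx x) *m A.
  rewrite (@derive_mulmx _ _ _ _ _ (fun y : 'M[R]_n => invmx y) (cst A)) //.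
  by rewrite derive_cst mulmx0 addr0 D1.
have dAi : differentiable (fun y : 'M[R]_n => invmx y *m A *m invmx y) x.
  exact: differentiable_mulmx.
rewrite (@derive_linear_comp _ _ _ _ _ (@mxtrace R n)); last first.
  exact: differentiable_mulmx.
rewrite (@derive_mulmx _ _ _ _ _ (fun y : 'M[R]_n => invmx y *m A *m invmx y) (cst B)) //.
rewrite derive_cst mulmx0 addr0 derive_mulmx // DA D1.
rewrite mulNmx mulmxN mulNmx -opprD mulNmx mulmxDl raddfN raddfD /=.
by rewrite !mulmxA.
Qed.

(** As the differential of the inverse is [- x^-1 V x^-1], each of the three
    derivatives in the Christoffel term is [- (a + b)], where [a] and [b] are the
    traces of the two cyclic words in [V], [Y x] and [W]. *)
Lemma trace_metric_levi_civita (Y : 'M[R]_n -> 'M[R]_n) x V :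
  x \in unitmx ->
  levi_civita (@trace_metric R n) Y x V ('D_V Y x -
    (2^-1 : R) *: (V *m invmx x *m Y x + Y x *m invmx x *m V)).
Proof.
move=> ux W; rewrite !derive_trace_metric // /trace_metric.
rewrite mulmxBr mulmxBl mulmxBl linearB /=; congr (_ + _).
rewrite -scalemxAr -!scalemxAl linearZ /= -mulrN; congr (_ * _).
rewrite mulmxDr !mulmxDl linearD /= !mulmxA.
set a := \tr (invmx x *m V *m invmx x *m Y x *m invmx x *m W).
set b := \tr (invmx x *m Y x *m invmx x *m V *m invmx x *m W).
have -> : \tr (invmx x *m W *m invmx x *m V *m invmx x *m Y x) = a.
  by rewrite -mulmxA -mulmxA -mulmxA mxtrace_mulC !mulmxA.
have -> : \tr (invmx x *m V *m invmx x *m W *m invmx x *m Y x) = b.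
  by rewrite -mulmxA mxtrace_mulC !mulmxA.
ring.
Qed.

(** Along a curve in [S] the tangent field satisfies [Y x + x Y = 0]; the
    derivative of this identity computes the failure of ['D_V Y] to be tangent, and
    the Christoffel term compensates it exactly. *)
Lemma SR_totally_geodesic : totally_geodesic (@trace_metric R n) S.
Proof.
move=> U Y x V oU sY tY Sx Ux tV; have ux := Sunit Sx.
exists ('D_V Y x - (2^-1 : R) *: (V *m invmx x *m Y x + Y x *m invmx x *m V)).
  exact: trace_metric_levi_civita.
apply/(tangentP uM oS) => //.
have aV := tangent_anticomm oS Sx tV.
have aY := tangent_anticomm oS Sx (tY _ Sx Ux).
have dY : differentiable Y x by exact: smooth_on_differentiable sY Ux.
(* The derivative of the tangency condition along a curve with velocity [V]. *)
have E1 : 'D_V Y x *m x + x *m 'D_V Y x = - (Y x *m V + V *m Y x).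
  case: tV => gamma cg gV; have dg := curve_differentiable cg.
  case: (cg) => g0 [e e0 [sg Sg]].
  have dYg : differentiable (fun t : R => Y (gamma t)) (0 : R).
    by apply: (@differentiable_comp _ _ _ _ gamma Y) => //; rewrite g0.
  have DYg : 'D_(1 : R) (fun t : R => Y (gamma t)) (0 : R) = 'D_V Y x.
    rewrite [in RHS]deriveE // [LHS]deriveE //.
    rewrite (_ : 'd _ (0 : R) = 'd Y x \o 'd gamma (0 : R) :> (_ -> _)) /=.
      by rewrite -gV derive1E'.
    rewrite -[in 'd Y x]g0.
    by apply: (@diff_comp _ _ _ _ gamma Y) => //; rewrite g0.
  have: 'D_(1 : R) (fun t : R => Y (gamma t) *m gamma t + gamma t *m Y (gamma t)) (0 : R)
      = 'D_(1 : R) (fun _ : R => 0 : 'M[R]_n) (0 : R).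
    apply: near_eq_derive; near=> t.
    have Sgt : S (gamma t) by apply: Sg; near: t; exact: nbhsx_ballx.
    apply: (tangent_anticomm oS Sgt); apply: tY => //.
    near: t; apply: (differentiable_continuous dg).
    by rewrite g0; exact: open_nbhs_nbhs.
  rewrite derive_cst (@deriveD _ _ _ (fun t : R => Y (gamma t) *m gamma t)
    (fun t : R => gamma t *m Y (gamma t))); last 2 first.
  - by apply: diff_derivable; exact: differentiable_mulmx.
  - by apply: diff_derivable; exact: differentiable_mulmx.
  rewrite !derive_mulmx // DYg -derive1E gV g0 => E.
  apply/eqP; rewrite -addr_eq0 -[X in _ == X]E.
  apply/eqP; rewrite -!addrA; congr (_ + _).
  by rewrite addrC -addrA.
rewrite /anticomm mulmxBl mulmxBr addrACA E1 -opprD.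
rewrite -scalemxAl -scalemxAr -scalerDr mulmxDl mulmxDr.
have -> : V *m invmx x *m Y x *m x = - (V *m Y x).
  by rewrite -[_ *m Y x *m x]mulmxA (anticommE aY) mulmxN !mulmxA mulmxKV.
have -> : Y x *m invmx x *m V *m x = - (Y x *m V).
  by rewrite -[_ *m V *m x]mulmxA (anticommE aV) mulmxN !mulmxA mulmxKV.
have -> : x *m (V *m invmx x *m Y x) = - (V *m Y x).
  by rewrite !mulmxA -[x *m V]opprK -(anticommE aV) !mulNmx mulmxK.
have -> : x *m (Y x *m invmx x *m V) = - (Y x *m V).
  by rewrite !mulmxA -[x *m Y x]opprK -(anticommE aY) !mulNmx mulmxK.
rewrite mx_add2 scalerA mulVf ?pnatr_eq0 // scale1r -!opprD.
by apply/eqP; rewrite oppr_eq0 [V *m _ + _]addrC subrr.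
Unshelve. all: by end_near. Qed.

(** In the Cayley charts at [x] and at its conjugate, conjugation is the linear
    map [K |-> g K g^-1]. *)
Lemma conjM_diffeo g : g \in unitmx -> (forall Y, S Y -> S (conjM g Y)) ->
  (forall Y, S Y -> S (conjM (invmx g) Y)) ->
  is_diffeo (X := submfd S) (Y := submfd S) (conjM g).
Proof.
have smooth h : h \in unitmx -> (forall Y, S Y -> S (conjM h Y)) ->
    smooth_map (X := submfd S) (Y := submfd S) (conjM h).
  move=> uh Sh x Sx; exists (cayley_chart S 1%:M x), (cayley_chart S 1%:M (conjM h x)).
  split.
  - by split; apply: (cayley_chart_submfd uM oS) => //; exact: Sh.
  - exact: cayley_chart_base uM oS Sx.
  - move=> _ [Y [SY uY] <-]; split; first exact: Sh.
    by rewrite /= -linearD conjM_unit.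
  - have oI := open_cimage uM oS Sx.
    apply: (@eq_smooth_on _ _ _ _ (fun z => anti_coord 1%:M (conjM h x)
       (conjM h (anti_vec z)))) => //.
      move=> z /(cayley_chart_imageP uM oS Sx) u /=.
      rewrite /conjM cayley_conj //; last first.
        apply: icayley_add_unit => //; [exact: two_unitr|exact: Sunit|].
        exact: anti_vec_anticomm.
      rewrite icayleyK //; [exact: two_unitr|exact: Sunit|].
      exact: anti_vec_anticomm.
    apply: smooth_linear_comp => //; apply: smooth_linear_comp => //.
    exact: smooth_linear_mx.
move=> ug Sg Sgi; exists (conjM (invmx g)); split.
- by move=> x Sx; split; [exact: Sg|exact: conjMK].
- by move=> x Sx; split; [exact: Sgi|exact: conjMVK].
- exact: smooth.
- by apply: smooth; rewrite ?unitmx_inv.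
Qed.

Lemma conjM_isometry g : g \in unitmx -> (forall Y, S Y -> S (conjM g Y)) ->
  (forall Y, S Y -> S (conjM (invmx g) Y)) ->
  isometry_of (@trace_metric R n) S (conjM g).
Proof.
move=> ug Sg Sgi; split; first exact: conjM_diffeo.
have dif x V V' : differential_at S (conjM g) x V V' -> V' = conjM g V.
  move=> [gamma [cg <- <-]]; have dg := curve_differentiable cg.
  by rewrite !derive1E (@derive_linear_comp _ _ _ _ _ (conjM g)).
move=> x V W V' W' Sx /dif -> /dif ->.
by rewrite trace_metric_conj //; exact: Sunit.
Qed.

End Geodesic.

Section Components.
Variables (R : realType) (n : nat) (M : 'M[R]_n).
Hypothesis uM : M \in unitmx.
Variable Y : 'M[R]_n.
Let S := connected_component (SR M) Y.

Let oS : relatively_open (SR M) S. Proof. exact: component_relatively_open. Qed.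

Lemma component_conj x y : S x -> S y -> conjugate_by_centralizer M x y.
Proof.
apply: connected_conj => //; first exact: component_connected.
exact: connected_component_sub.
Qed.

Lemma component_closed_in : closed_in (@GL R n) S.
Proof.
have cS : closed S.
  apply: component_closed.
  have -> : SR M = (fun Z : 'M[R]_n => Z *m Z) @^-1` [set M] by [].
  apply: preimage_closed; last exact: (accessible_closed_set1 (hausdorff_accessible (@norm_hausdorff _ _))).
  by move=> Z _; apply: differentiable_continuous; apply: differentiable_mulmx.
split; first by move=> Z /connected_component_sub; exact: SR_unit.
by move=> Z [cZ _]; exact: cS.
Qed.

(** A matrix of the centralizer of [M] that conjugates one point of the component
    into it maps the whole component, which is connected, into itself. *)
Lemma component_homogeneous : homogeneous (@trace_metric R n) S.
Proof.
move=> x y Sx Sy; have [g [ug gM Ey]] := component_conj Sx Sy.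
have stable h a b : h \in unitmx -> h *m M = M *m h -> S a -> S b ->
    b = conjM h a -> forall Z, S Z -> S (conjM h Z).
  move=> uh hM Sa Sb Eb Z SZ.
  have cI : connected (conjM h @` S).
    apply: connected_continuous_connected; first exact: component_connected.
    by apply: continuous_subspaceT; exact: continuous_linear_mx.
  have sI : conjM h @` S `<=` SR M.
    by move=> _ [T /connected_component_sub MT <-]; exact: SR_conj.
  apply: connected_component_trans Sb _.
  by apply: (connected_component_max _ sI cI); [exists a|exists Z].
exists (conjM g) => //; apply: (conjM_isometry uM oS) => //.
  exact: stable Sx Sy Ey.
apply: (stable _ y x) => //; first by rewrite unitmx_inv.
  exact: invmx_comm.
by rewrite Ey conjMK.
Qed.

End Components.

(** * Functional calculus of diagonalizable matrices *)

Section FunctionalCalculus.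
Variables (F : fieldType) (n : nat).
Implicit Types (A X P Q : 'M[F]_n) (d e : 'rV[F]_n) (f g : F -> F).

Definition diagonalized P d A := P \in unitmx /\ A = invmx P *m diag_mx d *m P.

Lemma diagonalizable_exP A : diagonalizable A <-> exists P d, diagonalized P d A.
Proof.
split.
  move=> [P uP /(diagonalizable_forPex)[d /(simmxRL uP)E]].
  exists P, d; split=> //; rewrite E !mulmxA mulVmx // mul1mx.
  by rewrite -mulmxA mulVmx // mulmx1.
move=> [P [d [uP ->]]]; exists P => //; apply/diagonalizable_forPex; exists d.
by apply/(simmxRL uP); rewrite !mulmxA mulmxV // mul1mx -mulmxA mulmxV // mulmx1.
Qed.

Definition calc_diag f P d := invmx P *m diag_mx (map_mx f d) *m P.

(** An entry of [X] can be nonzero only where the two eigenvalues agree. *)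
Lemma diag_intertwine f X d e : X *m diag_mx d = diag_mx e *m X ->
  X *m diag_mx (map_mx f d) = diag_mx (map_mx f e) *m X.
Proof.
move=> E; apply/matrixP => i j; rewrite mul_mx_diag mul_diag_mx !mxE.
move/matrixP/(_ i j): E; rewrite mul_mx_diag mul_diag_mx !mxE => /eqP.
rewrite mulrC -subr_eq0 -mulrBl mulf_eq0 subr_eq0 => /orP[/eqP ->|/eqP ->].
  by rewrite mulrC.
by rewrite mulr0 mul0r.
Qed.

Lemma calc_diag_comm f P d Q e X : P \in unitmx -> Q \in unitmx ->
  X *m (invmx P *m diag_mx d *m P) = invmx Q *m diag_mx e *m Q *m X ->
  X *m calc_diag f P d = calc_diag f Q e *m X.
Proof.
move=> uP uQ E; rewrite /calc_diag.
have E' : (Q *m X *m invmx P) *m diag_mx d = diag_mx e *m (Q *m X *m invmx P).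
  apply: (can_inj (mulmxK uP)) => /=.
  rewrite -[RHS]mulmxA mulmxKV // -2![LHS]mulmxA -[LHS]mulmxA.
  by rewrite [invmx P *m _]mulmxA E !mulmxA mulmxV // mul1mx.
have := diag_intertwine f E'; move: (diag_mx _) (diag_mx _) => D1 D2 {E' E}E.
apply: (can_inj (mulKmx uQ)) => /=; rewrite !mulmxA mulmxV // mul1mx.
have := congr1 (mulmx^~ P) E; rewrite /= -[in X in _ = X -> _]mulmxA.
by rewrite mulmxKV // !mulmxA => ->.
Qed.

(** [f] applied to a diagonalizable matrix: the value does not depend on the
    diagonalization, as [calc_diag_comm] with [X = 1] shows. *)
Definition fmx f A : 'M[F]_n :=
  xget 0 [set X | exists P d, diagonalized P d A /\ X = calc_diag f P d].

Lemma fmxE f A P d : diagonalized P d A -> fmx f A = calc_diag f P d.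
Proof.
move=> dA; rewrite /fmx; case: xgetP => [X -> [Q [e [[uQ EA] ->]]]|].
  case: dA => uP EA'.
  have := @calc_diag_comm f Q e P d 1%:M uQ uP.
  by rewrite mul1mx mulmx1 -EA -EA' mul1mx mulmx1; apply.
by move=> /(_ (calc_diag f P d)); case; exists P, d.
Qed.

Lemma fmx_comm f A X : diagonalizable A -> X *m A = A *m X ->
  X *m fmx f A = fmx f A *m X.
Proof.
move=> /diagonalizable_exP[P [d dA]]; rewrite (fmxE f dA).
by case: dA => uP -> E; apply: calc_diag_comm.
Qed.

Lemma fmxM f g A : diagonalizable A ->
  fmx f A *m fmx g A = fmx (fun x => f x * g x) A.
Proof.
move=> /diagonalizable_exP[P [d dA]]; rewrite !(fmxE _ dA) /calc_diag.
case: dA => uP _; rewrite !mulmxA mulmxK // -[X in X *m P]mulmxA mulmx_diag.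
by congr (_ *m diag_mx _ *m _); apply/rowP => i; rewrite !mxE.
Qed.

Lemma fmxD f g A : diagonalizable A ->
  fmx f A + fmx g A = fmx (fun x => f x + g x) A.
Proof.
move=> /diagonalizable_exP[P [d dA]]; rewrite !(fmxE _ dA) /calc_diag.
rewrite -mulmxDl -mulmxDr -linearD; congr (_ *m diag_mx _ *m _).
by apply/rowP => i; rewrite !mxE.
Qed.

Lemma fmx_const c A : diagonalizable A -> fmx (fun=> c) A = c%:M.
Proof.
move=> /diagonalizable_exP[P [d dA]]; rewrite !(fmxE _ dA) /calc_diag.
have -> : map_mx (fun=> c) d = const_mx c by apply/rowP => i; rewrite !mxE.
case: dA => uP _; rewrite diag_const_mx scalar_mxC -mulmxA mulVmx //.
exact: mulmx1.
Qed.

Lemma fmx_id A : diagonalizable A -> fmx id A = A.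
Proof.
move=> /diagonalizable_exP[P [d dA]]; rewrite (fmxE _ dA) /calc_diag.
by rewrite map_mx_id //; case: dA.
Qed.

Lemma eq_fmx f g A : (forall x, f x = g x) -> fmx f A = fmx g A.
Proof. by move=> fg; congr fmx; apply/funext. Qed.

Lemma diagonalized_sqr P d A : diagonalized P d A ->
  diagonalized P (map_mx (fun x => x * x) d) (A *m A).
Proof.
case=> uP ->; split=> //.
rewrite !mulmxA mulmxK // -[X in X *m P]mulmxA mulmx_diag.
by congr (_ *m diag_mx _ *m _); apply/rowP => i; rewrite !mxE.
Qed.

Lemma fmx_sqr f A : diagonalizable A -> fmx f (A *m A) = fmx (fun x => f (x * x)) A.
Proof.
move=> /diagonalizable_exP[P [d dA]].
rewrite (fmxE f (diagonalized_sqr dA)) (fmxE _ dA) /calc_diag.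
by congr (_ *m diag_mx _ *m _); apply/rowP => i; rewrite !mxE.
Qed.

Lemma mxtrace_calc_diag f P d : P \in unitmx ->
  \tr (calc_diag f P d) = \sum_i f (d 0 i).
Proof.
move=> uP; rewrite /calc_diag -mulmxA mxtrace_mulC mulmxK // mxtrace_diag.
by apply: eq_bigr => i _; rewrite mxE.
Qed.

Lemma char_poly_diagonalized P d A : diagonalized P d A ->
  char_poly A = \prod_i ('X - (d 0 i)%:P).
Proof.
move=> [uP ->].
have -> : char_poly (invmx P *m diag_mx d *m P) = char_poly (diag_mx d).
  rewrite /char_poly /char_poly_mx.
  have -> : 'X%:M - map_mx polyC (invmx P *m diag_mx d *m P) =
     map_mx polyC (invmx P) *m ('X%:M - map_mx polyC (diag_mx d)) *m map_mx polyC P.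
    rewrite mulmxBr mulmxBl -!map_mxM; congr (_ - _).
    rewrite scalar_mxC -mulmxA -map_mxM mulVmx // map_mx1 mulmx1 //.
  rewrite !det_mulmx mulrAC -det_mulmx -map_mxM mulVmx // map_mx1 det1 mul1r //.
rewrite char_poly_trig; last exact: diag_mx_is_trig.
by apply: eq_bigr => i _; rewrite mxE eqxx.
Qed.

End FunctionalCalculus.

(** * Idempotents and involutions *)

(** The rank factorization of [E]; an idempotent is the identity on its image,
    so [b *m a = 1] and the trace is the rank. *)
Lemma idempotent_factor (F : fieldType) n (E : 'M[F]_n) : E *m E = E ->
  exists r (a : 'M[F]_(n, r)) (b : 'M[F]_(r, n)),
    [/\ E = a *m b, b *m a = 1%:M & \tr E = r%:R].
Proof.
move=> EE; exists (\rank E), (col_base E), (row_base E).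
have ba : row_base E *m col_base E = 1%:M.
  apply: (row_full_inj (col_base_full E)); apply: (row_free_inj (row_base_free E)).
  by rewrite mulmx1 mulmxA mulmx_base -mulmxA mulmx_base EE.
split=> //; first by rewrite mulmx_base.
by rewrite -[in LHS](mulmx_base E) mxtrace_mulC ba mxtrace1.
Qed.

(** An involution is the difference of two complementary idempotents, whose ranks
    are determined by the trace; bases of their images side by side form [g]. *)
Lemma involution_conj (F : numFieldType) u v h (e : (u + v)%N = h) (s : 'M[F]_h) :
  s *m s = 1%:M -> \tr s = u%:R - v%:R ->
  exists2 g, g \in unitmx &
    s = g *m castmx (e, e) (block_mx 1%:M 0 0 (- 1%:M)) *m invmx g.
Proof.
case: _ / e s => s ss ts; rewrite castmx_id.
have n2 : (2 : F) != 0 by rewrite pnatr_eq0.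
have idem (t : 'M[F]_(u + v)) : t *m t = 1%:M ->
    (2^-1 *: (1%:M + t)) *m (2^-1 *: (1%:M + t)) = 2^-1 *: (1%:M + t).
  move=> tt; rewrite -scalemxAl -scalemxAr scalerA mulmxDl !mulmxDr !mulmx1 mul1mx tt.
  by rewrite [t + _]addrC mx_add2 scalerA -mulrA mulVf // mulr1.
have trE (t : 'M[F]_(u + v)) : \tr (2^-1 *: (1%:M + t)) = 2^-1 * ((u + v)%:R + \tr t).
  by rewrite mxtraceZ mxtraceD mxtrace1.
have sNsN : - s *m - s = 1%:M by rewrite mulmxN mulNmx opprK.
have [r [a [b [Ep ba tp]]]] := idempotent_factor (idem _ ss).
have [r' [a' [b' [Eq ba' tq]]]] := idempotent_factor (idem _ sNsN).
have ru : r = u.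
  apply/eqP; rewrite -(eqr_nat F) -tp trE ts natrD; apply/eqP.
  by field.
have rv : r' = v.
  apply/eqP; rewrite -(eqr_nat F) -tq trE linearN /= ts natrD; apply/eqP.
  by field.
subst r r'.
have E1 : a *m b + a' *m b' = 1%:M.
  rewrite -Ep -Eq -scalerDr addrACA subrr addr0 mx_add2 scalerA mulVf //.
  by rewrite scale1r.
have E2 : a *m b - a' *m b' = s.
  rewrite -Ep -Eq -scalerBr opprD opprK addrACA subrr add0r mx_add2 scalerA.
  by rewrite mulVf // scale1r.
pose g := row_mx a a'.
have gK : g *m col_mx b b' = 1%:M by rewrite mul_row_col.
have [ug _] := mulmx1_unit gK.
exists g => //; have -> : invmx g = col_mx b b'.
  by apply: (can_inj (mulKmx ug)); rewrite mulmxV.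
rewrite mul_row_block mul_row_col !mulmx1 !mulmx0 addr0 add0r.
by rewrite mulmxN mulmx1 mulNmx E2.
Qed.


(** * Real forms of complex matrices *)

Section RealParts.
Variable R : realType.
Local Notation C := R[i].
Local Open Scope complex_scope.

(** [complexify], for rectangular matrices. *)
Definition cplx m n (A : 'M[R]_(m, n)) : 'M[C]_(m, n) := map_mx (real_complex R) A.
Definition conjm m n (A : 'M[C]_(m, n)) : 'M[C]_(m, n) := map_mx (@conjc R) A.
Definition Remx m n (A : 'M[C]_(m, n)) : 'M[R]_(m, n) := map_mx (@complex.Re R) A.
Definition Immx m n (A : 'M[C]_(m, n)) : 'M[R]_(m, n) := map_mx (@complex.Im R) A.

Lemma Re_sum I (r : seq I) (F : I -> C) :
  complex.Re (\sum_(i <- r) F i) = \sum_(i <- r) complex.Re (F i).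
Proof. by apply: (big_morph (@complex.Re R)) => [[a b] [c d]|]. Qed.

Lemma Im_sum I (r : seq I) (F : I -> C) :
  complex.Im (\sum_(i <- r) F i) = \sum_(i <- r) complex.Im (F i).
Proof. by apply: (big_morph (@complex.Im R)) => [[a b] [c d]|]. Qed.

Lemma RemxM m n p (A : 'M[C]_(m, n)) (B : 'M[C]_(n, p)) :
  Remx (A *m B) = Remx A *m Remx B - Immx A *m Immx B.
Proof.
apply/matrixP => i j; rewrite !mxE Re_sum -sumrB; apply: eq_bigr => k _.
by rewrite !mxE; case: (A i k) => a b; case: (B k j).
Qed.

Lemma ImmxM m n p (A : 'M[C]_(m, n)) (B : 'M[C]_(n, p)) :
  Immx (A *m B) = Remx A *m Immx B + Immx A *m Remx B.
Proof.
apply/matrixP => i j; rewrite !mxE Im_sum -big_split; apply: eq_bigr => k _ /=.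
by rewrite !mxE; case: (A i k) => a b; case: (B k j).
Qed.

Lemma Remx_cplx m n (A : 'M[R]_(m, n)) : Remx (cplx A) = A.
Proof. by apply/matrixP => i j; rewrite !mxE. Qed.

Lemma Immx_cplx m n (A : 'M[R]_(m, n)) : Immx (cplx A) = 0.
Proof. by apply/matrixP => i j; rewrite !mxE. Qed.

Lemma Remx_conjm m n (A : 'M[C]_(m, n)) : Remx (conjm A) = Remx A.
Proof. by apply/matrixP => i j; rewrite !mxE; case: (A i j). Qed.

Lemma Immx_conjm m n (A : 'M[C]_(m, n)) : Immx (conjm A) = - Immx A.
Proof. by apply/matrixP => i j; rewrite !mxE; case: (A i j). Qed.

Lemma Remx0 m n : Remx (0 : 'M[C]_(m, n)) = 0.
Proof. by apply/matrixP => i j; rewrite !mxE. Qed.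

Lemma Immx0 m n : Immx (0 : 'M[C]_(m, n)) = 0.
Proof. by apply/matrixP => i j; rewrite !mxE. Qed.

Lemma complex_mxP m n (A B : 'M[C]_(m, n)) :
  Remx A = Remx B -> Immx A = Immx B -> A = B.
Proof.
move=> /matrixP rE /matrixP iE; apply/matrixP => i j.
move: (rE i j) (iE i j); rewrite !mxE.
by case: (A i j) => a b; case: (B i j) => c d /= -> ->.
Qed.

Lemma cplx_inj m n : injective (@cplx m n).
Proof. by move=> A B /(congr1 (@Remx m n)); rewrite !Remx_cplx. Qed.

Lemma cplxM m n p (A : 'M[R]_(m, n)) (B : 'M[R]_(n, p)) :
  cplx (A *m B) = cplx A *m cplx B.
Proof. exact: map_mxM. Qed.

Lemma cplx1 n : cplx (1%:M : 'M[R]_n) = 1%:M.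
Proof. exact: map_mx1. Qed.

Lemma conjm_cplx m n (A : 'M[R]_(m, n)) : conjm (cplx A) = cplx A.
Proof. by apply/matrixP => i j; rewrite !mxE conjc_real. Qed.

Lemma conjmM m n p (A : 'M[C]_(m, n)) (B : 'M[C]_(n, p)) :
  conjm (A *m B) = conjm A *m conjm B.
Proof. exact: map_mxM. Qed.

Lemma conjm_real m n (A : 'M[C]_(m, n)) : conjm A = A -> A = cplx (Remx A).
Proof.
move=> E; apply: complex_mxP; first by rewrite Remx_cplx.
rewrite Immx_cplx; have := Immx_conjm A; rewrite E => /eqP.
rewrite -subr_eq0 opprK => /eqP h; apply/matrixP => i j.
have /matrixP/(_ i j) := h; rewrite !mxE => /eqP.
by rewrite -mulr2n mulrn_eq0 => /eqP.
Qed.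

Lemma cplx_tr n (A : 'M[R]_n) : \tr (cplx A) = (\tr A)%:C.
Proof. by rewrite /mxtrace rmorph_sum; apply: eq_bigr => i _; rewrite !mxE. Qed.

Lemma unitmx_cplx n (A : 'M[R]_n) : (cplx A \in unitmx) = (A \in unitmx).
Proof. exact: map_unitmx. Qed.

End RealParts.

Section Realify.
Variable R : realType.
Local Notation C := R[i].
Local Open Scope complex_scope.

Fact dord_subproof k (j : 'I_k) (b : bool) : (b + j.*2 < k.*2)%N.
Proof. by case: j b => j jk [] /=; rewrite ?add1n ?add0n ?ltn_Sdouble ?ltn_double. Qed.

(** The two real coordinates of the complex coordinate [j]: [b] tells the
    imaginary part from the real part. *)
Definition dord k (j : 'I_k) (b : bool) : 'I_(k.*2) := Ordinal (dord_subproof j b).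

Lemma half_dord k (j : 'I_k) b : half_ord (dord j b) = j.
Proof. by apply/val_inj; rewrite /= half_bit_double. Qed.

Lemma odd_dord k (j : 'I_k) b : odd (dord j b) = b.
Proof. by rewrite /= oddD odd_double addbF oddb. Qed.

Lemma dordK k (a : 'I_(k.*2)) : dord (half_ord a) (odd a) = a.
Proof. by apply/val_inj; rewrite /= odd_double_half. Qed.

Lemma dord_eq k (i j : 'I_k) b c : (dord i b == dord j c) = (i == j) && (b == c).
Proof.
apply/eqP/andP => [E|[/eqP -> /eqP -> //]].
have := congr1 (@half_ord k) E.
have := congr1 (fun x : 'I_(k.*2) => odd x) E.
by rewrite !odd_dord !half_dord => -> ->.
Qed.

Lemma sum_dord (V : nmodType) k (F : 'I_(k.*2) -> V) :
  \sum_a F a = \sum_j (F (dord j false) + F (dord j true)).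
Proof.
rewrite (reindex (fun p : 'I_k * bool => dord p.1 p.2)) /=; last first.
  exists (fun a => (half_ord a, odd a)) => [[j b] _|a _]; last exact: dordK.
  by rewrite half_dord odd_dord.
rewrite -(pair_bigA _ (fun j b => F (dord j b))); apply: eq_bigr => j _.
by rewrite big_bool /= addrC.
Qed.

Lemma mx_dordP m k (X X' : 'M[R]_(m.*2, k.*2)) :
  (forall i b j c, X (dord i b) (dord j c) = X' (dord i b) (dord j c)) -> X = X'.
Proof. by move=> E; apply/matrixP => a c; rewrite -(dordK a) -(dordK c). Qed.

Lemma realifyE k (A : 'M[C]_k) i b j c : realify A (dord i b) (dord j c) =
  if b == c then complex.Re (A i j)
  else if b then complex.Im (A i j) else - complex.Im (A i j).
Proof. by rewrite mxE !half_dord !odd_dord. Qed.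

Lemma realifyM k (A B : 'M[C]_k) : realify (A *m B) = realify A *m realify B.
Proof.
apply: mx_dordP => i b j c; rewrite realifyE [RHS]mxE sum_dord !mxE Re_sum Im_sum.
have E l : realify A (dord i b) (dord l false) * realify B (dord l false) (dord j c) +
           realify A (dord i b) (dord l true) * realify B (dord l true) (dord j c) =
  if b == c then complex.Re (A i l * B l j)
  else if b then complex.Im (A i l * B l j) else - complex.Im (A i l * B l j).
  rewrite !realifyE; case: (A i l) => x y; case: (B l j) => z t.
  by case: b; case: c => /=; ring.
rewrite (eq_bigr _ (fun l _ => E l)); case: b {E}; case: c => //=.
by rewrite sumrN.
Qed.

Lemma realify1 k : realify (1%:M : 'M[C]_k) = 1%:M.
Proof.
apply: mx_dordP => i b j c; rewrite realifyE !mxE.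
rewrite dord_eq.
by case: (i == j); case: b; case: c; rewrite /= ?oppr0.
Qed.

Lemma realify_inj k : injective (@realify R k).
Proof.
move=> A B E; apply: complex_mxP; apply/matrixP => i j; rewrite !mxE.
  by have /matrixP/(_ (dord i false) (dord j false)) := E; rewrite !realifyE.
by have /matrixP/(_ (dord i true) (dord j false)) := E; rewrite !realifyE.
Qed.

(** Multiplication by [i]: a real matrix is complex linear when it commutes with
    it. *)
Definition complex_structure k : 'M[R]_(k.*2) := realify ('i%C%:M : 'M[C]_k).

Lemma mul_complex_structure m k (X : 'M[R]_(m, k.*2)) i j c :
  (X *m complex_structure k) i (dord j c) =
  if c then - X i (dord j false) else X i (dord j true).
Proof.
rewrite mxE sum_dord (bigD1 j) //= big1 ?addr0 => [|l lj].
  by rewrite !realifyE !mxE eqxx /=; case: c => /=; ring.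
by rewrite !realifyE !mxE (negPf lj) /=; case: c => /=; ring.
Qed.

Lemma complex_structure_mul m k (X : 'M[R]_(k.*2, m)) i j b :
  (complex_structure k *m X) (dord i b) j =
  if b then X (dord i false) j else - X (dord i true) j.
Proof.
rewrite mxE sum_dord (bigD1 i) //= big1 ?addr0 => [|l lj].
  by rewrite !realifyE !mxE eqxx /=; case: b => /=; ring.
by rewrite !realifyE !mxE [i == l]eq_sym (negPf lj) /=; case: b => /=; ring.
Qed.

Lemma realifyP k (X : 'M[R]_(k.*2)) :
  X *m complex_structure k = complex_structure k *m X <->
  exists A : 'M[C]_k, X = realify A.
Proof.
split=> [E|[A ->]]; last first.
  by rewrite -!realifyM scalar_mxC.
exists (\matrix_(i, j) (X (dord i false) (dord j false) +i*
                        X (dord i true) (dord j false))).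
have E1 i j : X (dord i false) (dord j true) = - X (dord i true) (dord j false).
  have /matrixP/(_ (dord i false) (dord j false)) := E.
  by rewrite mul_complex_structure complex_structure_mul.
have E2 i j : X (dord i true) (dord j true) = X (dord i false) (dord j false).
  have /matrixP/(_ (dord i true) (dord j false)) := E.
  by rewrite mul_complex_structure complex_structure_mul.
by apply: mx_dordP => i b j c; rewrite realifyE mxE /=; case: b; case: c.
Qed.

Lemma unitmx_realify k (A : 'M[C]_k) : (realify A \in unitmx) = (A \in unitmx).
Proof.
apply/idP/idP => u; last first.
  have := mulmxV u => /(congr1 (@realify R k)); rewrite realifyM realify1.
  by case/mulmx1_unit.
have cA : realify A *m complex_structure k = complex_structure k *m realify A.
  by apply/realifyP; exists A.
have /realifyP[B EB] := intertwine_inv u (esym cA).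
have : realify (A *m B) = realify 1%:M by rewrite realifyM -EB mulmxV // realify1.
by move/realify_inj => /mulmx1_unit[].
Qed.

Lemma invmx_realify k (A : 'M[C]_k) : A \in unitmx ->
  invmx (realify A) = realify (invmx A).
Proof.
move=> u; have ur : realify A \in unitmx by rewrite unitmx_realify.
by apply: (can_inj (mulKmx ur)); rewrite mulmxV // -realifyM mulmxV // realify1.
Qed.

Lemma GLCP k (X : 'M[R]_(k.*2)) : GLC X <->
  X \in unitmx /\ X *m complex_structure k = complex_structure k *m X.
Proof.
split=> [[A uA <-]|[uX /realifyP[A EX]]].
  by split; [rewrite unitmx_realify|apply/realifyP; exists A].
by exists A => //; move: uX; rewrite EX unitmx_realify.
Qed.

(** The real columns spanning a complex subspace and its conjugate: a complex
    column [w] becomes the pair [Re w], [- Im w], on which multiplication by a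
    complex number acts through [realify]. [half_rows] is the dual operation,
    scaled so that complementary projections go to complementary projections. *)
Definition half_cols n m (a : 'M[C]_(n, m)) : 'M[R]_(n, m.*2) :=
  \matrix_(i, j) (if odd j then - complex.Im (a i (half_ord j))
                  else complex.Re (a i (half_ord j))).
Definition half_rows m n (b : 'M[C]_(m, n)) : 'M[R]_(m.*2, n) :=
  \matrix_(i, j) (2 * (if odd i then complex.Im (b (half_ord i) j)
                       else complex.Re (b (half_ord i) j))).

Lemma half_cols_rows n m (a : 'M[C]_(n, m)) (b : 'M[C]_(m, n)) :
  cplx (half_cols a *m half_rows b) = a *m b + conjm (a *m b).
Proof.
have -> : half_cols a *m half_rows b = 2 *: Remx (a *m b).
  rewrite RemxM; apply/matrixP => i j; rewrite !mxE sum_dord -sumrB mulr_sumr.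
  apply: eq_bigr => l _; rewrite !mxE !half_dord !odd_dord /=; ring.
apply/matrixP => i j; rewrite !mxE; move: (\sum_j _) => [x y] /=.
by apply/eqP; rewrite eq_complex /=; apply/andP; split; apply/eqP; ring.
Qed.

(** In a basis adapted to the columns of [a] and their conjugates, the hypothesis
    makes [X] preserve the splitting, so that [X] acts on the real form of the
    span of [a] as the complex matrix [b X a]. *)
Lemma half_rows_cols n m (a : 'M[C]_(n, m)) (b : 'M[C]_(m, n)) (X : 'M[R]_n) :
  b *m cplx X *m conjm a = 0 ->
  half_rows b *m X *m half_cols a = realify (b *m cplx X *m a).
Proof.
move=> E0; set t := b *m cplx X *m a.
have Rt : Remx t = Remx b *m X *m Remx a - Immx b *m X *m Immx a.
  by rewrite RemxM RemxM ImmxM Remx_cplx Immx_cplx !mulmx0 subr0 add0r.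
have It : Immx t = Remx b *m X *m Immx a + Immx b *m X *m Remx a.
  by rewrite ImmxM RemxM ImmxM Remx_cplx Immx_cplx !mulmx0 subr0 add0r.
have R0 : Remx b *m X *m Remx a + Immx b *m X *m Immx a = 0.
  have := congr1 (@Remx R _ _) E0; rewrite Remx0 RemxM RemxM ImmxM Remx_cplx Immx_cplx.
  by rewrite !mulmx0 subr0 add0r Remx_conjm Immx_conjm mulmxN opprK.
have I0 : Immx b *m X *m Remx a - Remx b *m X *m Immx a = 0.
  have := congr1 (@Immx R _ _) E0; rewrite Immx0 ImmxM RemxM ImmxM Remx_cplx Immx_cplx.
  by rewrite !mulmx0 subr0 add0r Remx_conjm Immx_conjm mulmxN addrC.
apply: mx_dordP => i b' j c; rewrite realifyE.
have -> : complex.Re (t i j) = Remx t i j by rewrite [RHS]mxE.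
have -> : complex.Im (t i j) = Immx t i j by rewrite [RHS]mxE.
have -> : (half_rows b *m X *m half_cols a) (dord i b') (dord j c) =
  2 * (if c then -1 else 1) *
  ((if b' then Immx b else Remx b) *m X *m (if c then Immx a else Remx a)) i j.
  rewrite !mxE mulr_sumr; apply: eq_bigr => l _.
  rewrite !mxE half_dord odd_dord.
  have -> : \sum_j0 half_rows b (dord i b') j0 * X j0 l =
     2 * \sum_k (if b' then Immx b else Remx b) i k * X k l.
    rewrite mulr_sumr; apply: eq_bigr => k _; rewrite !mxE half_dord odd_dord.
    by rewrite mulrA; case: b'; rewrite mxE.
  by case: c; rewrite !mxE; ring.
have -> : ((if b' then Immx b else Remx b) *m X *m (if c then Immx a else Remx a)) =
  if b' then if c then Immx b *m X *m Immx a else Immx b *m X *m Remx a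
  else if c then Remx b *m X *m Immx a else Remx b *m X *m Remx a.
  by case: b'; case: c.
move: Rt It R0 I0; move: (Remx t) (Immx t) (Remx b *m X *m Remx a)
  (Immx b *m X *m Immx a) (Remx b *m X *m Immx a) (Immx b *m X *m Remx a).
move=> T1 T2 A1 A2 A3 A4 -> -> /matrixP/(_ i j) + /matrixP/(_ i j).
rewrite !mxE => e1 e2.
by case: b'; case: c => /=; lra.
Qed.

End Realify.

(** * Semisimple square roots *)

(** [A] is killed by a product of distinct factors [X - c], in which [c = 0] can be
    dropped because [A] is invertible. Substituting [X^2] for [X] gives a
    polynomial that kills [Y]; its roots [+- sqrtC c] are again distinct. *)
Lemma sqrt_diagonalizable (F : numClosedFieldType) n (A Y : 'M[F]_n) :
  A \in unitmx -> diagonalizable A -> Y *m Y = A -> diagonalizable Y.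
Proof.
case: n A Y => [|n] A Y uA dA YY.
  apply/diagonalizable_exP; exists 1%:M, 0; split; first exact: unitmx1.
  by rewrite [LHS]flatmx0 [RHS]flatmx0.
have /diagonalizableP[rs urs rsA] := dA.
pose rs' := [seq x <- rs | x != 0].
have p0 : horner_mx A (\prod_(x <- rs) ('X - x%:P)) = 0.
  exact/mxminpoly_minP.
have p0' : horner_mx A (\prod_(x <- rs') ('X - x%:P)) = 0.
  move: p0; rewrite (bigID (fun x => x != 0)) /= -big_filter rmorphM /=.
  set B := horner_mx A (\prod_(x <- rs | ~~ _) _).
  have uB : B \in unitmx.
    rewrite /B rmorph_prod.
    apply: (big_ind (fun C : 'M[F]_n.+1 => C \in unitmx)) => [|C D uC uD|x].
    - exact: unitmx1.
    - by rewrite -mulmxE unitmx_mul uC.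
    - by rewrite negbK => /eqP ->; rewrite polyC0 subr0 /= horner_mx_X.
  by move=> /(congr1 (mulmx^~ (invmx B))); rewrite /= -mulmxE mulmxK // mul0mx.
pose ys := [seq sqrtC x | x <- rs'] ++ [seq - sqrtC x | x <- rs'].
apply/diagonalizableP; exists ys.
  have sI : injective (fun x : F => sqrtC x).
    by move=> x y E; rewrite -(sqrtCK x) E sqrtCK.
  rewrite cat_uniq !map_inj_uniq ?filter_uniq //; last first.
    by move=> x y /oppr_inj /sI.
  rewrite andbT /= -all_predC; apply/allP => _ /mapP[x xr ->] /=.
  apply/negP => /mapP[y yr E]; have xy : x = y.
    by rewrite -(sqrtCK x) -(sqrtCK y) -E sqrrN.
  move: xr; rewrite mem_filter => /andP[x0 _].
  move: E; rewrite -xy => /eqP; rewrite eq_sym -subr_eq0 opprK -mulr2n mulrn_eq0 /=.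
  by rewrite sqrtC_eq0 (negPf x0).
apply/mxminpoly_minP.
rewrite big_cat /= !big_map -big_split /= -[RHS]p0' !rmorph_prod.
apply: eq_bigr => x _ /=.
rewrite -[in RHS](sqrtCK x) polyCN opprK; move: (sqrtC x) => s.
have -> : ('X - s%:P) * ('X + s%:P) = 'X^2 - (s ^+ 2)%:P.
  by rewrite polyC_exp; ring.
rewrite !rmorphB /= rmorphXn /= !horner_mx_X !horner_mx_C.
by rewrite expr2 -mulmxE YY.
Qed.

(** In an eigenbasis the centralizer consists of block matrices, on which the
    trace form is nondegenerate because it pairs dual matrix units. *)
Lemma diagonalizable_trace_nondegenerate (F : fieldType) n (A U : 'M[F]_n) :
  diagonalizable A -> U *m A = A *m U ->
  (forall W, W *m A = A *m W -> \tr (U *m W) = 0) -> U = 0.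
Proof.
move=> /diagonalizable_exP[P [d [uP EA]]] cU tU.
have uiP : invmx P \in unitmx by rewrite unitmx_inv.
have EA' : A = conjM (invmx P) (diag_mx d) by rewrite /conjM invmxK.
have ED : diag_mx d = conjM P A by rewrite EA' conjMVK.
have cV : conjM P U *m diag_mx d = diag_mx d *m conjM P U.
  by rewrite ED -!conjM_mul // cU.
suff V0 : conjM P U = 0 by rewrite -[U](conjMK uP) V0 linear0.
apply/matrixP => i j; rewrite [RHS]mxE.
have [dij|dij] := eqVneq (d 0 i) (d 0 j); last first.
  move: cV; move: (conjM P U) => V /matrixP/(_ i j).
  rewrite mul_mx_diag mul_diag_mx !mxE => /eqP.
  by rewrite mulrC -subr_eq0 -mulrBl mulf_eq0 subr_eq0 eq_sym (negPf dij) => /eqP.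
have comm : delta_mx j i *m diag_mx d = diag_mx d *m delta_mx j i.
  apply/matrixP => k l; rewrite mul_mx_diag mul_diag_mx !mxE.
  by case: eqP => [->|_]; case: eqP => [->|_]; rewrite ?mulr0 ?mul0r //= dij mulrC.
have /tU : conjM (invmx P) (delta_mx j i) *m A = A *m conjM (invmx P) (delta_mx j i).
  by rewrite EA' -!conjM_mul // comm.
have tr_conj (B : 'M[F]_n) : \tr (conjM P B) = \tr B.
  by rewrite /conjM mxtrace_mulC mulKmx.
rewrite -tr_conj conjM_mul // conjMVK //; move: (conjM P U) => V <-.
rewrite /mxtrace (bigD1 i) //= big1 ?addr0.
  rewrite mxE (bigD1 j) //= big1 ?addr0; first by rewrite mxE !eqxx mulr1.
  by move=> l /negPf lj; rewrite mxE lj mulr0.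
move=> k /negPf ki; rewrite mxE big1 // => l _.
by rewrite mxE ki andbF mulr0.
Qed.

Section Nondegenerate.
Variables (R : realType) (n : nat) (M : 'M[R]_n).
Hypothesis ssM : semisimple M.

Lemma centralizer_trace_nondegenerate (U : 'M[R]_n) : U *m M = M *m U ->
  (forall W, W *m M = M *m W -> \tr (U *m W) = 0) -> U = 0.
Proof.
move=> cU tU; apply: (@cplx_inj R n n).
rewrite [RHS]map_mx0; apply: (diagonalizable_trace_nondegenerate ssM).
  by rewrite -[complexify M]/(cplx M) -!cplxM cU.
move=> W; rewrite -[complexify M]/(cplx M) => cW.
have cr : Remx W *m M = M *m Remx W.
  have := congr1 (@Remx R n n) cW; rewrite !RemxM Remx_cplx Immx_cplx.
  by rewrite mulmx0 mul0mx !subr0.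
have ci : Immx W *m M = M *m Immx W.
  have := congr1 (@Immx R n n) cW; rewrite !ImmxM Remx_cplx Immx_cplx.
  by rewrite mulmx0 mul0mx addr0 add0r.
have tr0 := tU _ cr; have ti0 := tU _ ci.
have -> : \tr (cplx U *m W) = ((\tr (Remx (cplx U *m W))) +i* \tr (Immx (cplx U *m W)))%C.
  apply/eqP; rewrite eq_complex /= /mxtrace Re_sum Im_sum.
  by apply/andP; split; apply/eqP; apply: eq_bigr => i _; rewrite [RHS]mxE.
rewrite RemxM ImmxM Remx_cplx Immx_cplx !mul0mx subr0 addr0 tr0 ti0 //.
Qed.

Hypothesis uM : M \in unitmx.

(** For [W] in the centralizer of [M], the matrix [W - x^-1 W x] is tangent and its
    product with [V] is [- 2 \tr (V M^-1 W)]; as [V M^-1] lies in the centralizer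
    too, this reduces to the nondegeneracy of the trace form there. *)
Lemma anticomm_nondegenerate (x V : 'M[R]_n) : SR M x -> anticomm x V ->
  (forall W, anticomm x W -> trace_metric x V W = 0) -> V = 0.
Proof.
move=> Mx aV tV; have ux := SR_unit uM Mx.
have xx : x *m x = M by [].
have aE := anticommE aV.
have cVM : V *m M = M *m V.
  by rewrite -xx mulmxA aE mulNmx -!mulmxA aE mulmxN opprK.
have ciM : V *m invmx M = invmx M *m V by rewrite (intertwine_inv uM cVM).
suff : V *m invmx M = 0 by move/(congr1 (mulmx^~ M)); rewrite /= mulmxKV // mul0mx.
apply: centralizer_trace_nondegenerate.
  by rewrite mulmxKV // ciM mulmxA mulmxV // mul1mx.
move=> W cW.
pose W' := W - invmx x *m W *m x.
have aW' : anticomm x W'.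
  rewrite /anticomm /W' mulmxBl mulmxBr !mulmxA mulmxV // mul1mx.
  rewrite -[invmx x *m W *m x *m x]mulmxA xx -mulmxA cW -xx !mulmxA mulVmx // mul1mx.
  by rewrite addrC addrA subrK subrr.
have E : invmx x *m V *m invmx x = - (V *m invmx M).
  apply: (can_inj (mulmxK ux)) => /=; rewrite mulmxKV //.
  apply: (can_inj (mulmxK ux)) => /=.
  by rewrite -[LHS]mulmxA aE mulmxN mulKmx // -[RHS]mulmxA xx mulNmx mulmxKV.
have := tV W' aW'; rewrite /trace_metric E /W' mulNmx mulmxBr linearN linearB /=.
have -> : \tr (V *m invmx M *m (invmx x *m W *m x)) = - \tr (V *m invmx M *m W).
  rewrite !mulmxA mxtrace_mulC !mulmxA.
  have xV : x *m V = - (V *m x) by rewrite aE opprK.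
  have xiM : x *m invmx M = invmx M *m x.
    by rewrite (intertwine_inv uM (SR_comm Mx)).
  rewrite xV mulNmx mulNmx mulNmx -[V *m x *m _]mulmxA xiM linearN /=.
  by rewrite !mulmxA mulmxK.
by rewrite opprK -mulr2n => /eqP; rewrite oppr_eq0 mulrn_eq0 => /eqP.
Qed.

Theorem component_geometry (Y : 'M[R]_n) (S := connected_component (SR M) Y) :
  [/\ closed_in (@GL R n) S,
      semi_riemannian_submanifold (@trace_metric R n) S,
      totally_geodesic (@trace_metric R n) S &
      homogeneous (@trace_metric R n) S].
Proof.
have oS : relatively_open (SR M) S by exact: component_relatively_open.
have cS := component_conj uM (Y := Y).
split.
- exact: (component_closed_in uM).
- split.
  + exact: conj_embedded uM oS cS.
  + move=> x V Sx tV tW; apply: (@anticomm_nondegenerate x V).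
    * exact: connected_component_sub Sx.
    * exact/(tangentP uM oS).
    * by move=> W aW; apply: tW; apply/(tangentP uM oS).
  + exact: conj_metric_index uM oS cS.
- exact: SR_totally_geodesic uM oS.
- exact: (component_homogeneous uM).
Qed.

End Nondegenerate.

(** * Cayley charts of homogeneous spaces *)

Section SmoothEntries.
Variables (R : realType) (V : normedModType R) (U : set V).
Hypothesis oU : open U.

Lemma smooth_mx m n (f : V -> 'M[R]_(m, n)) :
  (forall i j, smooth_on U (fun v => f v i j : R)) -> smooth_on U f.
Proof.
move: f; apply: smooth_coind => // [f x sf Ux|f v sf].
  by apply: differentiable_mx => i j; exact: smooth_on_differentiable (sf i j) Ux.
exists (fun x => \matrix_(i, j) 'D_v (fun y => f y i j : R) x).
  move=> i j; rewrite (_ : (fun x => _) = (fun x => 'D_v (fun y => f y i j : R) x)).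
    exact: smooth_on_derive.
  by apply/funext => x; rewrite mxE.
move=> x Ux; apply: derive_mx; apply: diff_derivable; apply: differentiable_mx => i j.
exact: smooth_on_differentiable (sf i j) Ux.
Qed.

Lemma smooth_entry m n (f : V -> 'M[R]_(m, n)) i j :
  smooth_on U f -> smooth_on U (fun v => f v i j : R).
Proof.
move=> sf; apply: (@smooth_coind _ _ _ _ (fun g =>
  exists2 f : V -> 'M[R]_(m, n), smooth_on U f & g = fun v => f v i j) oU); last by exists f.
  move=> _ x [{sf}f sf ->] Ux; apply: differentiable_entry.
  exact: smooth_on_differentiable sf Ux.
move=> _ v [{sf}f sf ->]; exists (fun x => ('D_v f x) i j).
  by exists (fun x => 'D_v f x) => //; exact: smooth_on_derive.
move=> x Ux; rewrite derive_mx ?mxE //; apply: diff_derivable.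
exact: smooth_on_differentiable sf Ux.
Qed.

Lemma smooth_row_mx m n1 n2 (f : V -> 'M[R]_(m, n1)) (g : V -> 'M[R]_(m, n2)) :
  smooth_on U f -> smooth_on U g -> smooth_on U (fun v => row_mx (f v) (g v)).
Proof.
move=> sf sg; apply: smooth_mx => i j; case: (split_ordP j) => k ->.
  rewrite (_ : (fun v => _) = (fun v => f v i k)); first exact: smooth_entry.
  by apply/funext => v; rewrite row_mxEl.
rewrite (_ : (fun v => _) = (fun v => g v i k)); first exact: smooth_entry.
by apply/funext => v; rewrite row_mxEr.
Qed.

Lemma smooth_mxrow m N (p : 'I_N -> nat) (f : forall i, V -> 'M[R]_(m, p i)) :
  (forall i, smooth_on U (f i)) -> smooth_on U (fun v => \mxrow_i f i v).
Proof.
move=> sf; apply: smooth_mx => i j.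
rewrite (_ : (fun v => _) = (fun v => f (tagnat.sig1 j) v i (tagnat.sig2 j))).
  exact: smooth_entry.
by apply/funext => v; rewrite mxE.
Qed.

End SmoothEntries.

Section HomChart.
Variables (R : realType) (N : nat) (G H : set 'M[R]_N) (J D : 'M[R]_N).
Implicit Types (g h x Y K : 'M[R]_N) (X : set 'M[R]_N).

(** What the three kinds of homogeneous spaces have in common: [G] is the group of
    units of a commutant and [G / H] is the orbit of [D] under conjugation, which
    consists of square roots of the same matrix [D *m D]. *)
Record stabilizer_pair : Prop := StabilizerPair {
  sp_G : forall g, G g <-> g \in unitmx /\ g *m J = J *m g;
  sp_H : forall h, H h <-> G h /\ h *m D = D *m h;
  sp_DJ : D *m J = J *m D;
  sp_D : D \in unitmx;
  sp_DD : forall g, G g -> g *m (D *m D) = D *m D *m g }.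

Hypothesis sp : stabilizer_pair.

(** The coset of [H] that corresponds to the point [Y] of the orbit of [D] under
    conjugation. *)
Definition fiber Y := [set g | G g /\ g *m D = Y *m g].
(** The point [g D g^-1] of the orbit attached to the coset [g H], which is nonempty:
    the default value [1] of [xget] is never taken on cosets. *)
Definition orbit_value X := conjM (xget 1%:M X) D.

Lemma sp_unit g : G g -> g \in unitmx.
Proof. by move=> /(sp_G sp)[]. Qed.

(** Two elements of [G] that carry [D] to the same point differ by an element of
    its stabilizer. *)
Lemma lcoset_fiber g : G g -> lcoset_mx H g = fiber (conjM g D).
Proof.
move=> Gg; have /(sp_G sp)[ug gJ] := Gg; apply/seteqP; split=> k /=.
  move=> [h /(sp_H sp)[/(sp_G sp)[uh hJ] hD] <-]; split.
    by apply/(sp_G sp); rewrite unitmx_mul ug uh -mulmxA hJ !mulmxA gJ.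
  by rewrite /conjM -mulmxA hD !mulmxA mulmxKV.
move=> [/(sp_G sp)[uk kJ] kD]; exists (invmx g *m k); last by rewrite mulKVmx.
have ugk : invmx g *m k \in unitmx by rewrite unitmx_mul unitmx_inv ug.
apply/(sp_H sp); split.
  by apply/(sp_G sp); split=> //; rewrite -mulmxA kJ !mulmxA invmx_comm.
by rewrite -mulmxA kD /conjM !mulmxA mulVmx // mul1mx.
Qed.

Lemma fiber_refl g : G g -> fiber (conjM g D) g.
Proof. by move=> Gg; split=> //; rewrite /conjM mulmxKV // sp_unit. Qed.

Lemma orbit_value_fiber Y g : fiber Y g -> orbit_value (fiber Y) = Y.
Proof.
move=> Fg; rewrite /orbit_value; case: xgetP => [k -> [Gk kD]|/(_ g) //].
by rewrite /conjM kD mulmxK // sp_unit.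
Qed.

Lemma orbit_value_lcoset g : G g -> orbit_value (lcoset_mx H g) = conjM g D.
Proof.
by move=> Gg; rewrite lcoset_fiber //; exact: orbit_value_fiber (fiber_refl Gg).
Qed.

Lemma conjM_sqr g : G g -> conjM g D *m conjM g D = D *m D.
Proof.
move=> Gg; rewrite -conjM_mul ?sp_unit // conjM_id ?sp_unit //.
exact: (sp_DD sp).
Qed.

Lemma conjM_comm g : G g -> conjM g D *m J = J *m conjM g D.
Proof.
move=> /(sp_G sp)[ug gJ]; rewrite /conjM -mulmxA (invmx_comm ug gJ).
by rewrite !mulmxA -[g *m D *m J]mulmxA (sp_DJ sp) mulmxA gJ.
Qed.

Lemma cayley_comm x Y : x *m J = J *m x -> Y *m J = J *m Y -> Y + x \in unitmx ->
  cayley x Y *m J = J *m cayley x Y.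
Proof.
move=> xJ YJ u; rewrite /cayley -mulmxA (intertwine_inv (B := J) u).
  by rewrite !mulmxA mulmxBl mulmxBr xJ YJ.
by rewrite mulmxDl mulmxDr xJ YJ.
Qed.

Variable g0 : 'M[R]_N.
Hypothesis Gg0 : G g0.
Let x0 := conjM g0 D.

Lemma hom_base_unit : x0 \in unitmx.
Proof. by rewrite (conjM_unit _ (sp_unit Gg0)); exact: (sp_D sp). Qed.

(** Cayley coordinates at [x0] of the point of the orbit; since [1 + K] conjugates
    [x0] to the point with coordinate [K], the section [(1 + K) g0] is affine in
    [K]. *)
Definition hom_chart : chart R (set 'M[R]_N) :=
  Chart [set X | (lcoset_mx H @` G) X /\ orbit_value X + x0 \in unitmx]
        (fun X => anti_coord J x0 (cayley x0 (orbit_value X)))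
        (fun z => lcoset_mx H ((1%:M + anti_vec z) *m g0)).

Lemma hom_chart_anti g : G g -> conjM g D + x0 \in unitmx ->
  cayley x0 (conjM g D) \in anti_space J x0.
Proof.
move=> Gg u; apply/anti_spaceP; split.
  by apply: cayley_anticomm => //; rewrite !conjM_sqr.
by apply: cayley_comm => //; exact: conjM_comm.
Qed.

Lemma hom_section_in z : 1%:M + @anti_vec R N J x0 z \in unitmx ->
  G ((1%:M + anti_vec z) *m g0).
Proof.
move=> u; have /(sp_G sp)[ug gJ] := Gg0; apply/(sp_G sp).
rewrite unitmx_mul u ug; split=> //.
by rewrite -mulmxA gJ !mulmxA mulmxDl mulmxDr mulmx1 mul1mx anti_vec_comm.
Qed.

Lemma hom_section_conj K : 1%:M + K \in unitmx ->
  conjM ((1%:M + K) *m g0) D = icayley x0 K.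
Proof.
by move=> u; rewrite /conjM (invmxM (sp_unit Gg0) u) /icayley /x0 /conjM !mulmxA.
Qed.

Lemma orbit_value_cinv z : 1%:M + anti_vec z \in unitmx ->
  orbit_value (cinv hom_chart z) = icayley x0 (anti_vec z).
Proof.
move=> u; rewrite /= orbit_value_lcoset; last exact: hom_section_in.
exact: hom_section_conj.
Qed.

Lemma hom_chart_image : cimage hom_chart = [set z | 1%:M + anti_vec z \in unitmx].
Proof.
apply/seteqP; split=> z /=.
  move=> [_ [[g Gg <-] + <-]]; rewrite orbit_value_lcoset // => u.
  rewrite /= orbit_value_lcoset // anti_coordK; last exact: hom_chart_anti.
  apply: cayley_unit => //; first exact: two_unitr.
  by rewrite (conjM_unit _ (sp_unit Gg)); exact: (sp_D sp).
move=> u; exists (cinv hom_chart z).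
  split; first by exists ((1%:M + anti_vec z) *m g0) => //; exact: hom_section_in.
  rewrite orbit_value_cinv //; apply: icayley_add_unit => //.
  - exact: two_unitr.
  - exact: hom_base_unit.
  - exact: anti_vec_anticomm.
rewrite /= orbit_value_lcoset; last exact: hom_section_in.
rewrite hom_section_conj // icayleyK ?anti_vecK //.
- exact: two_unitr.
- exact: hom_base_unit.
- exact: anti_vec_anticomm.
Qed.

Lemma hom_chartK X : cdom hom_chart X -> cinv hom_chart (cmap hom_chart X) = X.
Proof.
move=> [[g Gg <-]]; rewrite orbit_value_lcoset // => u.
rewrite /= orbit_value_lcoset // anti_coordK; last exact: hom_chart_anti.
have uK : 1%:M + cayley x0 (conjM g D) \in unitmx.
  apply: cayley_unit => //; first exact: two_unitr.
  by rewrite (conjM_unit _ (sp_unit Gg)); exact: (sp_D sp).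
rewrite !lcoset_fiber //; last first.
  rewrite -[cayley _ _](anti_coordK (hom_chart_anti Gg u)).
  by apply: hom_section_in; rewrite anti_coordK //; exact: hom_chart_anti.
rewrite hom_section_conj // cayleyK //; first exact: two_unitr.
- by rewrite (conjM_unit _ (sp_unit Gg)); exact: (sp_D sp).
- by rewrite !conjM_sqr.
Qed.

Let O := [set g | g *m D + x0 *m g \in unitmx].

Lemma open_hom_dom : open O.
Proof.
rewrite (_ : O = [set g | setT g /\ g *m D + x0 *m g \in unitmx]).
  apply: open_preim_unit; first exact: openT.
  move=> z _; apply: differentiable_continuous.
  apply: (differentiable_linear_mx (mulmxr D \+ mulmx x0)).
by apply/seteqP; split => z //= [].
Qed.

Lemma hom_dom_unit g : g \in unitmx ->
  (g *m D + x0 *m g \in unitmx) = (conjM g D + x0 \in unitmx).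
Proof.
move=> ug; have -> : g *m D + x0 *m g = (conjM g D + x0) *m g.
  by rewrite mulmxDl /conjM mulmxKV.
by rewrite unitmx_mul ug andbT.
Qed.

(** On the group the coordinate is a rational function of [g], without a choice of
    representative. *)
Lemma hom_cayley g : g \in unitmx -> conjM g D + x0 \in unitmx ->
  cayley x0 (conjM g D) = (g *m D - x0 *m g) *m invmx (g *m D + x0 *m g).
Proof.
move=> ug u; have -> : g *m D + x0 *m g = (conjM g D + x0) *m g.
  by rewrite mulmxDl /conjM mulmxKV.
have -> : g *m D - x0 *m g = (conjM g D - x0) *m g.
  by rewrite mulmxBl /conjM mulmxKV.
by rewrite invmxM // mulmxA mulmxK.
Qed.

Lemma hom_chart_charts : charts (homspace G H) hom_chart.
Proof.
have domE g : G g -> cdom hom_chart (lcoset_mx H g) <-> O g.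
  move=> Gg; have uE := hom_dom_unit (sp_unit Gg).
  split=> [[_]|Og]; first by rewrite /O /= orbit_value_lcoset // uE.
  by split; [exists g|rewrite orbit_value_lcoset // -uE].
split.
- split; last exact: hom_chartK.
  by rewrite hom_chart_image; exact: open_units_affine.
- by move=> X [].
- exists O; first exact: open_hom_dom.
  by apply/seteqP; split=> g /= [Gg] => [/(domE _ Gg)|/(domE _ Gg)].
- move=> g [Gg /(domE _ Gg) Og].
  exists O, (fun g => anti_coord J x0
    ((g *m D - x0 *m g) *m invmx (g *m D + x0 *m g))); split=> //.
  + exact: open_hom_dom.
  + apply: smooth_linear_comp; first exact: open_hom_dom.
    apply: smooth_mulmx; first exact: open_hom_dom.
      apply: (@smooth_linear_mx _ _ _ _ O (mulmxr D \- mulmx x0)).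
      exact: open_hom_dom.
    apply: smooth_invmx; [exact: open_hom_dom| |by []].
    apply: (@smooth_linear_mx _ _ _ _ O (mulmxr D \+ mulmx x0)).
    exact: open_hom_dom.
  + move=> h _ [Gh /(domE _ Gh)]; rewrite /O /= => u.
    have uh := sp_unit Gh; rewrite orbit_value_lcoset // (hom_cayley uh) //.
    by rewrite -(hom_dom_unit uh).
- move=> z zI; exists (cimage hom_chart), (fun z => (1%:M + anti_vec z) *m g0).
  have oI : open (cimage hom_chart) by rewrite hom_chart_image; exact: open_units_affine.
  split=> //.
  + apply: smooth_mulmx => //; last exact: smooth_cst.
    by apply: smooth_add => //; [exact: smooth_cst|exact: smooth_linear_mx].
  + by move=> w; rewrite hom_chart_image => u; split=> //; exact: hom_section_in.
Qed.

End HomChart.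

(** * Iterated products of manifolds *)

(** [Z] is, up to reindexing, the product of the family [X]: what maps into and
    out of an iterated product need of its charts. Nested products of manifolds
    are thereby handled as one product over a single index type. *)
Definition product_like (R : realType) (I : Type) (X : I -> mfd R) (Z : mfd R)
  (to : (forall b, mtype (X b)) -> mtype Z)
  (from : mtype Z -> forall b, mtype (X b)) : Prop :=
  [/\ forall z, to (from z) = z,
      forall y b, from (to y) b = y b,
      forall z, carrier Z z <-> forall b, carrier (X b) (from z b) &
      forall c : (forall b, chart R (mtype (X b))),
        (forall b, charts (X b) (c b)) ->
        exists (d : chart R (mtype Z))
               (pi : forall b, 'rV[R]_(cdim d) -> 'rV[R]_(cdim (c b))),
        [/\ charts Z d,
            forall z, cdom d z <-> forall b, cdom (c b) (from z b),
            forall w, (forall b, cimage (c b) (pi b w)) -> cimage d w,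
            forall b, [/\ linear (pi b),
              forall z, pi b (cmap d z) = cmap (c b) (from z b) &
              forall w, from (cinv d w) b = cinv (c b) (pi b w)] &
            forall (V : normedModType R) (U : set V) (f : V -> mtype Z), open U ->
              (forall b, smooth_on U (fun v => cmap (c b) (from (f v) b))) ->
              smooth_on U (fun v => cmap d (f v))]].

Lemma product_like_unit (R : realType) (X : unit -> mfd R) :
  @product_like R unit X (X tt) (fun y => y tt)
    (fun z b => match b with tt => z end).
Proof.
split=> //; [by move=> y []|by move=> z; split=> [Xz []|/(_ tt)]|].
move=> c Xc; exists (c tt), (fun b => match b with tt => id end); split=> //.
- by move=> z; split=> [dz []|/(_ tt)].
- by case; split.
Qed.

Lemma dependent_pick (I : Type) (T : I -> Type) (P : forall i, T i -> Prop) :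
  (forall i, exists y, P i y) -> exists f : (forall i, T i), forall i, P i (f i).
Proof. by move=> ex; exists (fun i => sval (cid (ex i))) => i; exact: svalP. Qed.

Section ProductLikeProd.
Variables (R : realType) (N : nat) (J : 'I_N -> Type).
Variables (X : {i & J i} -> mfd R) (Z : 'I_N -> mfd R).
Variables (to : forall i, (forall j, mtype (X (existT J i j))) -> mtype (Z i)).
Variables (from : forall i, mtype (Z i) -> forall j, mtype (X (existT J i j))).
Hypothesis pl : forall i,
  @product_like R (J i) (fun j => X (existT J i j)) (Z i) (@to i) (@from i).

Lemma product_like_prod :
  @product_like R {i & J i} X (prod_mfd Z)
    (fun y i => @to i (fun j => y (existT J i j)))
    (fun z b => match b return mtype (X b) with
      existT i j => @from i (z i) j end).
Proof.
split.
- move=> z; apply: functional_extensionality_dep => i.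
  by case: (pl i) => toK _ _ _; rewrite /= toK.
- by move=> y [i j] /=; case: (pl i) => _ -> _ _.
- move=> z; split=> [Zz [i j]|Xz i].
    by case: (pl i) => _ _ + _ => /(_ (z i)) [+ _] => /(_ (Zz i)).
  case: (pl i) => _ _ + _ => /(_ (z i)) [_ +]; apply => j.
  exact: (Xz (existT J i j)).
move=> c Xc.
have ex i := let: And4 _ _ _ h := pl i in
  h (fun j => c (existT J i j)) (fun j => Xc (existT J i j)).
have [d ex2] := dependent_pick ex.
have [pi P] := dependent_pick ex2.
exists (prod_chart d), (fun b w => match b return 'rV[R]_(cdim (c b)) with
  existT i j => pi i j (submxrow w i) end); split.
- by exists d => // i; case: (P i).
- move=> z; split=> [dz [i j]|cz i].
    by case: (P i) => _ + _ _ _ => /(_ (z i)) [+ _] => /(_ (dz i)).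
  case: (P i) => _ + _ _ _ => /(_ (z i)) [_ +]; apply => j.
  exact: (cz (existT J i j)).
- move=> w cw.
  have dw i : cimage (d i) (submxrow w i).
    by case: (P i) => _ _ + _ _; apply => j; exact: (cw (existT J i j)).
  have xw i := cid2 (dw i).
  exists (fun i => s2val (xw i)); first by move=> i; exact: (s2valP (xw i)).
  rewrite /= -[RHS]submxrowK; congr mxrow.
  by apply: functional_extensionality_dep => i; exact: (s2valP' (xw i)).
- move=> [i j]; case: (P i) => _ _ _ /(_ j)[lin E1 E2] _; split.
  + move=> a u v; rewrite -lin; congr (pi i j _).
    by apply/matrixP => k l; rewrite !mxE.
  + by move=> z; rewrite -E1 /= mxrowK.
  + by move=> w; rewrite -E2.
- move=> V U f oU sf; apply: smooth_mxrow => // i.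
  case: (P i) => _ _ _ _ h; apply: (h V U (fun v => f v i) oU) => j.
  exact: (sf (existT J i j)).
Qed.

End ProductLikeProd.

Section ProductLikePair.
Variables (R : realType) (I1 I2 : Type).
Variables (X : I1 + I2 -> mfd R) (Z1 Z2 : mfd R).
Variables (to1 : (forall j, mtype (X (inl j))) -> mtype Z1).
Variables (from1 : mtype Z1 -> forall j, mtype (X (inl j))).
Variables (to2 : (forall j, mtype (X (inr j))) -> mtype Z2).
Variables (from2 : mtype Z2 -> forall j, mtype (X (inr j))).
Hypothesis pl1 : @product_like R I1 (fun j => X (inl j)) Z1 to1 from1.
Hypothesis pl2 : @product_like R I2 (fun j => X (inr j)) Z2 to2 from2.

Lemma product_like_pair :
  @product_like R (I1 + I2) X (pair_mfd Z1 Z2)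
    (fun y => (to1 (fun i => y (inl i)), to2 (fun j => y (inr j))))
    (fun z b => match b return mtype (X b) with
      inl i => from1 z.1 i | inr j => from2 z.2 j end).
Proof.
case: pl1 => toK1 fromK1 c1 ch1; case: pl2 => toK2 fromK2 c2 ch2; split.
- by move=> [z1 z2] /=; rewrite toK1 toK2.
- by move=> y [i|j] /=; rewrite ?fromK1 ?fromK2.
- move=> [z1 z2]; split=> [[/c1 h1 /c2 h2]|h].
    by move=> [i|j]; [exact: (h1 i)|exact: (h2 j)].
  split.
    by apply/c1 => i; exact: (h (inl i)).
  by apply/c2 => j; exact: (h (inr j)).
move=> c Xc.
have [d1 [pi1 [Zd1 D1 C1 L1 S1]]] := ch1 (fun i => c (inl i)) (fun i => Xc (inl i)).
have [d2 [pi2 [Zd2 D2 C2 L2 S2]]] := ch2 (fun i => c (inr i)) (fun i => Xc (inr i)).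
exists (pair_chart d1 d2), (fun b w => match b return 'rV[R]_(cdim (c b)) with
  inl i => pi1 i (lsubmx w) | inr j => pi2 j (rsubmx w) end); split.
- by exists (d1, d2).
- move=> [z1 z2]; split=> [[/D1 h1 /D2 h2]|h].
    by move=> [i|j]; [exact: (h1 i)|exact: (h2 j)].
  split.
    by apply/D1 => i; exact: (h (inl i)).
  by apply/D2 => j; exact: (h (inr j)).
- move=> w cw.
  have [x1 dx1 E1] := C1 _ (fun i => cw (inl i)).
  have [x2 dx2 E2] := C2 _ (fun j => cw (inr j)).
  by exists (x1, x2); rewrite //= E1 E2 hsubmxK.
- move=> [i|j].
    case: (L1 i) => lin E1 E2; split=> [a u v|[z1 z2]|w] /=.
    + by rewrite -lin linearP.
    + by rewrite row_mxKl E1.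
    + exact: E2.
  case: (L2 j) => lin E1 E2; split=> [a u v|[z1 z2]|w] /=.
  + by rewrite -lin linearP.
  + by rewrite row_mxKr E1.
  + exact: E2.
- move=> V U f oU sf; apply: smooth_row_mx => //.
    by apply: (S1 V U (fun v => (f v).1)) => // i; exact: (sf (inl i)).
  by apply: (S2 V U (fun v => (f v).2)) => // j; exact: (sf (inr j)).
Qed.

End ProductLikePair.

(** * Block decompositions *)

Lemma bigcap_open_finite (T : topologicalType) (I : finType) (F : I -> set T) :
  (forall b, open (F b)) -> open (\bigcap_(b in [set: I]) F b).
Proof.
move=> oF; rewrite openE => x Fx.
have h : \forall y \near x, forall b, F b y.
  by apply: filter_forall => b; apply: open_nbhs_nbhs; split; [exact: oF|exact: Fx].
by apply: filterS h => y Fy b _; exact: Fy.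
Qed.

Section Blocks.
Variables (R : realType) (n : nat) (M : 'M[R]_n) (S : set 'M[R]_n).
Hypothesis uM : M \in unitmx.
Variables (I : finType) (N : I -> nat).
Variables (G H : forall b, set 'M[R]_(N b)) (J D : forall b, 'M[R]_(N b)).
Variables (A : forall b, 'M[R]_(n, N b)) (B : forall b, 'M[R]_(N b, n)).

Definition blk b (X : 'M[R]_n) := B b *m X *m A b.
Definition glue (K : forall b, 'M[R]_(N b)) := \sum_b A b *m K b *m B b.

(** A splitting of the space into isotypic pieces for [M], given by inclusions
    [A] and projections [B], such that [S] consists of the square roots of [M]
    whose blocks lie in the [G b]-orbits of the matrices [D b]. *)
Record block_decomposition : Prop := BlockDecomposition {
  bd_pair : forall b, stabilizer_pair (@G b) (@H b) (J b) (D b);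
  bd_BA : forall b, B b *m A b = 1%:M;
  bd_BA0 : forall b c, b != c -> B b *m A c = 0;
  bd_sum : \sum_b A b *m B b = 1%:M;
  bd_comm0 : forall X b c, X *m M = M *m X -> b != c -> B b *m X *m A c = 0;
  bd_commJ : forall X b, X *m M = M *m X -> blk b X *m J b = J b *m blk b X;
  bd_M : glue (fun b => D b *m D b) = M;
  bd_S : forall Y, S Y <-> SR M Y /\
    forall b, exists2 g, G g & blk b Y = conjM g (D b) }.

Hypothesis bd : block_decomposition.

Lemma blk_glue K b : blk b (glue K) = K b.
Proof.
rewrite /blk /glue mulmx_sumr mulmx_suml (bigD1 b) //= big1 ?addr0.
  by rewrite !mulmxA bd_BA // mul1mx -mulmxA bd_BA // mulmx1.
by move=> c cb; rewrite !mulmxA bd_BA0 // 1?eq_sym // !mul0mx.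
Qed.

Lemma glue_blk X : X *m M = M *m X -> glue (fun b => blk b X) = X.
Proof.
move=> cX; rewrite -[RHS]mul1mx -[RHS]mulmx1 -(bd_sum bd) mulmx_suml mulmx_suml.
apply: eq_bigr => b _; rewrite mulmx_sumr (bigD1 b) //= big1 ?addr0.
  by rewrite /blk !mulmxA.
move=> c cb; have -> : A b *m B b *m X *m (A c *m B c) =
  A b *m (B b *m X *m A c) *m B c by rewrite !mulmxA.
by rewrite bd_comm0 // 1?eq_sym // mulmx0 mul0mx.
Qed.

Lemma glueM K K' : glue K *m glue K' = glue (fun b => K b *m K' b).
Proof.
rewrite /glue mulmx_suml; apply: eq_bigr => b _.
rewrite mulmx_sumr (bigD1 b) //= big1 ?addr0.
  by rewrite !mulmxA -[A b *m K b *m B b *m A b]mulmxA bd_BA // mulmx1.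
move=> c cb; rewrite !mulmxA -[A b *m K b *m B b *m A c]mulmxA.
by rewrite bd_BA0 // 1?eq_sym // mulmx0 !mul0mx.
Qed.

Lemma glueD K K' : glue K + glue K' = glue (fun b => K b + K' b).
Proof.
by rewrite /glue -big_split; apply: eq_bigr => b _; rewrite mulmxDr mulmxDl.
Qed.

Lemma glue1 : glue (fun b => 1%:M) = 1%:M.
Proof. by rewrite -(bd_sum bd); apply: eq_bigr => b _; rewrite mulmx1. Qed.

Lemma glue_unit K : (forall b, K b \in unitmx) -> glue K \in unitmx.
Proof.
move=> uK; suff : glue K *m glue (fun b => invmx (K b)) = 1%:M.
  by case/mulmx1_unit.
by rewrite glueM -glue1; apply: eq_bigr => b _; rewrite mulmxV.
Qed.

Lemma blkM X X' b : X *m M = M *m X -> X' *m M = M *m X' ->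
  blk b (X *m X') = blk b X *m blk b X'.
Proof.
by move=> cX cX'; rewrite -{1}(glue_blk cX) -{1}(glue_blk cX') glueM blk_glue.
Qed.

Lemma blkD X X' b : blk b (X + X') = blk b X + blk b X'.
Proof. by rewrite /blk mulmxDr mulmxDl. Qed.

Lemma blk1 b : blk b 1%:M = 1%:M.
Proof. by rewrite /blk mulmx1 bd_BA. Qed.

Lemma blk_unit X b : X *m M = M *m X -> X \in unitmx -> blk b X \in unitmx.
Proof.
move=> cX uX; suff : blk b X *m blk b (invmx X) = 1%:M by case/mulmx1_unit.
by rewrite -blkM ?mulmxV ?blk1 //; exact: invmx_comm.
Qed.

Lemma blk_invmx X b : X *m M = M *m X -> X \in unitmx ->
  blk b (invmx X) = invmx (blk b X).
Proof.
move=> cX uX; have u := blk_unit b cX uX; apply: (can_inj (mulKmx u)) => /=.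
by rewrite mulmxV // -blkM ?mulmxV ?blk1 //; exact: invmx_comm.
Qed.

Lemma blk_cayley x Y b : SR M x -> SR M Y -> Y + x \in unitmx ->
  blk b (cayley x Y) = cayley (blk b x) (blk b Y).
Proof.
move=> Mx MY u; have cD : (Y + x) *m M = M *m (Y + x).
  by rewrite mulmxDl mulmxDr (SR_comm Mx) (SR_comm MY).
have cB : (Y - x) *m M = M *m (Y - x).
  by rewrite mulmxBl mulmxBr (SR_comm Mx) (SR_comm MY).
rewrite /cayley blkM //; last exact: invmx_comm.
by rewrite blk_invmx // !blkD [blk b (- x)]/blk mulmxN mulNmx.
Qed.

Lemma S_SR : S `<=` SR M.
Proof. by move=> Y /(bd_S bd)[]. Qed.

(** A square root of [M] close to [x] is conjugate to [x] by an element of the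
    centralizer, whose blocks lie in the groups [G b]: the orbit of each block is
    preserved. *)
Lemma S_relatively_open : relatively_open (SR M) S.
Proof.
exists (\bigcup_(x in S) [set Y | Y + x \in unitmx]).
  by apply: bigcup_open => y _; exact: open_addunit.
apply/seteqP; split=> Y.
  move=> SY; split; first exact: S_SR.
  exists Y => //=; rewrite mx_add2 unitmxZ ?two_unitr //.
  exact: SR_unit uM (S_SR SY).
move=> [MY [x Sx /= u]]; apply/(bd_S bd); split=> // b.
have [P [uP cP ->]] := SR_near_conj (S_SR Sx) MY u.
have [_ /(_ b)[g Gg Eg]] := (bd_S bd x).1 Sx.
have cx := SR_comm (S_SR Sx).
have uPb := blk_unit b cP uP.
have ug := sp_unit (bd_pair bd b) Gg.
exists (blk b P *m g).
  have /(sp_G (bd_pair bd b))[_ gJ] := Gg; apply/(sp_G (bd_pair bd b)).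
  rewrite unitmx_mul uPb ug; split=> //.
  move: (bd_commJ bd b cP); move: (blk b P) => Pb PJ.
  by rewrite -mulmxA gJ !mulmxA PJ.
have cPx : (P *m x) *m M = M *m (P *m x) by rewrite -mulmxA cx !mulmxA cP.
rewrite /conjM (blkM _ cPx (invmx_comm uP cP)) blkM // Eg blk_invmx // /conjM (invmxM ug uPb).
by rewrite !mulmxA.
Qed.

Variables (Z : mfd R).
Variables (to : (forall b, mtype (homspace (@G b) (@H b))) -> mtype Z).
Variables (from : mtype Z -> forall b, mtype (homspace (@G b) (@H b))).
Arguments from : clear implicits.
Hypothesis pl : product_like to from.

Definition blocks_map (Y : 'M[R]_n) : mtype Z :=
  to (fun b => fiber (@G b) (D b) (blk b Y)).
Definition blocks_inv (z : mtype Z) : 'M[R]_n :=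
  glue (fun b => orbit_value (D b) (from z b)).

Let toK z : to (from z) = z. Proof. by case: pl. Qed.
Let fromK y b : from (to y) b = y b. Proof. by case: pl => _ ->. Qed.
Let carrierP z : carrier Z z <-> forall b, (lcoset_mx (@H b) @` (@G b)) (from z b).
Proof. by case: pl => _ _ /(_ z). Qed.

Lemma blocks_map_in Y : S Y -> carrier Z (blocks_map Y).
Proof.
move=> /(bd_S bd)[_ SY]; apply/carrierP => b; rewrite fromK.
have [g Gg ->] := SY b; exists g => //.
by rewrite (lcoset_fiber (bd_pair bd b)).
Qed.

Lemma orbit_value_blocks_map Y b : S Y ->
  orbit_value (D b) (from (blocks_map Y) b) = blk b Y.
Proof.
move=> /(bd_S bd)[_ /(_ b)[g Gg E]]; rewrite fromK E.
exact: (orbit_value_fiber (bd_pair bd b) (fiber_refl (bd_pair bd b) Gg)).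
Qed.

Lemma blocks_mapK Y : S Y -> blocks_inv (blocks_map Y) = Y.
Proof.
move=> SY; rewrite -[RHS]glue_blk; last exact: SR_comm (S_SR SY).
by apply: eq_bigr => b _; rewrite orbit_value_blocks_map.
Qed.

Lemma blocks_inv_in z : carrier Z z -> S (blocks_inv z).
Proof.
move=> /carrierP Zz.
have ov b : exists2 g, @G b g & orbit_value (D b) (from z b) = conjM g (D b).
  have [g Gg <-] := Zz b; exists g => //.
  exact: (orbit_value_lcoset (bd_pair bd b)).
apply/(bd_S bd); split.
  rewrite /SR /= /blocks_inv glueM -[RHS](bd_M bd); apply: eq_bigr => b _.
  by have [g Gg ->] := ov b; rewrite (conjM_sqr (bd_pair bd b)).
by move=> b; have [g Gg E] := ov b; exists g; rewrite ?blk_glue.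
Qed.

Lemma blocks_invK z : carrier Z z -> blocks_map (blocks_inv z) = z.
Proof.
move=> Zz; rewrite -[RHS]toK; congr to; apply: functional_extensionality_dep => b.
rewrite blk_glue; have /carrierP/(_ b)[g Gg <-] := Zz.
rewrite (orbit_value_lcoset (bd_pair bd b)) //.
by rewrite (lcoset_fiber (bd_pair bd b)).
Qed.

(** [cayley] commutes with taking blocks, so in Cayley coordinates at [Y0] and at
    its blocks the two maps send [K] to its blocks and back; they are linear. *)
Lemma blocks_charts Y0 : S Y0 -> exists d : chart R (mtype Z),
  let c := cayley_chart S 1%:M Y0 in
  [/\ charts Z d, cdom d (blocks_map Y0),
      (forall Y, cdom c Y -> cdom d (blocks_map Y)),
      (forall z, cdom d z -> carrier Z z /\ cdom c (blocks_inv z)) &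
      smooth_on (cimage c) (fun w => cmap d (blocks_map (cinv c w))) /\
      smooth_on (cimage d) (fun w => cmap c (blocks_inv (cinv d w)))].
Proof.
move=> SY0.
have oS := S_relatively_open.
have MY0 := S_SR SY0.
have ex b : {g : 'M[R]_(N b) | @G b g & blk b Y0 = conjM g (D b)}.
  have [_ /(_ b) h] := (bd_S bd Y0).1 SY0.
  by apply: cid2.
pose g b := s2val (ex b).
have Gg b : @G b (g b) := s2valP (ex b).
have Eg b : blk b Y0 = conjM (g b) (D b) := s2valP' (ex b).
pose cb b := hom_chart (@G b) (@H b) (J b) (D b) (g b).
have Xcb b : charts (homspace (@G b) (@H b)) (cb b).
  exact: (hom_chart_charts (bd_pair bd b) (Gg b)).
case: pl => _ _ _ /(_ cb Xcb) [d [pi [Zd domd imdP L sm]]].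
pose c := cayley_chart S 1%:M Y0.
have cdomE Y : cdom c Y -> forall b, blk b Y + conjM (g b) (D b) \in unitmx.
  move=> [SY u] b; rewrite -Eg -blkD; apply: blk_unit => //.
  by rewrite mulmxDl mulmxDr (SR_comm MY0) (SR_comm (S_SR SY)).
have dommap Y : cdom c Y -> cdom d (blocks_map Y).
  move=> dY; apply/domd => b; have [SY u] := dY; split.
    by have /carrierP := blocks_map_in SY.
  by rewrite orbit_value_blocks_map //; exact: cdomE.
have dominv z : cdom d z -> carrier Z z /\ cdom c (blocks_inv z).
  move=> /domd dz; have Zz : carrier Z z by apply/carrierP => b; case: (dz b).
  split=> //; split; first exact: blocks_inv_in.
  rewrite /= -(glue_blk (SR_comm MY0)) glueD; apply: glue_unit => b.
  by rewrite Eg; case: (dz b).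
exists d; split=> //.
  by apply: dommap; exact: (cayley_chart_base uM oS SY0).
have oc : open (cimage c) by exact: (open_cimage uM oS SY0).
split.
  apply: sm => // b.
  apply: (@eq_smooth_on _ _ _ _ (fun w => anti_coord (J b) (conjM (g b) (D b))
     (blk b (anti_vec w)))) => //.
    move=> w wI; have [SY u] := cayley_chart_dom uM oS SY0 wI.
    rewrite /= orbit_value_blocks_map // -Eg -blk_cayley //; last exact: S_SR.
    rewrite icayleyK //; first exact: two_unitr.
    - exact: SR_unit uM MY0.
    - exact: anti_vec_anticomm.
    - exact: (cayley_chart_imageP uM oS SY0 wI).
  apply: smooth_linear_comp => //.
  apply: (@smooth_linear_comp _ _ _ _ _ _ (mulmxr (A b) \o mulmx (B b))) => //.
  exact: smooth_linear_mx.
have imd w : cimage d w -> forall b, 1%:M + anti_vec (pi b w) \in unitmx.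
  move=> [z /domd dz <-] b; have [_ piE _] := L b; rewrite piE.
  have h : cimage (cb b) (cmap (cb b) (from z b)).
    by exists (from z b) => //; exact: (dz b).
  by rewrite (hom_chart_image (bd_pair bd b) (Gg b)) in h; exact: h.
have domw w : cimage d w -> cdom d (cinv d w).
  move=> wI; apply/domd => b; have [_ _ ->] := L b.
  have : cimage (cb b) (pi b w).
    by rewrite (hom_chart_image (bd_pair bd b) (Gg b)); exact: imd.
  move=> [X dX <-].
  by rewrite (hom_chartK (bd_pair bd b) (Gg b)).
(* [blocks_inv] in coordinates; smoothness is that of a linear map. *)
pose F (w : 'rV[R]_(cdim d)) :=
  anti_coord 1%:M Y0 (glue (fun b => anti_vec (pi b w))).
have linF : linear F.
  move=> a u v; rewrite /F -linearP; congr anti_coord.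
  rewrite /glue scaler_sumr -big_split; apply: eq_bigr => b _ /=.
  have [lin _ _] := L b; rewrite lin linearP mulmxDr mulmxDl.
  by rewrite -scalemxAr -scalemxAl.
have od : open (cimage d).
  have -> : cimage d = \bigcap_(b in [set: I])
      (pi b @^-1` [set z | 1%:M + anti_vec z \in unitmx]).
    apply/seteqP; split=> w /= h; first by move=> b _; exact: imd.
    apply: imdP => b; rewrite (hom_chart_image (bd_pair bd b) (Gg b)).
    exact: h.
  apply: bigcap_open_finite => b.
  have [lin _ _] := L b.
  pose f : {linear 'rV[R]_(cdim d) -> _} :=
    HB.pack (pi b) (GRing.isLinear.Build _ _ _ _ _ lin).
  apply: open_comp; last exact: open_units_affine.
  by move=> w _; exact: (@continuous_linear_mx _ _ _ _ f).
have sF : smooth_on (cimage d) F.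
  pose f : {linear 'rV[R]_(cdim d) -> _} :=
    HB.pack F (GRing.isLinear.Build _ _ _ _ _ linF).
  exact: (@smooth_linear_mx _ _ _ _ _ f).
apply: eq_smooth_on sF => // w wI; rewrite /F /=.
congr anti_coord; have [_ [SY u]] := dominv _ (domw _ wI).
have MY := S_SR SY.
rewrite -[RHS]glue_blk; last first.
  by apply: cayley_comm => //; exact: SR_comm.
apply: eq_bigr => b _; rewrite blk_cayley // Eg blk_glue.
have [_ _ ->] := L b.
rewrite (orbit_value_cinv (bd_pair bd b) (Gg b)); last exact: imd.
rewrite icayleyK //; first exact: two_unitr.
- exact: (hom_base_unit (bd_pair bd b) (Gg b)).
- exact: anti_vec_anticomm.
- exact: imd.
Qed.

Theorem blocks_diffeo : diffeomorphic (submfd S) Z.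
Proof.
have oS := S_relatively_open.
exists blocks_map, blocks_inv; split.
- by move=> Y SY; split; [exact: blocks_map_in|exact: blocks_mapK].
- by move=> z Zz; split; [exact: blocks_inv_in|exact: blocks_invK].
- move=> Y SY; have [d [Zd dY domc domd [s1 s2]]] := blocks_charts SY.
  exists (cayley_chart S 1%:M Y), d; split=> //.
  + by split=> //; exact: (cayley_chart_submfd uM oS SY).
  + exact: (cayley_chart_base uM oS SY).
  + by move=> _ [X dX <-]; exact: domc.
- move=> z Zz; have SY := blocks_inv_in Zz.
  have [d [Zd dY domc domd [s1 s2]]] := blocks_charts SY.
  exists d, (cayley_chart S 1%:M (blocks_inv z)); split=> //.
  + by split=> //; exact: (cayley_chart_submfd uM oS SY).
  + by rewrite blocks_invK in dY.
  + by move=> _ [x dx <-]; have [] := domd _ dx.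
Qed.

End Blocks.

(** * Multiplicities as traces of spectral projections *)

Section Multiplicities.
Variable F : fieldType.

Lemma mup_prod (I : Type) (r : seq I) (P : pred I) (Q : I -> {poly F}) x :
  (forall i, P i -> Q i != 0) ->
  mup x (\prod_(i <- r | P i) Q i) = (\sum_(i <- r | P i) mup x (Q i))%N.
Proof.
move=> Q0; elim: r => [|i r IH]; first by rewrite !big_nil mupNroot // rootC oner_eq0.
rewrite !big_cons; case: ifP => // Pi.
rewrite mupM ?IH ?Q0 //.
by apply: (big_ind (fun q => q != 0)) => //; [exact: oner_neq0|exact: mulf_neq0].
Qed.

Lemma mup_exp (p : {poly F}) k x : p != 0 -> mup x (p ^+ k) = (k * mup x p)%N.
Proof.
move=> p0; elim: k => [|k IH]; first by rewrite expr0 mupNroot ?rootC ?oner_eq0.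
by rewrite exprS mupM ?expf_neq0 // IH mulSn.
Qed.

Lemma mup_lin (x y : F) : mup x ('X - y%:P) = (y == x).
Proof. by have := mup_XsubCX 1 x y; rewrite expr1 => ->; case: eqP. Qed.

Lemma mup_diagonalized n P (d : 'rV[F]_n) A x : diagonalized P d A ->
  mup x (char_poly A) = (\sum_i (d 0%R i == x))%N.
Proof.
move=> dA; rewrite (char_poly_diagonalized dA) mup_prod.
  by apply: eq_bigr => i _; rewrite mup_lin.
by move=> i _; rewrite polyXsubC_eq0.
Qed.

Definition spectral_proj n (z : F) (A : 'M[F]_n) := fmx (fun x => (x == z)%:R) A.

Lemma tr_spectral_proj n z (A : 'M[F]_n) : diagonalizable A ->
  \tr (spectral_proj z A) = (mup z (char_poly A))%:R.
Proof.
move=> /diagonalizable_exP[P [d dA]]; rewrite /spectral_proj (fmxE _ dA).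
case: (dA) => uP _; rewrite mxtrace_calc_diag // (mup_diagonalized z dA).
by rewrite natr_sum.
Qed.

Lemma spectral_proj_idem n z (A : 'M[F]_n) : diagonalizable A ->
  spectral_proj z A *m spectral_proj z A = spectral_proj z A.
Proof.
move=> dA; rewrite /spectral_proj fmxM //; apply: eq_fmx => x.
by rewrite -natrM mulnb andbb.
Qed.

Lemma spectral_proj_ortho n z w (A : 'M[F]_n) : diagonalizable A -> z != w ->
  spectral_proj z A *m spectral_proj w A = 0.
Proof.
move=> dA zw; rewrite /spectral_proj fmxM //.
rewrite (@eq_fmx _ _ _ (fun=> 0)) ?fmx_const ?raddf0 // => x.
by rewrite -natrM mulnb; case: eqP => // ->; rewrite (negPf zw).
Qed.

Lemma mul_spectral_proj n z (A : 'M[F]_n) : diagonalizable A ->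
  A *m spectral_proj z A = z *: spectral_proj z A.
Proof.
move=> dA; rewrite -{1}(fmx_id dA) /spectral_proj fmxM // -mul_scalar_mx.
rewrite -(fmx_const z dA) fmxM //; apply: eq_fmx => x.
by case: eqP => [->|_]; rewrite ?mulr0.
Qed.

(** On the eigenspace of [A *m A] for [w * w] the eigenvalues of [A] are [w] and
    [- w], and [A + w] is [w + w] on the first and [0] on the second. Multiplicities
    of a square root are thereby traces of matrices. *)
Lemma mup_sqrt_trace n (A : 'M[F]_n) (w : F) : diagonalizable A -> w != - w ->
  (mup w (char_poly A))%:R * (w + w) =
  \tr (spectral_proj (w * w) (A *m A) *m A) + w * \tr (spectral_proj (w * w) (A *m A)).
Proof.
move=> dA w2; rewrite -tr_spectral_proj //.
have -> : spectral_proj (w * w) (A *m A) = fmx (fun x => (x * x == w * w)%:R) A.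
  exact: fmx_sqr.
rewrite -[X in \tr (_ *m X)](fmx_id dA) fmxM // mulrC -!mxtraceZ -mxtraceD; congr (\tr _).
rewrite -!mul_scalar_mx -!(fmx_const _ dA) /spectral_proj !fmxM // fmxD //.
apply: eq_fmx => x; have [->|xw] := eqVneq x w; first by rewrite eqxx !mulr1 mul1r.
rewrite mulr0 -!expr2 eqf_sqr (negPf xw) /=.
by case: eqP => [->|_]; rewrite ?mul1r ?mulr1 ?addNr // mul0r mulr0 addr0.
Qed.

End Multiplicities.

Lemma eq_monic_mup (F : closedFieldType) (p q : {poly F}) :
  p \is monic -> q \is monic -> (forall z, mup z p = mup z q) -> p = q.
Proof.
move=> mp mq E.
have [rp] := closed_field_poly_normal p; rewrite (monicP mp) scale1r => Ep.
have [rq] := closed_field_poly_normal q; rewrite (monicP mq) scale1r => Eq.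
have cnt r z : mup z (\prod_(x <- r) ('X - x%:P : {poly F})) = count_mem z r.
  rewrite mup_prod; last by move=> x _; rewrite polyXsubC_eq0.
  by rewrite -sum1_count [RHS]big_mkcond /=; apply: eq_bigr => x _; rewrite mup_lin; case: eqP.
rewrite Ep Eq; apply: perm_big; apply/allP => x _ /=.
by rewrite -!cnt -Ep -Eq E.
Qed.

Section ConjFmx.
Variables (R : realType) (n : nat).
Local Notation C := R[i].

Lemma conjm_fmx (f : C -> C) (A : 'M[C]_n) : diagonalizable A ->
  conjm (fmx f A) = fmx (fun x => conjc (f (conjc x))) (conjm A).
Proof.
move=> /diagonalizable_exP[P [d dA]]; case: (dA) => uP EA.
have dAc : diagonalized (conjm P) (conjm d) (conjm A).
  split; first by rewrite /conjm map_unitmx.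
  by rewrite /conjm EA !map_mxM map_invmx map_diag_mx.
have Ed : map_mx (@conjc R) (map_mx f d) =
    map_mx (fun x => conjc (f (conjc x))) (conjm d).
  by apply/rowP => i; rewrite !mxE conjcK.
rewrite (fmxE _ dA) (fmxE _ dAc) /calc_diag -Ed.
by rewrite [LHS]map_mxM map_mxM map_invmx map_diag_mx.
Qed.

Lemma conjm_spectral_proj z (M : 'M[R]_n) : semisimple M ->
  conjm (spectral_proj z (cplx M)) = spectral_proj (conjc z) (cplx M).
Proof.
move=> ssM; have dM : diagonalizable (cplx M) := ssM.
rewrite /spectral_proj (conjm_fmx _ dM) conjm_cplx; apply: eq_fmx => x.
rewrite rmorph_nat; congr (_%:R); congr nat_of_bool.
by apply/eqP/eqP => [<-|->]; rewrite conjcK.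
Qed.

(** Conjugation fixes the characteristic polynomial of a real matrix and maps the
    factors [X - z] to [X - conjc z]. *)
Lemma mup_conjc z (M : 'M[R]_n) :
  mup (conjc z) (char_poly (cplx M)) = mup z (char_poly (cplx M)).
Proof.
have E : map_poly (@conjc R) (char_poly (cplx M)) = char_poly (cplx M).
  rewrite (@map_char_poly _ _ (@conjc R)) -[map_mx _ _]/(conjm (cplx M)).
  by rewrite conjm_cplx.
have p0 : char_poly (cplx M) != 0 by exact: monic_neq0 (char_poly_monic _).
have le (x : C) : (mup x (char_poly (cplx M)) <= mup (conjc x) (char_poly (cplx M)))%N.
  rewrite mup_geq // -[X in _ %| X]E.
  have -> : 'X - (conjc x)%:P = map_poly (@conjc R) ('X - x%:P).
    by rewrite rmorphB /= map_polyX map_polyC.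
  by rewrite -rmorphXn /= dvdp_map -mup_geq.
have h1 := le z; have h2 := le (conjc z); rewrite conjcK in h2.
by apply: anti_leq; apply/andP; split; [exact: h2|exact: h1].
Qed.

Lemma cplx_diagonalizable_sqrt (M Y : 'M[R]_n) : M \in unitmx -> semisimple M ->
  SR M Y -> diagonalizable (cplx Y).
Proof.
move=> uM ssM MY.
have uC : cplx M \in unitmx by rewrite unitmx_cplx.
have E : cplx Y *m cplx Y = cplx M by rewrite -cplxM MY.
exact: (@sqrt_diagonalizable R[i] n (cplx M) (cplx Y) uC ssM E).
Qed.

End ConjFmx.

(** * The three kinds of blocks *)

Lemma scalemx_sqr (F : fieldType) n (c : F) (X : 'M[F]_n) :
  (c *: X) *m (c *: X) = (c * c) *: (X *m X).
Proof. by rewrite -scalemxAl -scalemxAr scalerA. Qed.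

Section Signature.
Variable F : numFieldType.

Definition signature_mx u v h (e : (u + v)%N = h) : 'M[F]_h :=
  castmx (e, e) (block_mx 1%:M 0 0 (- 1%:M)).

Lemma signature_mx_sqr u v h (e : (u + v)%N = h) :
  signature_mx e *m signature_mx e = 1%:M.
Proof.
case: _ / e; rewrite /signature_mx castmx_id mulmx_block.
by rewrite !mulmx0 !mul0mx !addr0 !add0r mulmx1 mulmxN mulmx1 opprK scalar_mx_block.
Qed.

Lemma signature_mx_tr u v h (e : (u + v)%N = h) :
  \tr (signature_mx e) = u%:R - v%:R.
Proof.
by case: _ / e; rewrite /signature_mx castmx_id mxtrace_block raddfN /= !mxtrace1.
Qed.

(** The commutant of a signature matrix: the off-diagonal blocks are equal to
    their opposites. *)
Lemma GLsumP u v h (e : (u + v)%N = h) (g : 'M[F]_h) :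
  GLsum u v g <-> g \in unitmx /\ g *m signature_mx e = signature_mx e *m g.
Proof.
case: _ / e g => g; rewrite /signature_mx castmx_id; split.
  move=> [e [A [B [uA uB ->]]]]; rewrite castmx_id; split.
    by rewrite unitmxE det_ublock unitrM -!unitmxE; apply/andP.
  rewrite !mulmx_block !mulmx0 !mul0mx !addr0 !add0r !mulmx1 !mul1mx.
  by rewrite mulmxN mulNmx mulmx1 mul1mx.
move=> [ug E]; rewrite -[g]submxK in ug E *.
move: (ulsubmx g) (ursubmx g) (dlsubmx g) (drsubmx g) ug E => A B' C B ug.
rewrite !mulmx_block !mulmx0 !mul0mx !addr0 !add0r !mulmx1 !mul1mx.
rewrite !mulmxN !mulNmx !mulmx1 !mul1mx => /eq_block_mx[_ eB eC _].
have half0 m n (X : 'M[F]_(m, n)) : X = - X -> X = 0.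
  move=> /matrixP E; apply/matrixP => i j; have := E i j; rewrite !mxE => /eqP.
  by rewrite -subr_eq0 opprK -mulr2n mulrn_eq0 => /eqP.
have B0 : B' = 0 by apply: half0; rewrite -eB opprK.
have C0 : C = 0 by apply: half0.
move: ug; rewrite B0 C0 unitmxE det_ublock unitrM => /andP[uA uB].
by exists (erefl _), A, B; rewrite castmx_id /GL /= !unitmxE.
Qed.

Lemma signature_conjP u v h (e : (u + v)%N = h) (s : 'M[F]_h) : s *m s = 1%:M ->
  (exists2 g, g \in unitmx & s = conjM g (signature_mx e)) <-> \tr s = u%:R - v%:R.
Proof.
move=> ss; split=> [[g ug ->]|ts]; last exact: involution_conj.
by rewrite /conjM mxtrace_mulC mulKmx // signature_mx_tr.
Qed.

End Signature.

Section BlockPairs.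
Variable R : realType.
Local Notation C := R[i].

Lemma GL_commP N (g : 'M[R]_N) : GL g <-> g \in unitmx /\ g *m 1%:M = 1%:M *m g.
Proof. by rewrite mulmx1 mul1mx; split=> [|[]]. Qed.

Lemma real_pair u v h (e : (u + v)%N = h) (c : R) : c != 0 ->
  stabilizer_pair (@GL R h) (@GLsum R u v h) 1%:M (c *: signature_mx R e).
Proof.
move=> c0; split.
- exact: GL_commP.
- move=> g; rewrite (GLsumP e) -scalemxAr -scalemxAl.
  by split=> [[ug ->] //|[ug E]]; split=> //; exact: (scalerI c0 E).
- by rewrite mulmx1 mul1mx.
- have : c *: signature_mx R e *m (c^-1 *: signature_mx R e) = 1%:M.
    by rewrite -scalemxAl -scalemxAr scalerA mulfV // scale1r signature_mx_sqr.
  by case/mulmx1_unit=> uw _; exact: uw.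
- move=> g _; rewrite scalemx_sqr signature_mx_sqr.
  by rewrite -scalemxAr -scalemxAl mulmx1 mul1mx.
Qed.

Lemma complex_pair u v h (e : (u + v)%N = h) (w : C) : w != 0 ->
  stabilizer_pair (@GLC R h) (@GLCsum R u v h) (complex_structure R h)
    (realify (w *: signature_mx C e)).
Proof.
move=> w0; split.
- exact: GLCP.
- move=> g; split.
    move=> [A /(GLsumP e)[uA cA] <-]; split; first by exists A.
    by rewrite -!realifyM -scalemxAr -scalemxAl cA.
  move=> [[A uA <-]]; rewrite -!realifyM -scalemxAr -scalemxAl => /realify_inj E.
  by exists A => //; apply/(GLsumP e); split=> //; exact: (scalerI w0 E).
- by apply/realifyP; exists (w *: signature_mx C e).
- rewrite unitmx_realify.
  have : w *: signature_mx C e *m (w^-1 *: signature_mx C e) = 1%:M.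
    by rewrite -scalemxAl -scalemxAr scalerA mulfV // scale1r signature_mx_sqr.
  by case/mulmx1_unit=> uw _; exact: uw.
- move=> _ [A uA <-]; rewrite -!realifyM scalemx_sqr signature_mx_sqr.
  by rewrite -scalemxAr -scalemxAl mulmx1 mul1mx.
Qed.

Lemma complex_structure_sqr k :
  complex_structure R k *m complex_structure R k = - 1%:M.
Proof.
rewrite -realifyM mul_scalar_mx scale_scalar_mx -expr2 sqr_i.
apply: mx_dordP => i b j c; rewrite realifyE !mxE.
rewrite dord_eq.
by case: (i == j); case: b; case: c; rewrite /= ?oppr0.
Qed.

Lemma negative_pair k (c : R) : c != 0 ->
  stabilizer_pair (@GL R k.*2) (@GLC R k) 1%:M (c *: complex_structure R k).
Proof.
move=> c0; split.
- exact: GL_commP.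
- move=> g; rewrite GLCP -scalemxAr -scalemxAl.
  by split=> [[ug ->] //|[ug E]]; split=> //; exact: (scalerI c0 E).
- by rewrite mulmx1 mul1mx.
- have : c *: complex_structure R k *m (- c^-1 *: complex_structure R k) = 1%:M.
    rewrite -scalemxAl -scalemxAr scalerA mulrN mulfV // complex_structure_sqr.
    by rewrite scaleN1r opprK.
  by case/mulmx1_unit=> uw _; exact: uw.
- move=> g _; rewrite scalemx_sqr complex_structure_sqr.
  by rewrite -scalemxAr -scalemxAl mulmxN mulNmx mulmx1 mul1mx.
Qed.

Lemma natC m : (m%:R : C) = Complex (m%:R) 0.
Proof. by rewrite -(rmorph_nat (real_complex R)). Qed.

(** The [i]-eigenspace of [s] is a complement of its conjugate, and its real form
    is a basis adapted to [s]. *)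
Lemma complex_structure_conj k (s : 'M[R]_(k.*2)) : s *m s = - 1%:M ->
  exists2 g, g \in unitmx & s = conjM g (complex_structure R k).
Proof.
move=> ss; have [cs Ecs] : exists cs, cs = cplx s by exists (cplx s).
have [I EI] : exists I : C, I = Complex 0 1 by exists (Complex 0 1).
have II : I * I = -1 by rewrite EI -expr2 sqr_i.
have cscs : cs *m cs = - 1%:M by rewrite Ecs -cplxM ss /cplx map_mxN map_mx1.
have n2 : (2 : C) != 0 by rewrite pnatr_eq0.
have [p Ep0] : exists p : 'M[C]_(k.*2), p = 2^-1 *: (1%:M - I *: cs).
  by exists (2^-1 *: (1%:M - I *: cs)).
have csp : cs *m p = I *: p.
  rewrite Ep0 -scalemxAr mulmxBr mulmx1 -scalemxAr cscs scalerN opprK.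
  rewrite [RHS]scalerA [I * _]mulrC -scalerA; congr (_ *: _).
  by rewrite scalerBr scalerA II scaleN1r opprK addrC.
have pp : p *m p = p.
  rewrite {1}Ep0 -scalemxAl mulmxBl mul1mx -scalemxAl csp scalerA II scaleN1r opprK.
  by rewrite mx_add2 scalerA mulVf // scale1r.
have cspr : p *m cs = I *: p.
  rewrite -csp Ep0 -scalemxAl -scalemxAr; congr (_ *: _).
  by rewrite mulmxBr mulmxBl mulmx1 mul1mx -scalemxAl -scalemxAr.
have cp : conjm p = 1%:M - p.
  have -> : conjm p = 2^-1 *: (1%:M + I *: cs).
    have c2 : conjc (2^-1 : C) = 2^-1 by rewrite conjc_inv conjc_nat.
    have cI : - conjc I = I by rewrite EI /= /GRing.opp /= oppr0 opprK.
    rewrite Ep0 /conjm map_mxZ map_mxB map_mx1 map_mxZ -/(conjm cs) Ecs conjm_cplx.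
    rewrite -scaleNr; congr (_ *: (_ + _ *: _)); [exact: c2|exact: cI].
  apply: (canRL (addrK _)); rewrite Ep0 -scalerDr addrACA subrr addr0.
  by rewrite mx_add2 scalerA mulVf // scale1r.
have p_cp : p *m conjm p = 0 by rewrite cp mulmxBr mulmx1 pp subrr.
have [r [a [b [Ep ba tp]]]] := idempotent_factor pp.
have rk : r = k.
  have E : (r%:R : C) + r%:R = (k.*2)%:R - I * (real_complex R (\tr s)).
    have trE (X : 'M[C]_(k.*2)) : \tr (2^-1 *: (1%:M - I *: X)) +
        \tr (2^-1 *: (1%:M - I *: X)) = (k.*2)%:R - I * \tr X.
      rewrite mxtraceZ raddfB /= mxtraceZ mxtrace1 -mulrDr; set y := (_ - _).
      rewrite -[y]mul1r -mulrDl mulrA.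
      by rewrite (_ : 1 + 1 = 2 :> C) // mulVf // mul1r.
    by rewrite -tp -cplx_tr -Ecs Ep0 trE.
  move: E; rewrite -natrD !natC EI => /(congr1 (@complex.Re R)) /=.
  rewrite !(mul0r, mul1r, subr0, sub0r, oppr0, addr0) => /eqP.
  rewrite eqr_nat => /eqP.
  lia.
subst r.
have ap : p *m a = a by rewrite Ep -mulmxA ba mulmx1.
have bp : b *m p = b by rewrite Ep mulmxA ba mul1mx.
have cpa : conjm p *m conjm a = conjm a by rewrite -conjmM ap.
have b_ca : b *m conjm a = 0.
  by rewrite -bp -cpa -mulmxA [p *m _]mulmxA p_cp mul0mx mulmx0.
have b_s_ca : b *m cplx s *m conjm a = 0.
  have cspc : cs *m conjm p = conjm p *m cs.
    by rewrite cp mulmxBr mulmxBl mulmx1 mul1mx csp cspr.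
  rewrite -Ecs -bp -cpa -!mulmxA [cs *m _]mulmxA cspc -mulmxA [p *m _]mulmxA p_cp.
  by rewrite mul0mx mulmx0.
have BA : half_rows b *m half_cols a = 1%:M.
  rewrite -[half_rows b]mulmx1 half_rows_cols cplx1 mulmx1 ?b_ca //.
  by rewrite ba realify1.
have BsA : half_rows b *m s *m half_cols a = complex_structure R k.
  rewrite half_rows_cols // -Ecs -{1}ap mulmxA -[b *m cs *m p]mulmxA csp.
  by rewrite -scalemxAr -scalemxAl bp ba EI /complex_structure scalemx1.
have [uB uA] := mulmx1_unit BA.
exists (half_cols a) => //.
have iA : invmx (half_cols a) = half_rows b.
  by apply: (can_inj (mulmxK uA)) => /=; rewrite mulVmx.
rewrite /conjM iA -BsA !mulmxA.
have AB : half_cols a *m half_rows b = 1%:M by rewrite -iA mulmxV.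
by rewrite AB mul1mx -mulmxA AB mulmx1.
Qed.

End BlockPairs.

Lemma cplxZ (R : realType) m n (c : R) (A : 'M[R]_(m, n)) :
  cplx (c *: A) = real_complex R c *: cplx A.
Proof. exact: map_mxZ. Qed.

Lemma conjMZ (F : fieldType) n (g A : 'M[F]_n) (c : F) :
  conjM g (c *: A) = c *: conjM g A.
Proof. exact: linearZ. Qed.

Definition eigen1 (F : fieldType) (z x : F) : F := (x == z)%:R.
Definition eigen2 (F : fieldType) (z w x : F) : F := (x == z)%:R + (x == w)%:R.

Lemma fmx_eigen2 (F : fieldType) n (z w : F) (A : 'M[F]_n) : diagonalizable A ->
  spectral_proj z A + spectral_proj w A = fmx (eigen2 z w) A.
Proof. exact: fmxD. Qed.

Section BlockExistence.
Variables (R : realType) (n : nat) (M : 'M[R]_n).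
Hypotheses (uM : M \in unitmx) (ssM : semisimple M).
Local Notation C := R[i].
Local Notation cM := (cplx M).

(** [A] and [B] cut out of [M] the block with spectral indicator [f], on which
    a square root of [M] lies in the orbit of [D] exactly when [Q] holds. *)
Definition block_of N (G : set 'M[R]_N) (J D : 'M[R]_N) (f : C -> C)
    (Q : 'M[R]_n -> Prop) (A : 'M[R]_(n, N)) (B : 'M[R]_(N, n)) : Prop :=
  [/\ B *m A = 1%:M,
      cplx (A *m B) = fmx f cM,
      forall X, X *m M = M *m X -> B *m X *m A *m J = J *m (B *m X *m A),
      B *m M *m A = D *m D &
      forall Y, SR M Y -> (exists2 g, G g & B *m Y *m A = conjM g D) <-> Q Y].

Let dM : diagonalizable cM. Proof. exact: ssM. Qed.

Lemma real_eigen_split (c : R) N : mup (real_complex R c) (char_poly cM) = N ->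
  exists (A : 'M[R]_(n, N)) (B : 'M[R]_(N, n)),
   [/\ B *m A = 1%:M, cplx (A *m B) = spectral_proj (real_complex R c) cM &
       forall X, X *m M = M *m X -> X *m (A *m B) = A *m B *m X].
Proof.
move=> mN; have [E EE] : exists E, E = spectral_proj (real_complex R c) cM.
  by exists (spectral_proj (real_complex R c) cM).
have Ec : conjm E = E.
  by rewrite EE (conjm_spectral_proj _ ssM) conjc_real.
have Ei : E *m E = E by rewrite EE; exact: spectral_proj_idem.
have cE X : X *m cM = cM *m X -> X *m E = E *m X by rewrite EE; exact: fmx_comm.
have tE : \tr E = N%:R by rewrite EE (tr_spectral_proj _ dM) mN.
rewrite -EE; have Er := conjm_real Ec.
have EEr : Remx E *m Remx E = Remx E by apply: cplx_inj; rewrite cplxM -Er.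
have [r [A [B [EAB BA tEr]]]] := idempotent_factor EEr.
have rN : r = N.
  move: tE; rewrite Er cplx_tr tEr rmorph_nat => /eqP.
  by rewrite eqr_nat => /eqP.
subst r; exists A, B; split=> //; first by rewrite -EAB -Er.
move=> X cX; apply: cplx_inj; rewrite -EAB !cplxM -Er.
by apply: cE; rewrite -!cplxM cX.
Qed.

Lemma split_eigen (c : R) N (A : 'M[R]_(n, N)) (B : 'M[R]_(N, n)) :
  B *m A = 1%:M -> cplx (A *m B) = spectral_proj (real_complex R c) cM ->
  B *m M *m A = c%:M.
Proof.
move=> BA EAB.
have MAB : M *m (A *m B) = c *: (A *m B).
  apply: cplx_inj; rewrite cplxM cplxZ EAB; exact: mul_spectral_proj.
have -> : B *m M *m A = B *m (M *m (A *m B)) *m A.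
  by rewrite -!mulmxA BA mulmx1.
by rewrite MAB -scalemxAr -scalemxAl mulmxA BA mul1mx BA scalemx1.
Qed.

Lemma split_sqr (X : 'M[R]_n) N (A : 'M[R]_(n, N)) (B : 'M[R]_(N, n)) :
  B *m A = 1%:M -> X *m (A *m B) = A *m B *m X ->
  (B *m X *m A) *m (B *m X *m A) = B *m (X *m X) *m A.
Proof.
move=> BA cX.
have -> : B *m X *m A *m (B *m X *m A) = B *m (X *m (A *m B)) *m X *m A.
  by rewrite !mulmxA.
by rewrite cX !mulmxA BA mul1mx.
Qed.

(** On the eigenspace of [lam] a square root of [M] divided by [sqrt lam] is an
    involution; its conjugacy class is given by its trace, that is by the
    multiplicity of [sqrt lam]. *)
Lemma real_block u v h (e : (u + v)%N = h) (lam : R) : 0 < lam ->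
  mup (real_complex R lam) (char_poly cM) = h ->
  exists A B, @block_of h (@GL R h) 1%:M (Num.sqrt lam *: signature_mx R e)
    (eigen1 (real_complex R lam))
    (fun Y => mup (real_complex R (Num.sqrt lam)) (char_poly (cplx Y)) = u) A B.
Proof.
move=> lam0 mh; have [A [B [BA EAB cAB]]] := real_eigen_split mh.
have BMA := split_eigen BA EAB.
set c := Num.sqrt lam; have c0 : 0 < c by rewrite sqrtr_gt0.
have cc : c * c = lam by rewrite -expr2 sqr_sqrtr // ltW.
have cn0 : c != 0 by rewrite gt_eqF.
exists A, B; split=> //.
- by move=> X _; rewrite mulmx1 mul1mx.
- by rewrite BMA scalemx_sqr signature_mx_sqr cc scalemx1.
move=> Y MY; have dY := cplx_diagonalizable_sqrt uM ssM MY.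
set y := B *m Y *m A; have yy : y *m y = lam%:M.
  by rewrite /y split_sqr //; [rewrite MY|apply: cAB; exact: SR_comm].
have ss : (c^-1 *: y) *m (c^-1 *: y) = 1%:M.
  by rewrite scalemx_sqr yy scale_scalar_mx -cc -invfM mulVf // mulf_neq0.
have tY : (mup (real_complex R c) (char_poly (cplx Y)))%:R * (c + c) = \tr y + c * h%:R.
  apply: (@complexI R); have w2 : real_complex R c != - real_complex R c.
    by rewrite -subr_eq0 opprK -rmorphD /= (inj_eq (@complexI R) _ 0) -mulr2n mulrn_eq0.
  have := mup_sqrt_trace dY w2; rewrite -rmorphM /= cc -cplxM MY -EAB -cplxM.
  have t1 : \tr (A *m B *m Y) = \tr y by rewrite -mulmxA mxtrace_mulC.
  have t2 : \tr (A *m B) = h%:R by rewrite mxtrace_mulC BA mxtrace1.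
  rewrite !cplx_tr t1 t2.
  by move=> E; rewrite rmorphM rmorph_nat !rmorphD rmorphM; exact: E.
transitivity (exists2 g, g \in unitmx & c^-1 *: y = conjM g (signature_mx R e)).
  split=> -[g ug E]; exists g => //.
    by rewrite E linearZ scalerA mulVf // scale1r.
  by rewrite linearZ /= -E scalerA mulfV // scale1r.
rewrite (signature_conjP e ss) mxtraceZ.
have hE : (h%:R : R) = u%:R + v%:R by rewrite -natrD e.
split=> [E|mu].
  apply/eqP; rewrite -(eqr_nat R); apply/eqP; apply: (mulIf (_ : c + c != 0)).
    by rewrite -mulr2n mulrn_eq0.
  rewrite tY hE; have -> : \tr y = c * (u%:R - v%:R) by rewrite -E mulVKf.
  ring.
apply: (mulfI cn0); rewrite mulVKf //; apply: (addIr (c * h%:R)).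
rewrite -tY mu hE; ring.
Qed.

(** On the eigenspace of [- zeta] a square root of [M] divided by [sqrt zeta] is a
    complex structure, and these form a single conjugacy class. *)
Lemma negative_block k (zeta : R) : 0 < zeta ->
  mup (- real_complex R zeta) (char_poly cM) = k.*2 ->
  exists A B, @block_of k.*2 (@GL R k.*2) 1%:M (Num.sqrt zeta *: complex_structure R k)
    (eigen1 (- real_complex R zeta)) (fun _ => True) A B.
Proof.
move=> z0; rewrite -rmorphN /= => mh; have [A [B [BA EAB cAB]]] := real_eigen_split mh.
have BMA := split_eigen BA EAB.
set c := Num.sqrt zeta; have c0 : 0 < c by rewrite sqrtr_gt0.
have cc : c * c = zeta by rewrite -expr2 sqr_sqrtr // ltW.
have cn0 : c != 0 by rewrite gt_eqF.
have scal (a : R) : (- a)%:M = a *: (- 1%:M) :> 'M[R]_(k.*2).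
  by rewrite scalerN scalemx1 raddfN.
exists A, B; split=> //.
- by move=> X _; rewrite mulmx1 mul1mx.
- by rewrite BMA scalemx_sqr complex_structure_sqr cc scal.
move=> Y MY; split=> // _.
set y := B *m Y *m A; have yy : y *m y = (- zeta)%:M.
  by rewrite /y split_sqr //; [rewrite MY|apply: cAB; exact: SR_comm].
have ss : (c^-1 *: y) *m (c^-1 *: y) = - 1%:M.
  rewrite scalemx_sqr yy scal scalerA -cc -invfM mulVf ?scale1r //.
  exact: mulf_neq0.
have [g ug E] := complex_structure_conj ss.
by exists g => //; rewrite linearZ /= -E scalerA mulfV // scale1r.
Qed.

(** The eigenspace of [w * w] is a complex subspace meeting its conjugate
    trivially. Its real form is the block; there the real matrices commuting with
    [M] act through [realify], and a square root of [M] divided by [w] is a complex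
    involution, classified by its trace as in the real case. *)
Lemma complex_block u v h (e : (u + v)%N = h) (w : C) : w != 0 ->
  w * w != conjc (w * w) ->
  mup (w * w) (char_poly cM) = h ->
  exists A B, @block_of h.*2 (@GLC R h) (complex_structure R h)
    (realify (w *: signature_mx C e))
    (eigen2 (w * w) (conjc (w * w)))
    (fun Y => mup w (char_poly (cplx Y)) = u) A B.
Proof.
move=> w0; have [z Ez] : exists z, z = w * w by exists (w * w).
rewrite -Ez => zcz mh.
have [E [EE [Ec [EcE cE]]]] : exists E : 'M[C]_n, E = spectral_proj z cM /\
    (conjm E = spectral_proj (conjc z) cM /\
     (E *m E = E /\ forall X, X *m cM = cM *m X -> X *m E = E *m X)).
  exists (spectral_proj z cM); split=> //; split; first exact: conjm_spectral_proj.
  by split; [exact: spectral_proj_idem|move=> X; exact: fmx_comm].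
have EcEo : E *m conjm E = 0 by rewrite Ec EE; exact: spectral_proj_ortho.
have [r [a [b [Eab ba tE]]]] := idempotent_factor EcE.
have rh : r = h.
  have := tr_spectral_proj z dM; rewrite -EE tE mh => /eqP.
  by rewrite eqr_nat => /eqP.
subst r.
have Ea : E *m a = a by rewrite Eab -mulmxA ba mulmx1.
have bE : b *m E = b by rewrite Eab mulmxA ba mul1mx.
have cEa : conjm E *m conjm a = conjm a by rewrite -conjmM Ea.
have ortho X : X *m M = M *m X -> b *m cplx X *m conjm a = 0.
  move=> cX; have XE : cplx X *m E = E *m cplx X by apply: cE; rewrite -!cplxM cX.
  rewrite -bE -cEa -[b *m E *m _]mulmxA -XE -!mulmxA [E *m _]mulmxA EcEo.
  by rewrite mul0mx !mulmx0.
have blkE X : X *m M = M *m X ->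
    half_rows b *m X *m half_cols a = realify (b *m cplx X *m a).
  by move=> cX; apply: half_rows_cols; exact: ortho.
have blkM (X X' : 'M[R]_n) : X *m M = M *m X ->
    (b *m cplx X *m a) *m (b *m cplx X' *m a) = b *m cplx (X *m X') *m a.
  move=> cX; have XE : cplx X *m E = E *m cplx X by apply: cE; rewrite -!cplxM cX.
  have -> : b *m cplx X *m a *m (b *m cplx X' *m a) =
      b *m (cplx X *m (a *m b)) *m cplx X' *m a by rewrite !mulmxA.
  by rewrite -Eab XE [b *m (E *m _)]mulmxA bE cplxM !mulmxA.
have bMa : b *m cM *m a = z%:M.
  rewrite -Ea -[b *m cM *m _]mulmxA [cM *m _]mulmxA EE mul_spectral_proj //.
  by rewrite -EE -scalemxAl Ea -scalemxAr ba scalemx1.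
exists (half_cols a), (half_rows b); split.
- rewrite -[half_rows b]mulmx1 blkE ?mulmx1 ?mul1mx //.
  by rewrite cplx1 mulmx1 ba realify1.
- rewrite half_cols_rows -Eab Ec EE (fmx_eigen2 _ _ dM); reflexivity.
- by move=> X cX; apply/realifyP; rewrite blkE //; exists (b *m cplx X *m a).
- rewrite blkE // bMa -realifyM scalemx_sqr signature_mx_sqr -Ez.
  by rewrite scalemx1.
move=> Y MY; have dY := cplx_diagonalizable_sqrt uM ssM MY.
have cY := SR_comm MY.
have [y Ey] : exists y, y = b *m cplx Y *m a by exists (b *m cplx Y *m a).
have yy : y *m y = z%:M by rewrite Ey (blkM _ _ cY) MY bMa.
have ss : (w^-1 *: y) *m (w^-1 *: y) = 1%:M.
  by rewrite scalemx_sqr yy scale_scalar_mx Ez -invfM mulVf // mulf_neq0.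
have w2 : w != - w by rewrite -subr_eq0 opprK -mulr2n mulrn_eq0.
have tY : (mup w (char_poly (cplx Y)))%:R * (w + w) = \tr y + w * h%:R.
  rewrite (mup_sqrt_trace dY w2) -Ez -cplxM MY -EE Eab.
  have t1 : \tr (a *m b *m cplx Y) = \tr y by rewrite -mulmxA mxtrace_mulC Ey.
  have t2 : \tr (a *m b) = h%:R by rewrite mxtrace_mulC ba mxtrace1.
  by rewrite t1 t2.
rewrite blkE // -Ey.
transitivity (exists2 g, g \in unitmx & w^-1 *: y = conjM g (signature_mx C e)).
  split=> [[_ [g ug <-]]|[g ug E']].
    rewrite /conjM (invmx_realify ug) -!realifyM => /realify_inj E'.
    exists g; [exact: ug|rewrite E' -/(conjM g _) conjMZ].
    by rewrite scalerA (mulVf w0) scale1r.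
  exists (realify g); first by exists g.
  rewrite /conjM (invmx_realify ug) -!realifyM -/(conjM g _) conjMZ.
  by rewrite -E' scalerA (mulfV w0) scale1r.
rewrite (signature_conjP e ss) mxtraceZ.
have hE : (h%:R : C) = u%:R + v%:R by rewrite -natrD e.
split=> [E'|mu].
  apply/eqP; rewrite -(eqr_nat C); apply/eqP; apply: (mulIf (_ : w + w != 0)).
    by rewrite -mulr2n mulrn_eq0.
  rewrite tY hE; have -> : \tr y = w * (u%:R - v%:R) by rewrite -E' mulVKf.
  ring.
apply: (mulfI w0); rewrite mulVKf //; apply: (addIr (w * h%:R)).
rewrite -tY mu hE; ring.
Qed.

End BlockExistence.

(** * The eigenvalues of a square root *)

Section Polar.
Variable R : realType.
Local Notation C := R[i].
Implicit Types r t : R.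

Lemma conjc_polar r t : conjc (polar r t) = polar r (- t).
Proof. by rewrite /polar /= cosN sinN mulrN. Qed.

Lemma polar_subpi r t : polar r (t - pi) = - polar r t.
Proof.
rewrite /polar cosB sinB cospi sinpi !mulr0 addr0 subr0 !mulrN1 !mulrN.
by apply/eqP; rewrite eq_complex /= !eqxx.
Qed.

Lemma polar_half r t : 0 < r ->
  polar (Num.sqrt r) (t / 2) * polar (Num.sqrt r) (t / 2) = polar r t.
Proof.
move=> r0; rewrite {3}/polar {3 4}(splitr t) cosD sinD.
have E : r = Num.sqrt r * Num.sqrt r by rewrite -expr2 sqr_sqrtr // ltW.
rewrite {3 4}E /polar; set s := Num.sqrt r.
by apply/eqP; rewrite eq_complex /=; apply/andP; split; apply/eqP; ring.
Qed.

Lemma polar_inj r r' t t' : 0 < r -> 0 < r' -> 0 < t < pi -> 0 < t' < pi ->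
  polar r t = polar r' t' -> r = r' /\ t = t'.
Proof.
move=> r0 r0' /andP[t0 tp] /andP[t0' tp'] [Ec Es].
have rr : r = r'.
  have : r ^+ 2 = r' ^+ 2.
    rewrite -[r ^+ 2]mulr1 -[r' ^+ 2]mulr1 -{1}(cos2Dsin2 t) -(cos2Dsin2 t').
    by rewrite !mulrDr -!exprMn Ec Es.
  by move/eqP; rewrite eqrXn2 ?ltW // => /eqP.
split=> //; apply: cos_inj; rewrite ?in_itv /= ?(ltW t0) ?(ltW tp) ?(ltW t0') ?(ltW tp') //.
by apply: (mulfI (lt0r_neq0 r0)); rewrite Ec rr.
Qed.

Lemma Im_polar_gt0 r t : 0 < r -> 0 < t < pi -> 0 < complex.Im (polar r t).
Proof. by move=> r0 tp; rewrite /= mulr_gt0 // sin_gt0_pi. Qed.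

Lemma Re_polar_gt0 r t : 0 < r -> 0 < t < pi -> 0 < complex.Re (polar r (t / 2)).
Proof.
move=> r0 /andP[t0 tp]; rewrite /= mulr_gt0 //; apply: cos_gt0_pihalf.
by rewrite ltr_pM2r ?invr_gt0 // tp andbT (lt_trans (y := 0)) ?divr_gt0 // oppr_lt0
  divr_gt0 // pi_gt0.
Qed.

Lemma half_lt_pi t : 0 < t < pi -> 0 < t / 2 < pi.
Proof.
move=> /andP[t0 tp]; rewrite divr_gt0 //=; apply: lt_trans tp.
by rewrite ltr_pdivrMr // ltr_pMr // ltr1n.
Qed.

(** Hence [w], [- w] and their conjugates are four distinct numbers, the square
    roots of [w * w] and of its conjugate. *)
Lemma quadrant_neq (w : C) : 0 < complex.Re w -> 0 < complex.Im w ->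
  [/\ w != 0, w != - w, w != conjc w & w != - conjc w].
Proof.
case: w => a b /= a0 b0.
have oppE x y : - Complex x y = Complex (- x) (- y) :> C by [].
rewrite !oppE !eq_complex /=; split.
- by rewrite gt_eqF.
- by rewrite -[a == _]addr_eq0 -mulr2n mulrn_eq0 (gt_eqF a0).
- by rewrite -[b == _]addr_eq0 -mulr2n mulrn_eq0 (gt_eqF b0) andbF.
- by rewrite -[a == _]addr_eq0 -mulr2n mulrn_eq0 (gt_eqF a0).
Qed.

End Polar.

Section SquareMultiplicity.
Variables (F : fieldType) (n : nat) (A : 'M[F]_n).
Hypothesis dA : diagonalizable A.

Lemma mup_sqr (z : F) : z != - z ->
  mup (z * z) (char_poly (A *m A)) = (mup z (char_poly A) + mup (- z) (char_poly A))%N.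
Proof.
move=> z2; have [P [d dd]] := (diagonalizable_exP _).1 dA.
rewrite (mup_diagonalized _ (diagonalized_sqr dd)) !(mup_diagonalized _ dd) -big_split /=.
apply: eq_bigr => i _; rewrite mxE -!expr2 eqf_sqr.
by case: eqP => [->|_] //=; rewrite (negPf z2).
Qed.

Lemma mup_sqr_le (z : F) : (mup z (char_poly A) <= mup (z * z) (char_poly (A *m A)))%N.
Proof.
have [P [d dd]] := (diagonalizable_exP _).1 dA.
rewrite (mup_diagonalized _ (diagonalized_sqr dd)) (mup_diagonalized _ dd).
by apply: leq_sum => i _; rewrite mxE; case: eqP => [->|]; rewrite ?eqxx.
Qed.

Lemma fmx_spectrum (f g : F -> F) :
  (forall x, mup x (char_poly A) != 0 -> f x = g x) -> fmx f A = fmx g A.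
Proof.
move=> fg; have [P [d dd]] := (diagonalizable_exP _).1 dA.
rewrite !(fmxE _ dd) /calc_diag; congr (_ *m diag_mx _ *m _).
apply/rowP => i; rewrite !mxE; apply: fg; rewrite (mup_diagonalized _ dd).
by rewrite (bigD1 i) //= eqxx.
Qed.

Lemma fmx_sum (I : Type) (r : seq I) (f : I -> F -> F) :
  \sum_(b <- r) fmx (f b) A = fmx (fun x => \sum_(b <- r) f b x) A.
Proof.
elim: r => [|b r IH].
  rewrite big_nil (@eq_fmx _ _ _ (fun=> 0)) ?fmx_const ?raddf0 // => x.
  by rewrite big_nil.
rewrite big_cons IH fmxD //; apply: eq_fmx => x.
by rewrite big_cons.
Qed.

End SquareMultiplicity.

(** [L] is a multiplicity function: on the square roots of [v * v] it coincides
    with that of [(X - v) ^+ a * (X + v) ^+ b]. *)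
Lemma two_roots_count (F : fieldType) (v : F) (a b : nat) (L : F -> nat) :
  v != - v -> L v = a -> L (- v) = b ->
  forall z, z * z == v * v -> L z = (a * (v == z) + b * (- v == z))%N.
Proof.
move=> vN La Lb z; rewrite -!expr2 eqf_sqr => /orP[] /eqP ->.
  by rewrite La eqxx eq_sym (negPf vN) muln1 muln0 addn0.
by rewrite Lb (negPf vN) eqxx muln1 muln0 add0n.
Qed.

(** The analogue for a conjugate pair [w], [wc]; the hypotheses on [L] are the
    symmetries of the multiplicities of a real square root. *)
Lemma four_roots_count (F : fieldType) (w wc : F) (m k : nat) (L : F -> nat) :
  w != - w -> w != wc -> w != - wc -> wc != - wc -> wc != - w ->
  L w = k -> L wc = k -> m = (k + L (- w))%N -> L (- wc) = L (- w) ->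
  forall z, (z * z == w * w) || (z * z == wc * wc) ->
  L z = (k * ((w == z) + (wc == z)) + (m - k) * ((- w == z) + (- wc == z)))%N.
Proof.
move=> w1 w2 w3 cc cw Lw Lc mE LN z; rewrite -!expr2 !eqf_sqr.
have f1 := negPf w1; have f2 := negPf w2; have f3 := negPf w3.
have f4 := negPf cc; have f5 := negPf cw.
move: w1 w2 w3 cc cw; rewrite eq_sym => /negPf g1; rewrite eq_sym => /negPf g2.
rewrite eq_sym => /negPf g3; rewrite eq_sym => /negPf g4; rewrite eq_sym => /negPf g5.
case/orP => /orP[] /eqP ->.
- by rewrite Lw g1 g2 g3 eqxx muln0 !addn0 muln1.
- by rewrite f1 f5 !eqr_opp g2 eqxx !addn0 muln0 add0n muln1 mE addKn.
- by rewrite Lc f2 g4 g5 eqxx muln0 !addn0 add0n muln1.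
- by rewrite LN f3 f4 !eqr_opp f2 eqxx muln0 !add0n muln1 mE addKn.
Qed.

(** * Assembling the blocks *)

Section Assembly.
Variables (R : realType) (n : nat) (M : 'M[R]_n) (d : eigendata R).
Variables (u : 'I_(ed_p d) -> nat) (mu : forall l, 'I_(ed_s d l) -> nat).
Arguments mu : clear implicits.
Hypotheses (uM : M \in unitmx) (ssM : semisimple M) (hd : eigendata_of M d).
Hypothesis hu : forall i, (u i <= ed_h d i)%N.
Hypothesis hmu : forall l t, (mu l t <= ed_m d l t)%N.
Arguments hmu : clear implicits.
Local Notation C := R[i].
Local Notation cM := (cplx M).
Local Open Scope complex_scope.

(** One index per positive eigenvalue, per pair of conjugate non-real
    eigenvalues and per negative eigenvalue, nested as in [homspace_product]. *)
Definition block_index : finType :=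
  ({i : 'I_(ed_p d) & unit} + {l : 'I_(ed_r d) & {t : 'I_(ed_s d l) & unit}} +
   {i : 'I_(ed_q d) & unit})%type.

Local Notation RB i := (inl (inl (existT _ i tt))).
Local Notation CB l t := (inl (inr (existT _ l (existT _ t tt)))).
Local Notation NB i := (inr (existT _ i tt)).

Definition block_case (T : block_index -> Type)
    (f1 : forall i, T (RB i)) (f2 : forall l t, T (CB l t)) (f3 : forall i, T (NB i))
    (b : block_index) : T b :=
  match b return T b with
  | inl (inl (existT i tt)) => f1 i
  | inl (inr (existT l (existT t tt))) => f2 l t
  | inr (existT i tt) => f3 i
  end.

Definition root_of l t : C := polar (Num.sqrt (ed_rho d l t)) (ed_theta d l / 2).
Arguments root_of : clear implicits.
Definition neg_root i : C := Complex 0 (Num.sqrt (ed_zeta d i)).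

Definition bsize : block_index -> nat :=
  block_case (fun i => ed_h d i) (fun l t => (ed_m d l t).*2)
    (fun i => (ed_k d i).*2).
Definition bG : forall b, set 'M[R]_(bsize b) :=
  block_case (T := fun b => set 'M[R]_(bsize b))
    (fun i => @GL R (ed_h d i)) (fun l t => @GLC R (ed_m d l t))
    (fun i => @GL R (ed_k d i).*2).
Definition bH : forall b, set 'M[R]_(bsize b) :=
  block_case (T := fun b => set 'M[R]_(bsize b))
    (fun i => @GLsum R (u i) (ed_h d i - u i) (ed_h d i))
    (fun l t => @GLCsum R (mu l t) (ed_m d l t - mu l t) (ed_m d l t))
    (fun i => @GLC R (ed_k d i)).
Definition bJ : forall b, 'M[R]_(bsize b) :=
  block_case (T := fun b => 'M[R]_(bsize b))
    (fun i => 1%:M) (fun l t => complex_structure R (ed_m d l t)) (fun i => 1%:M).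
Definition bD : forall b, 'M[R]_(bsize b) :=
  block_case (T := fun b => 'M[R]_(bsize b))
    (fun i => Num.sqrt (ed_lam d i) *: signature_mx R (subnKC (hu i)))
    (fun l t => realify (root_of l t *: signature_mx C (subnKC (hmu l t))))
    (fun i => Num.sqrt (ed_zeta d i) *: complex_structure R (ed_k d i)).
Definition bspec (b : block_index) (x : C) : bool :=
  block_case (T := fun=> bool) (fun i => x == (ed_lam d i)%:C)
    (fun l t => (x == root_of l t * root_of l t) ||
                (x == conjc (root_of l t * root_of l t)))
    (fun i => x == - (ed_zeta d i)%:C) b.
Definition bindic (b : block_index) : C -> C :=
  block_case (T := fun=> (C -> C)) (fun i => eigen1 (ed_lam d i)%:C)
    (fun l t => eigen2 (root_of l t * root_of l t) (conjc (root_of l t * root_of l t)))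
    (fun i => eigen1 (- (ed_zeta d i)%:C)) b.
(** One multiplicity per block suffices: that of [- z] follows from that of [z * z]
    for [M], and that of the conjugates from [Y] being real. *)
Definition bcond (b : block_index) (Y : 'M[R]_n) : Prop :=
  block_case (T := fun=> Prop)
    (fun i => mup (Num.sqrt (ed_lam d i))%:C (char_poly (cplx Y)) = u i)
    (fun l t => mup (root_of l t) (char_poly (cplx Y)) = mu l t)
    (fun i => True) b.
(** The factors that the block [b] contributes to the characteristic polynomials
    of [M] and of the square roots under consideration. *)
Definition bpolyM (b : block_index) : {poly C} :=
  block_case (T := fun=> {poly C}) (fun i => lin_factor (ed_lam d i)%:C ^+ ed_h d i)
    (fun l t => conj_factor (ed_rho d l t) (ed_theta d l) ^+ ed_m d l t)
    (fun i => lin_factor (- (ed_zeta d i)%:C) ^+ (ed_k d i).*2) b.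
Definition bpolyY (b : block_index) : {poly C} :=
  block_case (T := fun=> {poly C})
    (fun i => lin_factor (Num.sqrt (ed_lam d i))%:C ^+ u i *
              lin_factor (- (Num.sqrt (ed_lam d i))%:C) ^+ (ed_h d i - u i))
    (fun l t =>
       conj_factor (Num.sqrt (ed_rho d l t)) (ed_theta d l / 2) ^+ mu l t *
       conj_factor (Num.sqrt (ed_rho d l t)) (ed_theta d l / 2 - pi)
         ^+ (ed_m d l t - mu l t))
    (fun i => lin_factor (neg_root i) ^+ ed_k d i *
              lin_factor (- neg_root i) ^+ ed_k d i) b.

Lemma prod_blocks (f : block_index -> {poly C}) :
  \prod_b f b = (\prod_i f (RB i)) * (\prod_l \prod_t f (CB l t)) * (\prod_i f (NB i)).
Proof.
have prod_unit (J : finType) (g : {i : J & unit} -> {poly C}) :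
    \prod_b g b = \prod_i g (existT _ i tt).
  rewrite (eq_bigr (fun i => \prod_(x : unit) g (existT _ i x))).
    by rewrite sig_big_dep /=; apply: eq_bigr => -[i x] _.
  by move=> i _; rewrite (big_pred1 tt) // => -[].
rewrite big_sumType big_sumType /= !prod_unit; congr (_ * _ * _).
rewrite (eq_bigr (fun l => \prod_(x : {t : 'I_(ed_s d l) & unit})
    f (inl (inr (existT _ l x))))).
  by rewrite sig_big_dep /=; apply: eq_bigr => -[i x] _.
by move=> l _; rewrite prod_unit.
Qed.

Let lam0 i : 0 < ed_lam d i.
Proof. by case: hd => -[[h _] _ _ _] _ _. Qed.
Let theta0 l : 0 < ed_theta d l < pi.
Proof. by case: hd => -[_ [[h _] h'] _ _] _ _; rewrite h h'. Qed.
Let rho0 l t : 0 < ed_rho d l t.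
Proof. by case: hd => -[_ _ h _] _ _; case: (h l). Qed.
Let zeta0 i : 0 < ed_zeta d i.
Proof. by case: hd => -[_ _ _ [h _]] _ _. Qed.
Let incr_inj N (a : 'I_N -> R) : pos_increasing a -> injective a.
Proof.
move=> [_ ai] i j E; case: (ltngtP i j) => [/ai|/ai|/ord_inj //].
  by rewrite E ltxx.
by rewrite E ltxx.
Qed.

Let root_sqr l t : root_of l t * root_of l t = polar (ed_rho d l t) (ed_theta d l).
Proof. exact: polar_half. Qed.

Let Re_root l t : 0 < complex.Re (root_of l t).
Proof. by apply: Re_polar_gt0; rewrite ?sqrtr_gt0. Qed.
Let Im_root l t : 0 < complex.Im (root_of l t).
Proof. by apply: Im_polar_gt0; rewrite ?sqrtr_gt0 //; exact: half_lt_pi. Qed.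
Let Im_root_sqr l t : 0 < complex.Im (root_of l t * root_of l t).
Proof. by rewrite root_sqr; exact: Im_polar_gt0. Qed.

Lemma root_sqr_real l t : root_of l t * root_of l t != conjc (root_of l t * root_of l t).
Proof.
have := Im_root_sqr t; move: (_ * _) => [a b] /= b0.
by rewrite eq_complex /= negb_and -[b == _]addr_eq0 -mulr2n mulrn_eq0 (gt_eqF b0) orbT.
Qed.

Lemma neg_root_sqr i : neg_root i * neg_root i = - (ed_zeta d i)%:C.
Proof.
rewrite /neg_root; have E : Num.sqrt (ed_zeta d i) * Num.sqrt (ed_zeta d i) = ed_zeta d i.
  by rewrite -expr2 sqr_sqrtr // ltW.
apply/eqP; rewrite eq_complex /= -{3}E.
by apply/andP; split; apply/eqP; rewrite /= ?oppr0; ring.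
Qed.

Lemma lam_sqr i : (Num.sqrt (ed_lam d i))%:C * (Num.sqrt (ed_lam d i))%:C =
  (ed_lam d i)%:C :> C.
Proof. by rewrite -rmorphM -expr2 sqr_sqrtr // ltW. Qed.

Lemma bspec_root l t x : bspec (CB l t) x =
  (x == polar (ed_rho d l t) (ed_theta d l)) ||
  (x == polar (ed_rho d l t) (- ed_theta d l)).
Proof. by rewrite -conjc_polar -root_sqr. Qed.

Let pos l t : 0 < complex.Im (polar (ed_rho d l t) (ed_theta d l)).
Proof. exact: Im_polar_gt0. Qed.
Let neg l t : complex.Im (polar (ed_rho d l t) (- ed_theta d l)) < 0.
Proof. by rewrite -conjc_polar /= oppr_lt0; exact: pos. Qed.
Let cplxIm l t y : (y == polar (ed_rho d l t) (ed_theta d l)) ||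
    (y == polar (ed_rho d l t) (- ed_theta d l)) -> complex.Im y != 0.
Proof. by case/orP => /eqP ->; rewrite ?(gt_eqF (pos t)) ?(lt_eqF (neg t)). Qed.

(** Real and imaginary parts separate the three kinds of blocks; within a kind the
    eigenvalues are strictly increasing. *)
Lemma bspec_disjoint b c x : bspec b x -> bspec c x -> b = c.
Proof.
have reR (a : R) : complex.Im (a%:C : C) = 0 by [].
have reN (a : R) : complex.Im (- (a%:C) : C) = 0 by rewrite /= oppr0.
case: b => [[[i []]|[l [t []]]]|[i []]]; case: c => [[[i' []]|[l' [t' []]]]|[i' []]];
  rewrite ?bspec_root.
- move=> /eqP -> /eqP /complexI E.
  by case: hd => -[h _ _ _] _ _; rewrite (incr_inj h E).
- by move=> /eqP -> /cplxIm; rewrite reR eqxx.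
- move=> /eqP -> /eqP E; have := congr1 (@complex.Re R) E => /= E'.
  by have := lam0 i; rewrite E' oppr_gt0 ltNge ltW.
- by move=> + /eqP E; rewrite E => /cplxIm; rewrite reR eqxx.
- move=> h1 h2.
  have [Er Et] : ed_rho d l t = ed_rho d l' t' /\ ed_theta d l = ed_theta d l'.
    apply: polar_inj => //.
    case/orP: h1 => /eqP E1; case/orP: h2 => /eqP E2.
    + by rewrite -E1 E2.
    + by have := pos t; rewrite -E1 E2 ltNge ltW // neg.
    + by have := neg t; rewrite -E1 E2 ltNge ltW // pos.
    + rewrite -[ed_theta d l]opprK -[ed_theta d l']opprK.
      by rewrite -(conjc_polar _ (- ed_theta d l)) -(conjc_polar _ (- ed_theta d l')) -E1 -E2.
  case: hd => -[_ [ht _] hr _] _ _; have El := incr_inj ht Et.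
  by subst l'; rewrite (incr_inj (hr l) Er).
- by move=> + /eqP E; rewrite E => /cplxIm; rewrite reN eqxx.
- move=> /eqP -> /eqP E; have := congr1 (@complex.Re R) E => /= E'.
  by have := lam0 i'; rewrite -E' oppr_gt0 ltNge ltW.
- by move=> /eqP -> /cplxIm; rewrite reN eqxx.
- move=> /eqP -> /eqP /oppr_inj /complexI E.
  by case: hd => -[_ _ _ h] _ _; rewrite (incr_inj h E).
Qed.

Lemma bindicE b x : bindic b x = (bspec b x)%:R.
Proof.
case: b => [[[i []]|[l [t []]]]|[i []]]; rewrite /bindic /bspec /block_case //.
have := root_sqr_real t; rewrite /eigen2; move: (_ * _) => z.
have [-> zc|_ _] := eqVneq x z; first by rewrite (negPf zc) addr0.
by rewrite add0r.
Qed.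

Lemma lin_factor_neq0 (z : C) : lin_factor z != 0.
Proof. by rewrite /lin_factor polyXsubC_eq0. Qed.

Lemma conj_factor_neq0 r t : conj_factor r t != 0 :> {poly C}.
Proof. by rewrite /conj_factor mulf_neq0 ?lin_factor_neq0. Qed.

Lemma mup_lin_factor (x z : C) k : mup x (lin_factor z ^+ k) = (k * (z == x))%N.
Proof. by rewrite mup_exp ?lin_factor_neq0 // /lin_factor mup_lin. Qed.

Lemma mup_conj_factor (x : C) r t k :
  mup x (conj_factor r t ^+ k) = (k * ((polar r t == x) + (polar r (- t) == x)))%N.
Proof.
rewrite mup_exp ?conj_factor_neq0 // /conj_factor mupM ?lin_factor_neq0 //.
by rewrite /lin_factor !mup_lin.
Qed.

Lemma bpolyM_neq0 b : bpolyM b != 0.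
Proof.
by case: b => [[[i []]|[l [t []]]]|[i []]] /=;
  rewrite expf_neq0 ?lin_factor_neq0 ?conj_factor_neq0.
Qed.

Lemma bpolyY_neq0 b : bpolyY b != 0.
Proof.
by case: b => [[[i []]|[l [t []]]]|[i []]] /=;
  rewrite mulf_neq0 // expf_neq0 ?lin_factor_neq0 ?conj_factor_neq0.
Qed.

Lemma char_polyM : char_poly cM = \prod_b bpolyM b.
Proof. by rewrite prod_blocks; case: hd => _ _ ->. Qed.

Lemma mup_bpolyM_out b x : ~~ bspec b x -> mup x (bpolyM b) = 0%N.
Proof.
case: b => [[[i []]|[l [t []]]]|[i []]]; rewrite ?bspec_root /=.
- by rewrite mup_lin_factor eq_sym => /negPf ->; rewrite muln0.
- rewrite negb_or => /andP[h1 h2]; rewrite mup_conj_factor.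
  rewrite [polar _ _ == x]eq_sym (negPf h1) [polar _ _ == x]eq_sym (negPf h2).
  by rewrite muln0.
- by rewrite mup_lin_factor eq_sym => /negPf ->; rewrite muln0.
Qed.

Lemma mup_bpolyM b x : bspec b x -> mup x (char_poly cM) = mup x (bpolyM b).
Proof.
move=> bx; rewrite char_polyM mup_prod; last by move=> c _; exact: bpolyM_neq0.
rewrite (bigD1 b) //= big1 ?addn0 // => c cb; apply: mup_bpolyM_out.
by apply: contra cb => cx; rewrite (bspec_disjoint bx cx).
Qed.

Lemma spectrum_bspec x : mup x (char_poly cM) != 0%N -> exists b, bspec b x.
Proof.
rewrite char_polyM mup_prod; last by move=> c _; exact: bpolyM_neq0.
rewrite sum_nat_eq0 negb_forall => /existsP[b /=] h; exists b.
by apply: contraTT h => nb; rewrite mup_bpolyM_out.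
Qed.

Lemma mup_lam i : mup (ed_lam d i)%:C (char_poly cM) = ed_h d i.
Proof. by rewrite (@mup_bpolyM (RB i)) /= ?eqxx // mup_lin_factor eqxx muln1. Qed.

Lemma mup_root_sqr l t : mup (root_of l t * root_of l t) (char_poly cM) = ed_m d l t.
Proof.
rewrite (@mup_bpolyM (CB l t)); last by rewrite /bspec /block_case eqxx.
rewrite /bpolyM /block_case mup_conj_factor -conjc_polar -root_sqr.
by rewrite eqxx eq_sym (negPf (root_sqr_real t)) addn0 muln1.
Qed.

Lemma mup_zeta i : mup (- (ed_zeta d i)%:C) (char_poly cM) = (ed_k d i).*2.
Proof. by rewrite (@mup_bpolyM (NB i)) /= ?eqxx // mup_lin_factor eqxx muln1. Qed.

Let conjcN (z : C) : conjc (- z) = - conjc z. Proof. by case: z. Qed.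

Lemma SR_indexE Y : SR_index M u mu Y <->
  SR M Y /\ char_poly (cplx Y) = \prod_b bpolyY b.
Proof. by rewrite prod_blocks. Qed.

Lemma mup_bpolyY_real i z : mup z (bpolyY (RB i)) =
  (u i * ((Num.sqrt (ed_lam d i))%:C == z) +
   (ed_h d i - u i) * (- (Num.sqrt (ed_lam d i))%:C == z))%N.
Proof.
rewrite /bpolyY /block_case mupM ?expf_neq0 ?lin_factor_neq0 //.
by rewrite !mup_lin_factor.
Qed.

Lemma mup_bpolyY_root l t z : mup z (bpolyY (CB l t)) =
  (mu l t * ((root_of l t == z) + (conjc (root_of l t) == z)) +
   (ed_m d l t - mu l t) * ((- root_of l t == z) + (- conjc (root_of l t) == z)))%N.
Proof.
rewrite /bpolyY /block_case mupM ?expf_neq0 ?conj_factor_neq0 //.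
rewrite !mup_conj_factor -!conjc_polar polar_subpi conjcN.
by rewrite -[polar _ _]/(root_of l t).
Qed.

Lemma mup_bpolyY_neg i z : mup z (bpolyY (NB i)) =
  (ed_k d i * (neg_root i == z) + ed_k d i * (- neg_root i == z))%N.
Proof.
rewrite /bpolyY /block_case mupM ?expf_neq0 ?lin_factor_neq0 //.
by rewrite !mup_lin_factor.
Qed.

Lemma mup_bpolyY_out b z : ~~ bspec b (z * z) -> mup z (bpolyY b) = 0%N.
Proof.
case: b => [[[i []]|[l [t []]]]|[i []]] nb.
- have h (r : C) : r * r = (ed_lam d i)%:C -> (r == z) = false.
    by move=> rr; apply: contraNF nb => /eqP <-; rewrite /bspec /block_case rr eqxx.
  by rewrite mup_bpolyY_real !h ?mulrNN ?lam_sqr // !muln0.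
- have h (r : C) : r * r = root_of l t * root_of l t -> (r == z) = false.
    by move=> rr; apply: contraNF nb => /eqP <-; rewrite /bspec /block_case rr eqxx.
  have h' (r : C) : r * r = conjc (root_of l t * root_of l t) -> (r == z) = false.
    move=> rr; apply: contraNF nb => /eqP <-.
    by rewrite /bspec /block_case rr eqxx orbT.
  have cc : conjc (root_of l t) * conjc (root_of l t) = conjc (root_of l t * root_of l t).
    by rewrite rmorphM.
  rewrite mup_bpolyY_root (h _ erefl) (h (- root_of l t)) ?mulrNN // (h' _ cc).
  by rewrite (h' (- _)) ?mulrNN ?cc // !muln0.
- have h (r : C) : r * r = - (ed_zeta d i)%:C -> (r == z) = false.
    by move=> rr; apply: contraNF nb => /eqP <-; rewrite /bspec /block_case rr eqxx.
  by rewrite mup_bpolyY_neg !h ?mulrNN ?neg_root_sqr // !muln0.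
Qed.

Lemma mup_prod_bpolyY b z : bspec b (z * z) ->
  mup z (\prod_b bpolyY b) = mup z (bpolyY b).
Proof.
move=> bz; rewrite mup_prod; last by move=> c _; exact: bpolyY_neq0.
rewrite (bigD1 b) //= big1 ?addn0 // => c cb; apply: mup_bpolyY_out.
by apply: contra cb => cz; rewrite (bspec_disjoint bz cz).
Qed.

Let neq_opp (z : C) : z != 0 -> z != - z.
Proof. by move=> z0; rewrite -addr_eq0 -mulr2n mulrn_eq0. Qed.

Let sqrt_lam_neq0 i : (Num.sqrt (ed_lam d i))%:C != 0 :> C.
Proof. by rewrite eq_complex /= eqxx andbT gt_eqF // sqrtr_gt0. Qed.

Let root_quadrant l t : [/\ root_of l t != 0, root_of l t != - root_of l t,
  root_of l t != conjc (root_of l t) & root_of l t != - conjc (root_of l t)].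
Proof. exact: quadrant_neq. Qed.

Let neg_root_neq0 i : neg_root i != 0.
Proof. by rewrite eq_complex /= eqxx /= gt_eqF // sqrtr_gt0. Qed.

Section Multiplicity.
Variable Y : 'M[R]_n.
Hypothesis MY : SR M Y.
Local Notation L z := (mup z (char_poly (cplx Y))).

Let dY : diagonalizable (cplx Y).
Proof. exact: cplx_diagonalizable_sqrt uM ssM MY. Qed.

Let YY : cplx Y *m cplx Y = cM.
Proof. by rewrite -cplxM MY. Qed.

Let L_sum z : z != 0 -> mup (z * z) (char_poly cM) = (L z + L (- z))%N.
Proof. by move=> z0; rewrite -YY; apply: mup_sqr => //; exact: neq_opp. Qed.

Let L_le z : (L z <= mup (z * z) (char_poly cM))%N.
Proof. by rewrite -YY; exact: mup_sqr_le. Qed.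

Let L_conj z : L (conjc z) = L z. Proof. exact: mup_conjc. Qed.

Lemma mup_of_bcond b z : bcond b Y -> bspec b (z * z) -> L z = mup z (bpolyY b).
Proof.
case: b => [[[i []]|[l [t []]]]|[i []]]; rewrite /bcond /bspec /block_case.
- move=> Lu; rewrite -lam_sqr mup_bpolyY_real.
  have c0 := sqrt_lam_neq0 i; have cN := neq_opp c0.
  have LN : L (- (Num.sqrt (ed_lam d i))%:C) = (ed_h d i - u i)%N.
    by have := L_sum c0; rewrite lam_sqr mup_lam Lu => ->; rewrite addKn.
  exact: (@two_roots_count C (Num.sqrt (ed_lam d i))%:C _ _ (fun z => L z) cN Lu LN z).
- move=> Lmu; have [w0 w1 w2 w3] := root_quadrant t.
  have := L_sum w0; rewrite mup_root_sqr Lmu mup_bpolyY_root.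
  have Lc : L (conjc (root_of l t)) = mu l t by rewrite L_conj.
  have LN : L (- conjc (root_of l t)) = L (- root_of l t).
    by rewrite -(L_conj (- root_of l t)) conjcN.
  have cc : conjc (root_of l t) != - conjc (root_of l t).
    by apply: neq_opp; rewrite conjc_eq0.
  have cw : conjc (root_of l t) != - root_of l t.
    by apply: contra w3 => /eqP E; rewrite E opprK.
  have E2 : conjc (root_of l t * root_of l t) =
    conjc (root_of l t) * conjc (root_of l t) by rewrite rmorphM.
  rewrite E2 => mE.
  exact: (@four_roots_count C (root_of l t) (conjc (root_of l t)) (ed_m d l t)
    (mu l t) (fun z => L z) w1 w2 w3 cc cw Lmu Lc mE LN z).
- move=> _; rewrite -neg_root_sqr mup_bpolyY_neg.
  have v0 := neg_root_neq0 i; have vN := neq_opp v0.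
  have cv : conjc (neg_root i) = - neg_root i.
    by apply/eqP; rewrite eq_complex /= oppr0 !eqxx.
  have LN : L (- neg_root i) = L (neg_root i) by rewrite -cv L_conj.
  have kE : ed_k d i = L (neg_root i).
    by have := L_sum v0; rewrite neg_root_sqr mup_zeta LN addnn => /double_inj.
  rewrite -kE in LN.
  exact: (@two_roots_count C (neg_root i) _ _ (fun z => L z) vN (esym kE) LN z).
Qed.

(** A monic complex polynomial is determined by its multiplicities, and those of
    [Y] vanish outside the square roots of the spectrum of [M]. *)
Lemma SR_index_bcond : SR_index M u mu Y <-> forall b, bcond b Y.
Proof.
rewrite SR_indexE; split=> [[_ E] b|cond].
  case: b => [[[i []]|[l [t []]]]|[i []]] //; rewrite /bcond /block_case E.
  - rewrite (@mup_prod_bpolyY (RB i)); last by rewrite /bspec /block_case lam_sqr.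
    by rewrite mup_bpolyY_real eqxx eq_sym (negPf (neq_opp (sqrt_lam_neq0 i)))
      muln1 muln0 addn0.
  - rewrite (@mup_prod_bpolyY (CB l t)); last by rewrite /bspec /block_case eqxx.
    have [w0 w1 w2 w3] := root_quadrant t.
    rewrite mup_bpolyY_root eqxx ![_ == root_of l t]eq_sym.
    by rewrite (negPf w1) (negPf w2) (negPf w3) addn0 muln0 addn0 muln1.
split=> //; apply: eq_monic_mup.
- exact: char_poly_monic.
- apply: monic_prod => b _.
  have lm (w : C) : lin_factor w \is monic by exact: monicXsubC.
  have cm r th : (conj_factor r th : {poly C}) \is monic by apply: rpredM; exact: lm.
  by case: b => [[[i []]|[l [t []]]]|[i []]]; rewrite /bpolyY /block_case;
     apply: rpredM; apply: rpredX; first [exact: lm | exact: cm].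
move=> z; have [[b bz]|nb] := pselect (exists b, bspec b (z * z)); last first.
  have out b : ~~ bspec b (z * z) by apply/negP => bz; apply: nb; exists b.
  rewrite mup_prod; last by move=> c _; exact: bpolyY_neq0.
  rewrite big1 => [|b _]; last exact: mup_bpolyY_out.
  apply/eqP; rewrite -leqn0; apply: leq_trans (L_le z) _; rewrite leqn0.
  by apply/negPn/negP => /spectrum_bspec.
by rewrite (mup_of_bcond (cond b) bz) (mup_prod_bpolyY bz).
Qed.

End Multiplicity.

Let dM : diagonalizable cM. Proof. exact: ssM. Qed.

Let blocks_exist : forall b, exists A : 'M[R]_(n, bsize b) * 'M[R]_(bsize b, n),
  block_of M (@bG b) (bJ b) (bD b) (bindic b) (bcond b) A.1 A.2.
Proof.
case=> [[[i []]|[l [t []]]]|[i []]].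
- have [A [B h]] := real_block uM ssM (subnKC (hu i)) (lam0 i) (mup_lam i).
  by exists (A, B).
- have [w0 _ _ _] := root_quadrant t.
  have [A [B h]] := complex_block uM ssM (subnKC (hmu l t)) w0 (root_sqr_real t)
    (mup_root_sqr t).
  by exists (A, B).
- have [A [B h]] := negative_block ssM (zeta0 i) (mup_zeta i).
  by exists (A, B).
Qed.

Lemma block_stabilizer_pair b : stabilizer_pair (@bG b) (@bH b) (bJ b) (bD b).
Proof.
case: b => [[[i []]|[l [t []]]]|[i []]].
- by apply: real_pair; rewrite gt_eqF // sqrtr_gt0.
- by apply: complex_pair; have [] := root_quadrant t.
- by apply: negative_pair; rewrite gt_eqF // sqrtr_gt0.
Qed.

(** The spectral projections of [M] split the space because their indicators are
    disjoint and add up to [1] on the spectrum. *)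
Lemma SR_index_decomposition :
  exists (A : forall b, 'M[R]_(n, bsize b)) (B : forall b, 'M[R]_(bsize b, n)),
  block_decomposition M (SR_index M u mu) (@bG) (@bH) bJ bD A B.
Proof.
have [AB hAB] := dependent_pick blocks_exist.
pose A b := (AB b).1; pose B b := (AB b).2.
have BA b : B b *m A b = 1%:M by case: (hAB b).
have EAB b : cplx (A b *m B b) = fmx (bindic b) cM by case: (hAB b).
have comm X b : X *m M = M *m X -> X *m (A b *m B b) = A b *m B b *m X.
  move=> cX; apply: cplx_inj; rewrite !cplxM -cplxM EAB.
  by apply: fmx_comm => //; rewrite -!cplxM cX.
have ortho b c : b != c -> B b *m A c = 0.
  move=> bc; have E : A b *m B b *m (A c *m B c) = 0.
    apply: cplx_inj; rewrite cplxM !EAB fmxM // [RHS]map_mx0.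
    rewrite (@eq_fmx _ _ _ (fun=> 0)) ?fmx_const ?raddf0 // => x.
    rewrite !bindicE -natrM mulnb; case bx: (bspec b x) => //=.
    case cx: (bspec c x) => //.
    by rewrite (bspec_disjoint bx cx) eqxx in bc.
  have -> : B b *m A c = B b *m (A b *m B b *m (A c *m B c)) *m A c.
    by rewrite !mulmxA BA mul1mx -mulmxA BA mulmx1.
  by rewrite E mulmx0 mul0mx.
have sumAB : \sum_b A b *m B b = 1%:M.
  apply: cplx_inj; rewrite cplx1 /cplx map_mx_sum.
  rewrite (eq_bigr (fun b => fmx (bindic b) cM)) => [|b _]; last exact: EAB.
  rewrite fmx_sum // -(fmx_const 1 dM); apply: fmx_spectrum => // x.
  move=> /spectrum_bspec[b bx]; rewrite (bigD1 b) //= bindicE bx big1 ?addr0 // => c cb.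
  rewrite bindicE; case cx: (bspec c x) => //.
  by rewrite (bspec_disjoint bx cx) eqxx in cb.
exists A, B; split=> //.
- exact: block_stabilizer_pair.
- move=> X b c cX bc.
  have -> : B b *m X *m A c = B b *m (A b *m B b *m X) *m A c.
    by rewrite !mulmxA BA mul1mx.
  by rewrite -comm // !mulmxA -mulmxA ortho // mulmx0.
- by move=> X b cX; case: (hAB b) => _ _ h _ _; exact: h.
- rewrite /glue -[RHS]mul1mx -sumAB mulmx_suml; apply: eq_bigr => b _.
  have <- : B b *m M *m A b = bD b *m bD b by case: (hAB b).
  have -> : A b *m (B b *m M *m A b) *m B b = A b *m (B b *m (M *m (A b *m B b))).
    by rewrite !mulmxA.
  by rewrite comm // !mulmxA -[A b *m B b *m A b]mulmxA BA mulmx1.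
- move=> Y; split=> [SY|[MY h]].
    have MY : SR M Y by case: SY.
    split=> // b; have /(SR_index_bcond MY)/(_ b) := SY.
    by case: (hAB b) => _ _ _ _ /(_ Y MY)[_ +]; apply.
  apply/(SR_index_bcond MY) => b.
  by case: (hAB b) => _ _ _ _ /(_ Y MY)[+ _]; apply; exact: h.
Qed.

Theorem SR_index_diffeo :
  diffeomorphic (submfd (SR_index M u mu)) (homspace_product u mu).
Proof.
have [A [B bd]] := SR_index_decomposition.
pose X b := homspace (@bG b) (@bH b).
have plr := @product_like_prod R (ed_p d) (fun=> unit)
  (fun x => X (inl (inl x))) _ _ _ (fun i => product_like_unit (fun x => X (inl (inl (existT _ i x))))).
have plc := @product_like_prod R (ed_r d) (fun l => {t : 'I_(ed_s d l) & unit})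
  (fun x => X (inl (inr x))) _ _ _ (fun l =>
     @product_like_prod R (ed_s d l) (fun=> unit)
       (fun x => X (inl (inr (existT _ l x)))) _ _ _ (fun t => product_like_unit
         (fun x => X (inl (inr (existT _ l (existT _ t x))))))).
have pln := @product_like_prod R (ed_q d) (fun=> unit)
  (fun x => X (inr x)) _ _ _ (fun i => product_like_unit (fun x => X (inr (existT _ i x)))).
have pl1 := @product_like_pair R _ _ (fun x => X (inl x)) _ _ _ _ _ _ plr plc.
have pl := @product_like_pair R _ _ X _ _ _ _ _ _ pl1 pln.
exact: (blocks_diffeo uM bd pl).
Qed.

End Assembly.

Theorem theorem2p5 (R : realType) (n : nat) (M : 'M[R]_n)
    (hM : M \in unitmx)
    (hss : semisimple M)
    (hev : even_negative_eigenvalues M) :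
  (forall Y : 'M[R]_n, SR M Y ->
     let S := connected_component (SR M) Y in
     [/\ closed_in (@GL R n) S,
         semi_riemannian_submanifold (@trace_metric R n) S,
         totally_geodesic (@trace_metric R n) S &
         homogeneous (@trace_metric R n) S])
  /\
  (forall d : eigendata R, eigendata_of M d ->
   forall (u : 'I_(ed_p d) -> nat) (mu : forall l, 'I_(ed_s d l) -> nat),
     (forall i, (u i <= ed_h d i)%N) ->
     (forall l t, (mu l t <= ed_m d l t)%N) ->
     diffeomorphic (submfd (SR_index M u mu)) (homspace_product u mu)).
Proof.
split=> [Y _ S|d hd u mu hu hmu]; first exact: component_geometry hss hM Y.
exact: SR_index_diffeo hM hss hd hu hmu.
Qed.
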